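(* Let $\mathcal{S}$ be the set of all pairs $(\mathfrak{m},\xi)$, where $\mathfrak{m}$ is a measure on $\mathbb{R}$ satisfying $\int_{\mathbb{R}}e^{-\varepsilon x^2}\,\mathfrak{m}(dx)<\infty$ for every $\varepsilon>0$ and $\{\xi(t), t\in\mathbb{R}^d\}$ is a Gaussian process, with the property that the particle system $\mathit{GS}(\mathfrak{m},\xi)$ is stationary. Then $$\mathcal{S}=\mathcal{S}_1\cup\mathcal{S}_2\cup\mathcal{S}_3,$$ where the sets $\mathcal{S}_1,\mathcal{S}_2,\mathcal{S}_3$ are defined as follows: 1. The set $\mathcal{S}_1$ consists of all pairs $(\mathfrak{m},\xi)$, where $\mathfrak{m}$ is an arbitrary measure on $\mathbb{R}$ satisfying $\int_{\mathbb{R}}e^{-\varepsilon x^2}\,\mathfrak{m}(dx)<\infty$ for every $\varepsilon>0$, and $\{\xi(t), t\in\mathbb{R}^d\}\stackrel{d}{=}\{W(t)+c, t\in\mathbb{R}^d\}$ for some stationary Gaussian process $\{W(t), t\in\mathbb{R}^d\}$ and some $c\in\mathbb{R}$. 2. The set $\mathcal{S}_2$ consists of all pairs $(\mathfrak{m},\xi)$, where $\mathfrak{m}=\alpha\mathfrak{e}_0$ and $\{\xi(t), t\in\mathbb{R}^d\}\stackrel{d}{=}\{W(t)+f(t)+c, t\in\mathbb{R}^d\}$ for some $\alpha>0$, $c\in\mathbb{R}$, a Gaussian process $\{W(t), t\in\mathbb{R}^d\}$ with stationary increments, and an additive function $f:\mathbb{R}^d\to\mathbb{R}$. 3. The set $\mathcal{S}_3$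 consists of all pairs $(\mathfrak{m},\xi)$, where $\mathfrak{m}=\alpha\mathfrak{e}_{\lambda}$ and $\{\xi(t), t\in\mathbb{R}^d\}\stackrel{d}{=}\{W(t)-\lambda\sigma^2(t)/2+c, t\in\mathbb{R}^d\}$ for some $\alpha>0$, $\lambda\neq 0$, $c\in\mathbb{R}$, and some Gaussian process $\{W(t), t\in\mathbb{R}^d\}$ with stationary increments and variance $\sigma^2(t)$.
   Context: Gaussian system: let $\mathfrak{m}$ be a measure on $\mathbb{R}$ with $\int_{\mathbb{R}}e^{-\varepsilon x^2}\,\mathfrak{m}(dx)<\infty$ for every $\varepsilon>0$, and let $\{\xi(t),t\in\mathbb{R}^d\}$ be a real-valued Gaussian process (its mean is not assumed to be zero). Let $\{U_i, i\in\mathbb{N}\}$ be a Poisson point process on $\mathbb{R}$ with intensity measure $\mathfrak{m}$ (the case of finite $\mathfrak{m}$, in which a.s. only finitely many points exist, is not excluded), and, independently, let $\xi_i$, $i\in\mathbb{N}$, be independent copies of $\xi$. Put $V_i(t)=U_i+\xi_i(t)$. The random collection of functions $\mathfrak{P}=\{V_i, i\in\mathbb{N}\}$ is called the (independent) Gaussian particle system generated by $(\mathfrak{m},\xi)$ and denoted $\mathit{GS}(\mathfrak{m},\xi)$. For $t_1,\ldots,t_n\in\mathbb{R}^d$ let $\mathfrak{P}_{t_1,\ldots,t_n}=\{(V_i(t_1),\ldots,V_i(t_n)), i\in\mathbb{N}\}$, a point process on $\mathbb{R}^n$. The system $\mathfrak{P}$ is called stationary if for all $n\in\mathbb{N}$,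 $t_1,\ldots,t_n\in\mathbb{R}^d$ and $h\in\mathbb{R}^d$, $\mathfrak{P}_{t_1+h,\ldots,t_n+h}\stackrel{d}{=}\mathfrak{P}_{t_1,\ldots,t_n}$ as point processes on $\mathbb{R}^n$. Notation and conventions: $\mathfrak{e}_\lambda(dx)=e^{-\lambda x}\,dx$ for $\lambda\in\mathbb{R}$ (so $\mathfrak{e}_0$ is Lebesgue measure). A function $f:\mathbb{R}^d\to\mathbb{R}$ is additive if $f(t_1+t_2)=f(t_1)+f(t_2)$ for all $t_1,t_2\in\mathbb{R}^d$. A process $W$ has stationary increments if the law of $\{W(t+h)-W(h),t\in\mathbb{R}^d\}$ does not depend on $h\in\mathbb{R}^d$. All stationary processes and processes with stationary increments are always supposed to have zero mean. The variance of $W$ is $\sigma^2(t)=\operatorname{Var}W(t)$. Equality in law of processes, $\stackrel{d}{=}$, means equality of finite-dimensional distributions.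
   Formalization: The measure 𝔪 is assumed to be nonzero: for 𝔪 = 0 the particle system is a.s. empty, hence stationary for every Gaussian process ξ, so the stated equality of sets fails in that case. *)

(* Defs.v *)
From HB Require Import structures.
From mathcomp Require Import all_boot all_order all_algebra.
From mathcomp Require Import all_classical all_reals all_analysis.
From mathcomp Require Import measurable_realfun.

Set Implicit Arguments.
Unset Strict Implicit.
Unset Printing Implicit Defensive.

Import Order.TTheory GRing.Theory Num.Theory.
Import numFieldNormedType.Exports.

Local Open Scope classical_set_scope.
Local Open Scope ring_scope.

Section laws.
Context {R : realType} {d1 d2 dS : measure_display}
  {T1 : measurableType d1} {T2 : measurableType d2} {S : measurableType dS}.

Definition eq_law (P1 : probability T1 R) (X : T1 -> S)
    (P2 : probability T2 R) (Y : T2 -> S) : Prop :=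
  forall A : set S, measurable A -> P1 (X @^-1` A) = P2 (Y @^-1` A).

End laws.

Section fdd.
Context {R : realType} {d1 d2 dS : measure_display}
  {T1 : measurableType d1} {T2 : measurableType d2} {S : measurableType dS}.

(* [n.-tuple S] carries the product sigma-algebra; for [S = R] this is the
   Borel sigma-algebra of R^n. *)
Definition eq_fdd (I : Type) (P1 : probability T1 R) (X : I -> T1 -> S)
    (P2 : probability T2 R) (Y : I -> T2 -> S) : Prop :=
  forall (n : nat) (t : n.-tuple I),
    eq_law (S := n.-tuple S)
      P1 (fun w => [tuple X (tnth t k) w | k < n])
      P2 (fun w => [tuple Y (tnth t k) w | k < n]).

End fdd.

Section real_processes.
Context {R : realType} {dT : measure_display} {T : measurableType dT}.

(* [sigma] is the standard deviation.  The degenerate law is split off because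
   [normal_prob mu 0] is the uniform law on [0, 1]. *)
Definition gaussian_variable (P : probability T R) (X : T -> R) : Prop :=
  exists mu sigma : R, forall A : set R, measurable A ->
    P (X @^-1` A) = if sigma == 0 then \d_mu A else normal_prob mu sigma A.

Definition gaussian_process (I : Type) (P : probability T R)
    (X : I -> T -> R) : Prop :=
  forall (n : nat) (t : n.-tuple I) (a : 'I_n -> R),
    gaussian_variable P (fun w => \sum_(k < n) a k * X (tnth t k) w).

Definition centered (I : Type) (P : probability T R) (X : I -> T -> R) : Prop :=
  forall t : I, ('E_P[X t] = 0)%E.

(* Both notions of stationarity include the zero mean condition. *)
Definition stationary_process (I : zmodType) (P : probability T R)
    (X : I -> T -> R) : Prop :=
  centered P X /\ forall h : I, eq_fdd P (fun t => X (t + h)) P X.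

Definition stationary_increments (I : zmodType) (P : probability T R)
    (X : I -> T -> R) : Prop :=
  centered P X /\
  forall h h' : I, eq_fdd P (fun t w => X (t + h) w - X h w)
                          P (fun t w => X (t + h') w - X h' w).

End real_processes.

Section independence.
Context {R : realType} {dT : measure_display} {T : measurableType dT}.

Definition mutually_independent (P : probability T R) (I : choiceType)
    (F : I -> set (set T)) : Prop :=
  forall (s : seq I) (A : I -> set T), uniq s ->
    (forall i, i \in s -> F i (A i)) ->
    P (\bigcap_(i in [set` s]) A i) = (\prod_(i <- s) P (A i))%E.

End independence.

Section point_processes.
Context {R : realType} {dT dS : measure_display}
  {T : measurableType dT} {S : measurableType dS}.

(* A random, possibly finite, collection of points of S is encoded by a sequence
   Z of random points and a sequence E of events: the i-th point is present
   exactly on the event E i, and Z i is irrelevant elsewhere.  [npoints E Z B]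
   is the number of points in B, counted with multiplicity. *)
Definition npoints (E : nat -> set T) (Z : nat -> T -> S) (B : set S)
    (w : T) : \bar R :=
  (\sum_(0 <= i <oo) (\1_(E i `&` Z i @^-1` B) w)%:E)%E.

(* The second argument of [poisson_prob] is a dummy; [poisson_prob 0 _] is the
   point mass at 0. *)
Definition poisson_process (m : {measure set S -> \bar R})
    (P : probability T R) (E : nat -> set T) (Z : nat -> T -> S) : Prop :=
  (forall (B : set S) (k : nat), measurable B -> (m B < +oo)%E ->
     P [set w | npoints E Z B w = (k%:R)%:E] =
     poisson_prob (fine (m B)) 0 [set k]) /\
  (forall (n : nat) (B : 'I_n -> set S),
     (forall j, measurable (B j)) -> trivIset setT B ->
     mutually_independent P
       (fun j => preimage_set_system setT (npoints E Z (B j))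
          measurable)).

(* Equality in law as random counting measures. *)
Definition eq_law_points (P : probability T R) (E : nat -> set T)
    (Z Z' : nat -> T -> S) : Prop :=
  forall (n : nat) (B : 'I_n -> set S), (forall j, measurable (B j)) ->
    eq_law (S := n.-tuple (\bar R))
      P (fun w => [tuple npoints E Z (B j) w | j < n])
      P (fun w => [tuple npoints E Z' (B j) w | j < n]).

End point_processes.

(* A real-valued process indexed by R^d, with its probability space. *)
Record process (R : realType) (d : nat) := Process {
  proc_disp : measure_display ;
  proc_space : measurableType proc_disp ;
  proc_prob : probability proc_space R ;
  proc_val :> 'rV[R]_d -> proc_space -> R ;
  proc_measurable : forall t, measurable_fun setT (proc_val t) }.

(* A realization of GS(m, xi).  The i-th particle is t |-> U_i + xi_i(t), and
   the starting point U_i is present exactly on the event [gs_present i]. *)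
Record gaussian_system (R : realType) (d : nat)
    (m : {measure set R -> \bar R}) (xi : process R d) := GaussianSystem {
  gs_disp : measure_display ;
  gs_space : measurableType gs_disp ;
  gs_prob : probability gs_space R ;
  gs_present : nat -> set gs_space ;
  gs_start : nat -> {RV gs_prob >-> R} ;
  gs_copy : nat -> 'rV[R]_d -> {RV gs_prob >-> R} ;
  gs_present_measurable : forall i, measurable (gs_present i) ;
  gs_start_poisson : poisson_process m gs_prob gs_present gs_start ;
  gs_copy_law : forall i, eq_fdd gs_prob (gs_copy i) (proc_prob xi) xi ;
  (* [None] stands for the point process of the U_i, [Some i] for xi_i. *)
  gs_independent : mutually_independent gs_prob (fun o : option nat =>
    if o is Some i then
      <<s [set gs_copy i t @^-1` B | t in [set: 'rV[R]_d] & B in measurable] >>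
    else
      <<s [set gs_present i `&` gs_start i @^-1` B |
             i in [set: nat] & B in measurable] >>) }.

Arguments gs_present {R d m xi} g i _.

Section systems.
Context {R : realType} {d : nat}.
Implicit Types (m : {measure set R -> \bar R}) (xi : process R d).

Definition particle m xi (G : gaussian_system m xi) (i : nat) (t : 'rV[R]_d)
    (w : gs_space G) : R :=
  gs_start G i w + gs_copy G i t w.

Definition stationary_system m xi (G : gaussian_system m xi) : Prop :=
  forall (n : nat) (t : n.-tuple 'rV[R]_d) (h : 'rV[R]_d),
    eq_law_points (S := n.-tuple R) (gs_prob G) (gs_present G)
      (fun i w => [tuple particle i (tnth t k + h) w | k < n])
      (fun i w => [tuple particle i (tnth t k) w | k < n]).

Definition admissible_intensity m : Prop :=
  forall eps : R, 0 < eps -> (\int[m]_x (expR (- (eps * x ^+ 2)))%:E < +oo)%E.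

Definition exp_measure (lam : R) (A : set R) : \bar R :=
  (\int[lebesgue_measure]_(x in A) (expR (- (lam * x)))%:E)%E.

Definition is_scaled_exp_measure m (alpha lam : R) : Prop :=
  forall A : set R, measurable A -> m A = (alpha%:E * exp_measure lam A)%E.

Definition additive_function (f : 'rV[R]_d -> R) : Prop :=
  forall t1 t2, f (t1 + t2) = f t1 + f t2.

Definition S1 m xi : Prop :=
  admissible_intensity m /\
    exists (W : process R d) (c : R),
      [/\ gaussian_process (proc_prob W) W,
          stationary_process (proc_prob W) W &
          eq_fdd (proc_prob xi) xi (proc_prob W) (fun t w => W t w + c)].

Definition S2 m xi : Prop :=
  exists (alpha c : R) (W : process R d) (f : 'rV[R]_d -> R),
    [/\ 0 < alpha /\ is_scaled_exp_measure m alpha 0,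
        gaussian_process (proc_prob W) W,
        stationary_increments (proc_prob W) W,
        additive_function f &
        eq_fdd (proc_prob xi) xi
          (proc_prob W) (fun t w => W t w + f t + c)].

Definition S3 m xi : Prop :=
  exists (alpha lam c : R) (W : process R d),
    [/\ 0 < alpha /\ lam != 0,
        is_scaled_exp_measure m alpha lam,
        gaussian_process (proc_prob W) W,
        stationary_increments (proc_prob W) W &
        eq_fdd (proc_prob xi) xi (proc_prob W)
          (fun t w => W t w - lam * fine 'V_(proc_prob W)[W t] / 2 + c)].

End systems.

(* Main.v *)
(* Let M_t be the intensity measure of the points (V_i(t_1), ..., V_i(t_n)).
   Thinning the particles and averaging first over the independent paths, then
   over the Poisson process, gives E prod_i (1 - h(V_i(t))) = exp(- int h dM_t);
   these functionals determine the law of the point process, so stationarity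
   means that M_t is invariant under shifts of t.

   Write J(psi) = int E psi(u + xi(0)) m(du).  Weighting pairs of times by
   exp(r(x_2 - x_1)), the Cameron-Martin formula turns the invariance of M into
   J(psi(. + r p)) = exp(r a + r^2 b) J(psi), where p is a difference of
   covariances, a of means and b of increment variances.  Comparing r = 1 with
   r = 2 gives b = 0, hence stationary increments of xi - E xi.  If some p is
   nonzero, J is multiplicative under translations and m = alpha e_(a/p),
   because the transforms of m along p/(n+1) then agree with those of an
   exponential measure.  If all p vanish, then all a do, the covariance is
   stationary and the mean is affine: either the mean is constant, or it
   translates J invariantly along f(t)/(n+1) and m = alpha e_0.

   Conversely, for m = alpha e_lambda the change of variable v = u + xi(t_1)
   turns M_t into e_lambda times the law of (xi(t_k) - xi(t_1))_k under the weight
   exp(lambda xi(t_1)), whose exponential transforms only involve the increment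
   variances and mu(t) + lambda sigma^2(t)/2. *)
Require Import Defs.
From HB Require Import structures.
From mathcomp Require Import all_boot all_order all_algebra.
From mathcomp Require Import all_classical all_reals all_analysis.
From mathcomp Require Import measurable_realfun ring lra.

Set Implicit Arguments.
Unset Strict Implicit.
Unset Printing Implicit Defensive.

Import Order.TTheory GRing.Theory Num.Theory.
Import numFieldNormedType.Exports.

Local Open Scope classical_set_scope.
Local Open Scope ring_scope.

(** One uniqueness principle carries the proof: a measure on the line with all exponential moments
    is determined by its integrals of exp(p x/(n+1)), whose exponents accumulate at 0. Such sparse
    exponents are forced: an additive f need be neither measurable nor continuous, so only
    f(t/(n+1)) = f(t)/(n+1) is known about its small values. Stated for weighted laws and applied
    one coordinate at a time, the principle identifies finite-dimensional laws, proves the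
    Cameron-Martin formula and recognizes m. Counts may be infinite, so they are first mapped into
    [0, 1] by exp(-x), where moments decide. The measure m may be infinite as well; it is tested
    against Gaussian functions, on which J is finite because m is admissible and positive because m
    is nonzero, and only then can a factor be cancelled from an identity between values of J. The
    unbounded weights exp(r(x_2 - x_1)) are legitimate because equality of the intensities as
    measures extends to every nonnegative measurable function. For that equality void probabilities
    suffice; the converse uses joint Laplace transforms of the counts. *)

Definition image_measure {R : realType} {d1 d2 : measure_display}
    {T1 : measurableType d1} {T2 : measurableType d2}
    (P : {measure set T1 -> \bar R}) {X : T1 -> T2}
    (mX : measurable_fun setT X) : {measure set T2 -> \bar R} :=
  measure_function_pushforward__canonical__measure_function_Measure P mX.

Lemma ge0_integral_image {R : realType} {d1 d2 : measure_display}
    {T1 : measurableType d1} {T2 : measurableType d2}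
    (P : {measure set T1 -> \bar R}) {X : T1 -> T2}
    (mX : measurable_fun setT X) (f : T2 -> \bar R) :
  measurable_fun setT f -> (forall y, 0 <= f y)%E ->
  (\int[image_measure P mX]_y f y = \int[P]_x f (X x))%E.
Proof.
by move=> mf f0; rewrite (ge0_integral_pushforward (phi := X)).
Qed.

(** * Images of measures with a density, and uniqueness on products *)

Section weighted_laws.
Local Open Scope ereal_scope.
Context {R : realType} {dT dS : measure_display}
  {T : measurableType dT} {S : measurableType dS}.
Variable (P : {measure set T -> \bar R}).

Import HBNNSimple.

Section density.
Variables (g : T -> R).
Hypotheses (mg : measurable_fun setT g) (g0 : forall x, (0 <= g x)%R).

Let dens (A : set T) : \bar R := \int[P]_(x in A) (g x)%:E.

Let dens0 : dens set0 = 0.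
Proof. by rewrite /dens integral_set0. Qed.

Let dens_ge0 A : 0 <= dens A.
Proof. by apply: integral_ge0 => x _; rewrite lee_fin. Qed.

Let dens_sigma_additive : semi_sigma_additive dens.
Proof.
move=> F mF tF mUF; rewrite /dens ge0_integral_bigcup//; last 2 first.
  - by apply: measurable_funTS; exact/measurable_EFinP.
  - by move=> x _; rewrite lee_fin.
apply: is_cvg_ereal_nneg_natsum_cond => n _ _.
exact: dens_ge0.
Qed.

HB.instance Definition _ := isMeasure.Build _ _ _ dens
  dens0 dens_ge0 dens_sigma_additive.

Let denI (f : T -> \bar R) : measurable_fun setT f -> (forall x, 0 <= f x) ->
  \int[dens]_x f x = \int[P]_x (f x * (g x)%:E).
Proof.
move=> mf f0.
pose f_ := nnsfun_approx measurableT mf.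
have f_f x : (f_ n x)%:E @[n --> \oo] --> f x by exact: cvg_nnsfun_approx.
transitivity (limn (fun n => \int[dens]_x (f_ n x)%:E)).
  rewrite -monotone_convergence//.
  - by apply: eq_integral => y _; apply/esym/cvg_lim => //; exact: f_f.
  - by move=> n; exact/measurable_EFinP/measurable_funP.
  - by move=> n y _; rewrite lee_fin.
  - by move=> y _ m n mn; rewrite lee_fin; exact/lefP/nd_nnsfun_approx.
rewrite [X in limn X](_ : _ =
    (fun n => \int[P]_x ((f_ n x)%:E * (g x)%:E))).
  rewrite -monotone_convergence//; last 3 first.
  - by move=> n /=; apply/measurable_EFinP/measurable_funM.
  - by move=> n x _ /=; rewrite -EFinM lee_fin mulr_ge0.
  - move=> x _ m n mn; rewrite -!EFinM lee_fin ler_wpM2r//.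
    exact/lefP/nd_nnsfun_approx.
  apply: eq_integral => x _ /=; apply/cvg_lim => //.
  apply: cvgeZr => //; exact: f_f.
apply/funext => n.
transitivity (\sum_(k \in range (f_ n))
    \int[P]_x (k * \1_(f_ n @^-1` [set k]) x * g x)%:E).
  under eq_integral do rewrite fimfunE -fsumEFin//.
  rewrite ge0_integral_fsum//; last 2 first.
  - by move=> y; exact/measurable_EFinP/measurable_funM.
  - by move=> y x _; rewrite nnfun_muleindic_ge0.
  apply: eq_fsbigr => r _; rewrite integralZl_indic_nnsfun// integral_indic//= setIT.
  rewrite /dens.
  have [r0|r0] := leP 0%R r; last first.
    rewrite preimage_nnfun0// integral_set0 mule0.
    by rewrite integral0_eq// => x _; rewrite indic0 mulr0 mul0r.
  rewrite -ge0_integralZl//; last 2 first.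
      by apply: measurable_funTS; exact/measurable_EFinP.
      by move=> x _; rewrite lee_fin.
  rewrite integral_mkcond; apply: eq_integral => x _; rewrite patchE indicE.
  by case: ifPn => _; rewrite ?mulr1 ?mulr0 ?mul0r// EFinM.
rewrite -ge0_integral_fsum//.
- apply: eq_integral => x _; rewrite [in RHS]fimfunE -fsumEFin//.
  rewrite ge0_mule_fsuml; last by move=> k; exact: nnfun_muleindic_ge0.
  by apply: eq_fsbigr => k _; rewrite -EFinM.
- by move=> r; apply/measurable_EFinP; apply: measurable_funM => //; exact: measurable_funM.
- by move=> r x _; rewrite EFinM mule_ge0// ?nnfun_muleindic_ge0// lee_fin.
Qed.

Variables (X : T -> S).
Hypothesis mX : measurable_fun setT X.

(** Hides the local measure [dens] behind the two properties that later proofs use. The integration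
    formula is restricted to nonnegative functions, so [P] may be any measure. *)
Lemma weighted_lawP : {nu : {measure set S -> \bar R} |
  (forall A, measurable A -> nu A = \int[P]_(x in X @^-1` A) (g x)%:E) /\
  (forall f, measurable_fun setT f -> (forall y, 0 <= f y) ->
     \int[nu]_y f y = \int[P]_x (f (X x) * (g x)%:E))}.
Proof.
exists (image_measure dens mX); split=> // f mf f0.
rewrite ge0_integral_image// denI//.
exact: (measurableT_comp mf mX).
Qed.

End density.

End weighted_laws.
Arguments weighted_lawP {R dT dS T S} P {g} mg g0 {X} mX.

Section weighted_laws_ext.
Local Open Scope ereal_scope.
Context {R : realType} {d1 d2 dS : measure_display}
  {T1 : measurableType d1} {T2 : measurableType d2} {S : measurableType dS}.

Lemma eq_weighted_integral (P1 : {measure set T1 -> \bar R})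
    (P2 : {measure set T2 -> \bar R}) (g1 : T1 -> R) (g2 : T2 -> R)
    (X1 : T1 -> S) (X2 : T2 -> S) :
  measurable_fun setT g1 -> measurable_fun setT g2 ->
  (forall x, (0 <= g1 x)%R) -> (forall x, (0 <= g2 x)%R) ->
  measurable_fun setT X1 -> measurable_fun setT X2 ->
  (forall A, measurable A ->
     \int[P1]_(x in X1 @^-1` A) (g1 x)%:E = \int[P2]_(x in X2 @^-1` A) (g2 x)%:E) ->
  forall f, measurable_fun setT f -> (forall y, 0 <= f y) ->
    \int[P1]_x (f (X1 x) * (g1 x)%:E) = \int[P2]_x (f (X2 x) * (g2 x)%:E).
Proof.
move=> mg1 mg2 g10 g20 mX1 mX2 eqA f mf f0.
have [nu1 [nu1E <-//]] := weighted_lawP P1 mg1 g10 mX1.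
have [nu2 [nu2E <-//]] := weighted_lawP P2 mg2 g20 mX2.
apply: eq_measure_integral => A mA _.
by rewrite nu1E// nu2E// eqA.
Qed.

Lemma eq_law_integral (P1 : {measure set T1 -> \bar R})
    (P2 : {measure set T2 -> \bar R})
    (X1 : T1 -> S) (X2 : T2 -> S) :
  measurable_fun setT X1 -> measurable_fun setT X2 ->
  (forall A, measurable A -> P1 (X1 @^-1` A) = P2 (X2 @^-1` A)) ->
  forall f, measurable_fun setT f -> (forall y, 0 <= f y) ->
    \int[P1]_x f (X1 x) = \int[P2]_x f (X2 x).
Proof.
move=> mX1 mX2 eqA f mf f0.
rewrite -(ge0_integral_image P1 mX1)// -(ge0_integral_image P2 mX2)//.
by apply: eq_measure_integral => A mA _; exact: eqA.
Qed.

End weighted_laws_ext.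

Section tuple_boxes.
Local Open Scope ereal_scope.
Context {R : realType} {dS : measure_display} {S : measurableType dS}.
Variable n : nat.

Lemma measure_tuple_unique (nu1 nu2 : {measure set (n.-tuple S) -> \bar R}) :
  nu1 setT < +oo ->
  (forall A : 'I_n -> set S, (forall k, measurable (A k)) ->
    nu1 [set x | forall k, A k (tnth x k)] =
    nu2 [set x | forall k, A k (tnth x k)]) ->
  forall B, measurable B -> nu1 B = nu2 B.
Proof.
move=> fin1 eqbox.
pose G : set (set (n.-tuple S)) := [set C | exists2 A : 'I_n -> set S,
  (forall k, measurable (A k)) & C = [set x | forall k, A k (tnth x k)]].
have GT : G setT.
  by exists (fun=> setT) => //; apply/seteqP; split.
apply: (measure_unique G (fun=> setT)) => //.
- apply/seteqP; split.
  (* A generator of the product sigma-algebra constrains a single coordinate, so it is the box with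
     all other sides full. *)
  + rewrite /measurable/=; apply: smallest_sub; first exact: smallest_sigma_algebra.
    move=> A /=; rewrite -bigcup_seq => -[i /= _ [B mB <-]].
    apply: sub_sigma_algebra; exists (fun k => if k == i then B else setT).
      by move=> k; case: ifP.
    rewrite setTI; apply/seteqP; split => x /=.
      by move=> Bx k; case: eqP => [->|].
    by move=> /(_ i); rewrite eqxx.
  + apply: smallest_sub; first exact: sigma_algebra_measurable.
    move=> _ [A mA ->].
    rewrite [X in measurable X](_ : _ =
      \bigcap_(k in [set: 'I_n]) ((fun x : n.-tuple S => tnth x k) @^-1` A k)).
      apply: fin_bigcap_measurable => // k _.
      by rewrite -[X in measurable X]setTI; exact: measurable_tnth.
    by apply/seteqP; split => x /= h k //; [move=> _; exact: h|exact: h].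
- move=> _ _ [A mA ->] [B mB ->]; exists (fun k => A k `&` B k).
    by move=> k; exact: measurableI.
  apply/seteqP; split => x /=; first by move=> [hA hB] k; split.
  by move=> h; split => k; have [] := h k.
- by apply/seteqP; split => // x _; exists 0%N.
- by move=> _ [A mA ->]; exact: eqbox.
Qed.

End tuple_boxes.

Section finite_measure_pack.
Local Open Scope ereal_scope.
Context {R : realType} {d : measure_display} {T : measurableType d}.
Variable nu : {measure set T -> \bar R}.
Hypothesis nuoo : nu setT < +oo.

Let nu' : set T -> \bar R := nu.

Let nu'_fin : fin_num_fun nu'.
Proof.
move=> A mA; rewrite ge0_fin_numE ?measure_ge0// (le_lt_trans _ nuoo)//.
by apply: le_measure; rewrite ?inE.
Qed.

#[local] HB.instance Definition _ := Measure.on nu'.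
#[local] HB.instance Definition _ := Measure_isFinite.Build _ _ _ nu' nu'_fin.

(** Turns the hypothesis [nu setT < +oo] into a bundled structure, the form in which Tonelli's
    theorem takes its measures. *)
Lemma finite_measure_pack :
  {mu : {finite_measure set T -> \bar R} | mu = nu :> (set T -> \bar R)}.
Proof. by exists nu'. Qed.

End finite_measure_pack.

Section products.
Local Open Scope ereal_scope.
Context {R : realType} {d1 d2 : measure_display}.
Context {S1 : measurableType d1} {S2 : measurableType d2}.

Lemma integral_rectangle_unique (nu : {measure set (S1 * S2) -> \bar R})
    (nu1 : {measure set S1 -> \bar R}) (nu2 : {measure set S2 -> \bar R}) :
  nu1 setT < +oo -> nu2 setT < +oo ->
  (forall A B, measurable A -> measurable B -> nu (A `*` B) = nu1 A * nu2 B) ->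
  forall f, measurable_fun setT f -> (forall z, 0 <= f z) ->
  \int[nu]_z f z = \int[nu1]_x \int[nu2]_y f (x, y).
Proof.
move=> /finite_measure_pack[mu1 mu1E] /finite_measure_pack[mu2 mu2E] nuE f mf f0.
rewrite -mu1E -mu2E -(fubini_tonelli1 f)//.
apply: eq_measure_integral => A mA _; apply/esym/product_measure_unique => //.
by move=> B C mB mC; rewrite nuE// -mu1E -mu2E.
Qed.

End products.

(** Factors are extracted by second-order patterns and passed explicitly, so that unification need
    not guess how a function splits. *)
Ltac mfun := repeat first [ done | match goal with
  | |- measurable_fun _ (fun _ => ?c) => exact: measurable_cst
  | |- measurable_fun _ (fun x => x) => exact: measurable_id
  | |- measurable_fun _ (fun x => EFin _) => apply/measurable_EFinP
  | |- measurable_fun _ (EFin \o _) => apply/measurable_EFinP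
  | |- measurable_fun _ (fun x => @?f x + @?g x)%R =>
      first [ apply: (measurable_funD (f := f) (g := g))
            | apply: (emeasurable_funD (f := f) (g := g)) ]
  | |- measurable_fun _ (fun x => - @?f x)%R => apply: (measurable_funN (f := f))
  | |- measurable_fun _ (fun x => @?f x * @?g x)%R => apply: (measurable_funM (f := f) (g := g))
  | |- measurable_fun _ (fun x => @?f x ^+ ?n)%R => apply: (measurable_funX (f := f) n)
  | |- measurable_fun _ (fun x => (@?f x * @?g x)%E) => apply: (emeasurable_funM (f := f) (g := g))
  | |- measurable_fun _ (fun x => expR (@?f x)) =>
      apply: (measurableT_comp (f := expR) (g := f)); [exact: measurable_expR|]
  | |- measurable_fun _ (fun x => `|@?f x|%R) =>
      apply: (measurableT_comp (f := Num.norm) (g := f)); [exact: normr_measurable|]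
  end ].

(** * Elementary bounds and limits *)

Lemma expR_abs_le {R : realType} (r x : R) : 0 <= r ->
  expR (r * `|x|) <= expR (r * x) + expR (- r * x).
Proof.
move=> r0; have [x0|x0] := leP 0 x.
  by rewrite ger0_norm// lerDl expR_ge0.
by rewrite ltr0_norm// mulrN mulNr lerDr expR_ge0.
Qed.

Lemma le_norm_expR {R : realType} (x : R) : `|x| <= expR `|x|.
Proof. by rewrite (le_trans _ (expR_ge1Dx _))// lerDr. Qed.

Lemma series_exp_coeff_le {R : realType} (x : R) n : 0 <= x ->
  series (exp_coeff x) n <= expR x.
Proof.
move=> x0; rewrite /expR; apply: nondecreasing_cvgn_le.
  apply/nondecreasing_seqP => k; rewrite /series/= big_nat_recr//= lerDl.
  exact: exp_coeff_ge0.
exact: is_cvg_series_exp_coeff.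
Qed.

Lemma norm_series_cos_coeff_le {R : realType} (x : R) n :
  `|series (cos_coeff x) n| <= expR `|x|.
Proof.
apply: le_trans (series_exp_coeff_le n (normr_ge0 x)).
rewrite (le_trans (ler_norm_sum _ _ _))//; apply: ler_sum => i _.
rewrite /cos_coeff/= /exp_coeff/= !normrM normfV normrX [`|_%:R|]ger0_norm//.
rewrite [`|_`!%:R|]ger0_norm// normrX normrN1 expr1n mulr1 ler_wpM2r ?invr_ge0//.
by case: odd; rewrite ?mul1r// mul0r exprn_ge0.
Qed.

Lemma bernoulli_le {R : realType} (x : R) n : 0 <= x <= 1 ->
  1 - n%:R * x <= (1 - x) ^+ n.
Proof.
move=> /andP[x0 x1]; elim: n => [|n IH]; first by rewrite mul0r subr0.
rewrite exprS; apply: (@le_trans _ _ ((1 - x) * (1 - n%:R * x))); last first.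
  by rewrite ler_wpM2l ?subr_ge0.
rewrite -natr1; have : 0 <= n%:R * x * x by rewrite !mulr_ge0.
by nra.
Qed.

Lemma cvg_natM_geometric {R : realType} (x : R) : 0 <= x < 1 ->
  n%:R * x ^+ n @[n --> \oo] --> 0.
Proof.
move=> /andP[x0 x1]; have [->|xn0] := eqVneq x 0.
  apply: cvg_near_cst; exists 1%N => // n /= n0.
  by rewrite expr0n; case: n n0 => //= n _; rewrite mulr0.
have xp : 0 < x by rewrite lt_neqAle eq_sym xn0.
(* Since x^n = z^n z^n, the Bernoulli inequality for 1/z bounds n z^n, and the other factor z^n
   tends to 0. *)
pose z := Num.sqrt x.
have z0 : 0 < z by rewrite sqrtr_gt0.
have z1 : z < 1 by rewrite -sqrtr1 ltr_sqrt.
have h0 : 0 < z^-1 - 1 by rewrite subr_gt0 -invr1 ltf_pV2 ?posrE.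
have cz : z ^+ n / (z^-1 - 1) @[n --> \oo] --> 0.
  rewrite -(mul0r ((z^-1 - 1)^-1)); apply: cvgM; last exact: cvg_cst.
  by apply: cvg_expr; rewrite gtr0_norm.
apply: (@squeeze_cvgr _ _ _ _ (fun=> 0) (fun n => z ^+ n / (z^-1 - 1))) => //;
  last exact: cvg_cst.
apply: nearW => n; rewrite mulr_ge0 ?exprn_ge0//=.
have -> : x ^+ n = z ^+ n * z ^+ n by rewrite -exprMn -expr2 sqr_sqrtr.
have zb : 1 + n%:R * (z^-1 - 1) <= (z^-1) ^+ n.
  elim: n => [|n IH]; first by rewrite mul0r addr0.
  rewrite exprS; apply: (@le_trans _ _ (z^-1 * (1 + n%:R * (z^-1 - 1)))); last first.
    by rewrite ler_wpM2l// invr_ge0 ltW.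
  rewrite -natr1; have : 0 <= n%:R * (z^-1 - 1) * (z^-1 - 1).
    by rewrite !mulr_ge0// ltW.
  by nra.
have key : n%:R * (z^-1 - 1) * z ^+ n <= 1.
  rewrite -ler_pdivlMr ?exprn_gt0// mul1r -exprVn (le_trans _ zb)//.
  by rewrite lerDr.
rewrite ler_pdivlMr//.
have -> : n%:R * (z ^+ n * z ^+ n) * (z^-1 - 1) =
  z ^+ n * (n%:R * (z^-1 - 1) * z ^+ n) by ring.
by rewrite -[leRHS]mulr1 ler_wpM2l// exprn_ge0// ltW.
Qed.

(* The powers (1 - q^n)^(n 2^n) of Brosowski and Deutsch; the extra factor n
   in the exponent makes the limit 0 at q = 1/2 as well. *)
Lemma cvg_threshold {R : realType} (q : R) : 0 <= q <= 1 ->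
  (1 - q ^+ n) ^+ (n * 2 ^ n) @[n --> \oo] --> ((q < 2^-1)%R%:R : R).
Proof.
move=> /andP[q0 q1].
have qn (n : nat) : 0 <= q ^+ n <= 1 by rewrite exprn_ge0//= exprn_ile1.
have [q2|q2] := ltP q 2^-1.
  apply: (@squeeze_cvgr _ _ _ _ (fun n => 1 - n%:R * (2 * q) ^+ n) (fun=> 1)).
  - apply: nearW => n; apply/andP; split.
      apply: le_trans (bernoulli_le _ (qn n)).
      by rewrite natrM natrX exprMn mulrA.
    by have /andP[a b] := qn n; rewrite exprn_ile1 ?subr_ge0// gerBl.
  - rewrite -[X in _ --> X]subr0; apply: cvgB; first exact: cvg_cst.
    by apply: cvg_natM_geometric; rewrite mulr_ge0//=; lra.
  - exact: cvg_cst.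
apply: (@squeeze_cvgr _ _ _ _ (fun=> 0) (fun n => (expR (- 1)) ^+ n)).
- apply: nearW => n; have /andP[a b] := qn n; apply/andP; split.
    by rewrite exprn_ge0// subr_ge0.
  apply: (@le_trans _ _ (expR (- (2^-1 ^+ n)) ^+ (n * 2 ^ n))).
    rewrite lerXn2r ?nnegrE ?subr_ge0 ?expR_ge0//.
    apply: le_trans (expR_ge1Dx _); rewrite lerD2l lerN2 lerXn2r ?nnegrE//.
  rewrite -!expRM_natr ler_expR.
  rewrite mulrC natrM natrX mulrN -mulrA -exprMn divff ?pnatr_eq0// expr1n.
  by rewrite mulr1 mulN1r.
- exact: cvg_cst.
- by apply: cvg_expr; rewrite gtr0_norm ?expR_gt0// expR_lt1 ltrN10.
Qed.

(** * The moment problem under exponential integrability *)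

Definition exp_dominated {R : realType} (f : R -> R) (C r : R) :=
  forall x, `|f x| <= C * expR (r * `|x|).

Section exp_dominated_functions.
Context {R : realType}.
Implicit Types (f : R -> R) (rho : {measure set R -> \bar R}).

Definition exp_integrable rho :=
  forall s : R, (\int[rho]_x (expR (s * x))%:E < +oo)%E.

Lemma exp_integrable_abs rho r : exp_integrable rho -> 0 <= r ->
  rho.-integrable setT (EFin \o (fun x : R => expR (r * `|x|))).
Proof.
move=> irho r0; apply/integrableP; split.
  by mfun.
have mE (s : R) : measurable_fun [set: R] (fun x : R => (expR (s * x))%:E).
  by mfun.
apply: (@le_lt_trans _ _
    (\int[rho]_x ((expR (r * x))%:E + (expR (- r * x))%:E)))%E.
  apply: ge0_le_integral => //.
  - by apply: measurableT_comp => //; mfun.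
  - by mfun.
  - by move=> x _ /=; rewrite ger0_norm ?expR_ge0// -EFinD lee_fin expR_abs_le.
rewrite ge0_integralD//.
by rewrite lte_add_pinfty.
Qed.

Lemma exp_dominated_integrable rho f C r : exp_integrable rho -> 0 <= r ->
  measurable_fun setT f -> exp_dominated f C r ->
  rho.-integrable setT (EFin \o f).
Proof.
move=> irho r0 mf fC.
apply: (@le_integrable _ _ _ rho setT measurableT (EFin \o f) (fun x => C%:E * (expR (r * `|x|))%:E)%E).
- exact/measurable_EFinP.
- move=> x _ /=; rewrite lee_fin (le_trans (fC x))// ler_norm//.
- by apply: integrableZl => //; exact: exp_integrable_abs.
Qed.

Lemma exp_dominatedM f g C D r s : exp_dominated f C r -> exp_dominated g D s ->
  exp_dominated (fun x => f x * g x) (C * D) (r + s).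
Proof.
move=> fC gD x; rewrite normrM mulrDl expRD mulrACA.
by apply: ler_pM.
Qed.

Lemma exp_dominatedX f C r j : exp_dominated f C r ->
  exp_dominated (fun x => f x * x ^+ j) C (r + j%:R).
Proof.
move=> fC; have := @exp_dominatedM f (fun x => x ^+ j) C 1 r j%:R fC.
rewrite mulr1; apply => x; rewrite mul1r mulrC expRM_natr normrX.
by rewrite lerXn2r ?nnegrE ?expR_ge0// le_norm_expR.
Qed.

End exp_dominated_functions.

Section moment_class.
Context {R : realType} (rho1 rho2 : {measure set R -> \bar R}).
Hypotheses (irho1 : exp_integrable rho1) (irho2 : exp_integrable rho2).
Implicit Types f : R -> R.

(** Functions [f] for which the signed measures f rho1 and f rho2 have equal moments. The class is
    linear and stable under multiplication by polynomials and under dominated limits; starting from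
    the constant 1 it is enlarged until it contains indicators of intervals, without Fourier
    inversion. *)
Definition same_moments f := [/\ measurable_fun setT f,
  exists C r, 0 <= r /\ exp_dominated f C r &
  forall j, (\int[rho1]_x (f x * x ^+ j)%:E = \int[rho2]_x (f x * x ^+ j)%:E)%E].

Lemma measurable_mulX f j : measurable_fun setT f ->
  measurable_fun setT (fun x : R => f x * x ^+ j).
Proof. by move=> mf; apply: measurable_funM => //; exact: measurable_funX. Qed.

(** Dominated convergence. The common bound is exponential with a single rate [r], since the factor
    x^j then only raises the rate to r + j. *)
Lemma same_moments_lim (f_ : nat -> R -> R) f C r :
  0 <= r -> (forall n, same_moments (f_ n)) ->
  (forall n, exp_dominated (f_ n) C r) ->
  (forall x, f_ n x @[n --> \oo] --> f x) -> same_moments f.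
Proof.
move=> r0 sf fC cf.
have mf : measurable_fun setT f.
  apply: (@measurable_fun_cvg _ _ _ _ f_) => // n.
  by have [] := sf n.
have fCr : exp_dominated f C r.
  move=> x; apply: (cvgr_to_le (cvg_norm (cf x))).
  by apply: nearW => n; exact: fC.
split => //; first by exists C, r.
move=> j.
have cvgj (rho : {measure set R -> \bar R}) : exp_integrable rho ->
    (\int[rho]_x (f_ n x * x ^+ j)%:E @[n --> \oo] -->
     \int[rho]_x (f x * x ^+ j)%:E)%E.
  move=> irho.
  have [] := @dominated_convergence _ _ _ rho _ measurableT
    (fun n x => (f_ n x * x ^+ j)%:E) (fun x => (f x * x ^+ j)%:E)
    (fun x => (C * expR ((r + j%:R) * `|x|))%:E) => //.
  - move=> n; apply/measurable_EFinP; apply: measurable_mulX.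
    by have [] := sf n.
  - by apply/measurable_EFinP; exact: measurable_mulX.
  - apply: aeW => x _; apply: cvg_EFin; first exact: nearW.
    apply: cvgM; last exact: cvg_cst. exact: cf.
  - under eq_fun do rewrite EFinM.
    apply: integrableZl => //; apply: exp_integrable_abs => //.
    by rewrite addr_ge0.
  - apply: aeW => x n _; rewrite lee_fin; exact: exp_dominatedX (fC n) x.
have c1 := cvgj _ irho1; have c2 := cvgj _ irho2.
have e : (fun n => \int[rho1]_x (f_ n x * x ^+ j)%:E)%E =
         (fun n => \int[rho2]_x (f_ n x * x ^+ j)%:E)%E.
  by apply/funext => n; have [_ _ ->] := sf n.
rewrite e in c1.
exact: (cvg_unique _ c1 c2).
Qed.

Lemma exp_dominated_weaken f C r D s : 0 <= C -> C <= D -> r <= s ->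
  exp_dominated f C r -> exp_dominated f D s.
Proof.
move=> C0 CD rs fC x; rewrite (le_trans (fC x))// ler_pM// ?expR_ge0//.
by rewrite ler_expR ler_wpM2r.
Qed.

Lemma exp_dominated_ge0 f C r : exp_dominated f C r -> 0 <= C.
Proof.
move=> /(_ 0); rewrite normr0 mulr0 expR0 mulr1; exact: le_trans.
Qed.

Lemma same_moments_integrable f j : same_moments f ->
  rho1.-integrable setT (EFin \o (fun x => f x * x ^+ j)) /\
  rho2.-integrable setT (EFin \o (fun x => f x * x ^+ j)).
Proof.
move=> [mf [C [r [r0 fC]]] _]; split.
  apply: (@exp_dominated_integrable _ rho1 _ C (r + j%:R)) => //.
  - by rewrite addr_ge0.
  - exact: measurable_mulX.
  - exact: exp_dominatedX.
apply: (@exp_dominated_integrable _ rho2 _ C (r + j%:R)) => //.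
- by rewrite addr_ge0.
- exact: measurable_mulX.
- exact: exp_dominatedX.
Qed.

Lemma same_moments_lin f g a : same_moments f -> same_moments g ->
  same_moments (fun x => f x + a * g x).
Proof.
move=> sf sg; have [mf [C [r [r0 fC]]] fE] := sf.
have [mg [D [s [s0 gD]]] gE] := sg.
split; first by mfun.
  exists (C + `|a| * D), (r + s); split; first by rewrite addr_ge0.
  move=> x; rewrite (le_trans (ler_normD _ _))// mulrDl lerD//.
    apply: (@exp_dominated_weaken f C r) => //; first exact: exp_dominated_ge0 fC.
    by rewrite lerDl.
  rewrite normrM -mulrA ler_wpM2l//.
  apply: (@exp_dominated_weaken g D s) => //; first exact: exp_dominated_ge0 gD.
  by rewrite lerDr.
move=> j.
have [f1 f2] := same_moments_integrable j sf.
have [g1 g2] := same_moments_integrable j sg.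
have E (rho : {measure set R -> \bar R}) :
    rho.-integrable setT (EFin \o (fun x => f x * x ^+ j)) ->
    rho.-integrable setT (EFin \o (fun x => g x * x ^+ j)) ->
    (\int[rho]_x ((f x + a * g x) * x ^+ j)%:E =
    \int[rho]_x (f x * x ^+ j)%:E + a%:E * \int[rho]_x (g x * x ^+ j)%:E)%E.
  move=> i1 i2; transitivity (\int[rho]_x ((f x * x ^+ j)%:E + a%:E * (g x * x ^+ j)%:E))%E.
    by apply: eq_integral => x _; rewrite mulrDl -mulrA EFinD EFinM.
  rewrite integralD//; last exact: (@integrableZl _ _ _ rho _ measurableT a _ i2).
  by rewrite integralZl.
by rewrite E// E// fE gE.
Qed.

Lemma same_moments_mulX f : same_moments f -> same_moments (fun x => f x * x).
Proof.
move=> [mf [C [r [r0 fC]]] fE]; split; first by mfun.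
  exists C, (r + 1); split; first by rewrite addr_ge0.
  by have := exp_dominatedX 1 fC; apply.
move=> j.
transitivity (\int[rho1]_x (f x * x ^+ j.+1)%:E)%E.
  by apply: eq_integral => x _; rewrite exprS mulrA.
by rewrite fE; apply: eq_integral => x _; rewrite exprS mulrA.
Qed.

Lemma eq_same_moments f g : f =1 g -> same_moments f -> same_moments g.
Proof. by move=> /funext ->. Qed.

Lemma same_moments_mulXc f c k : same_moments f ->
  same_moments (fun x => f x * (x - c) ^+ k).
Proof.
move=> sf; elim: k => [|k IH].
  by apply: eq_same_moments sf => x; rewrite expr0 mulr1.
apply: eq_same_moments (same_moments_lin (- c) (same_moments_mulX IH) IH) => x.
by rewrite exprSr; ring.
Qed.

Lemma same_moments0 : same_moments (fun=> 0).
Proof.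
split => //; first by exists 0, 0; split => // x; rewrite normr0 mul0r.
by move=> j; rewrite !integral0_eq// => x _; rewrite mul0r.
Qed.

(** Partial sums of the cosine series are polynomials, bounded uniformly in [n] by exp(|y (x - c)|).
    This is where integrability of all exponentials is spent. *)
Lemma same_moments_cos f y c : same_moments f ->
  same_moments (fun x => f x * cos (y * (x - c))).
Proof.
move=> sf; have [mf [C [r [r0 fC]]] fE] := sf.
have C0 := exp_dominated_ge0 fC.
apply: (@same_moments_lim
  (fun n x => f x * series (cos_coeff (y * (x - c))) n) _
  (C * expR (`|y| * `|c|)) (r + `|y|)).
- by rewrite addr_ge0.
- elim=> [|n IH].
    by apply: eq_same_moments same_moments0 => x; rewrite /series/= big_geq// mulr0.
  set a : R := (~~ odd n)%:R * (-1) ^+ n./2 * y ^+ n / n`!%:R.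
  apply: eq_same_moments (same_moments_lin a IH (same_moments_mulXc c n sf)) => x.
  rewrite /series/= big_nat_recr//= [in RHS]mulrDr; congr (_ + _).
  by rewrite /cos_coeff/= /a exprMn -exprnP; ring.
- move=> n x; rewrite normrM.
  apply: (@le_trans _ _ (C * expR (r * `|x|) * expR `|y * (x - c)|)).
    apply: ler_pM => //.
    exact: norm_series_cos_coeff_le.
  rewrite -mulrA -expRD -[X in _ <= X]mulrA -expRD ler_wpM2l// ler_expR.
  have : `|x - c| <= `|x| + `|c| by exact: ler_normB.
  rewrite normrM mulrDl; have := normr_ge0 y; nra.
- move=> x; apply: cvgM; first exact: cvg_cst.
  rewrite unlock; exact: is_cvg_series_cos_coeff.
Qed.

Lemma same_moments_threshold f q n M : (forall g, same_moments g ->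
    same_moments (fun x => g x * q x)) -> same_moments f ->
  same_moments (fun x => f x * (1 - q x ^+ n) ^+ M).
Proof.
move=> hq.
have hX k g : same_moments g -> same_moments (fun x => g x * q x ^+ k).
  move=> sg; elim: k => [|k IH].
    by apply: eq_same_moments sg => x; rewrite mulr1.
  by apply: eq_same_moments (hq _ IH) => x; rewrite exprSr mulrA.
move=> sf; elim: M => [|M IH].
  by apply: eq_same_moments sf => x; rewrite mulr1.
apply: eq_same_moments (same_moments_lin (- 1) IH (hX n _ IH)) => x.
by rewrite [in RHS]exprSr; ring.
Qed.

Hypothesis same1 : same_moments (fun=> 1).

(** Polynomials in q = (1 + cos)/(2 (1 + b)) tend to the indicator of q < 1/2 by [cvg_threshold],
    and q < 1/2 means cos < b. The condition 0 <= b keeps q at most 1. *)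
Lemma same_moments_cos_lt y c b : 0 <= b ->
  same_moments (fun x => (cos (y * (x - c)) < b)%R%:R).
Proof.
move=> b0; pose q x : R := (2 * (1 + b))^-1 * (1 + cos (y * (x - c))).
have q01 x : 0 <= q x <= 1.
  have c1 := cos_le1 (y * (x - c)); have c2 := cos_geN1 (y * (x - c)).
  have p : 0 < 2 * (1 + b) by lra.
  by apply/andP; split; [apply: mulr_ge0; [rewrite invr_ge0 ltW|lra]
                        |rewrite ler_pdivrMl//; lra].
have hq g : same_moments g -> same_moments (fun x => g x * q x).
  move=> sg.
  apply: eq_same_moments (same_moments_lin (2 * (1 + b))^-1 same_moments0
     (same_moments_lin 1 sg (same_moments_cos y c sg))) => x.
  by rewrite /q; ring.
apply: (@same_moments_lim
    (fun n x => 1 * (1 - q x ^+ n) ^+ (n * 2 ^ n)) _ 1 0) => //.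
- by move=> n; exact: same_moments_threshold.
- move=> n x; have /andP[q0 q1] := q01 x.
  have q2 : 0 <= 1 - q x ^+ n <= 1.
    by rewrite subr_ge0 exprn_ile1//= gerBl exprn_ge0.
  have /andP[q3 q4] := q2.
  by rewrite !mul1r mul0r expR0 normrX ger0_norm// exprn_ile1.
- move=> x; under eq_fun do rewrite mul1r.
  have -> : (cos (y * (x - c)) < b) = (q x < 2^-1).
    by rewrite /q ltr_pdivrMl; [apply/idP/idP; lra|lra].
  exact: cvg_threshold.
Qed.

(** The set where cos(y (x - c)) < cos(y r) is periodic, but near [c] it is the complement of the
    ball; letting the frequency y_n tend to 0 pushes the other periods to infinity. *)
Lemma same_moments_ball c r : 0 <= r ->
  same_moments (fun x => (r < `|x - c|)%R%:R).
Proof.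
move=> r0.
(* With this choice y_n r <= 1 <= pi/2, so cos(y_n r) is nonnegative as [same_moments_cos_lt]
   requires. *)
pose y (n : nat) : R := (n.+1%:R * (r + 1))^-1.
have p (n : nat) : 0 < n.+1%:R * (r + 1) by rewrite mulr_gt0// ltr_wpDl.
have y0 n : 0 < y n by rewrite invr_gt0.
have yr n : y n * r <= 1.
  rewrite ler_pdivrMl//.
  rewrite mulr1 -natr1; have : 0 <= n%:R * (r + 1) by rewrite mulr_ge0// addr_ge0.
  by lra.
have pi2 : 2 <= pi :> R by exact: pi_ge2.
apply: (@same_moments_lim
  (fun n x => (cos (y n * (x - c)) < cos (y n * r))%R%:R) _ 1 0) => //.
- move=> n; apply: same_moments_cos_lt; apply: cos_ge0_pihalf.
  have := yr n; have : 0 <= y n * r by rewrite mulr_ge0// ltW.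
  lra.
- by move=> n x; rewrite mul0r expR0 mulr1; case: ltP => _; rewrite ?normr1 ?normr0.
- move=> x; apply: cvg_near_cst.
  near=> n.
  have -> : cos (y n * (x - c)) = cos (y n * `|x - c|).
    by rewrite -cos_norm normrM gtr0_norm.
  rewrite ltr_cos ?in_itv/=; last 2 first.
  - rewrite mulr_ge0// ?ltW//=; have := yr n; lra.
  - rewrite mulr_ge0// ?ltW//=; suff : y n * `|x - c| <= 1 by lra.
    rewrite ler_pdivrMl// mulr1.
    have : `|x - c| <= n%:R by near: n; exact: nbhs_infty_ger.
    have : 0 <= n%:R * r by rewrite mulr_ge0.
    by rewrite -natr1; lra.
  by rewrite ltr_pM2l.
Unshelve. all: end_near.
Qed.

Lemma same_moments_closed_ball c r : 0 <= r ->
  rho1 `[c - r, c + r]%classic = rho2 `[c - r, c + r]%classic.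
Proof.
move=> r0.
have s := same_moments_lin (- 1) same1 (same_moments_ball c r0).
have [_ _ /(_ 0%N)] := s.
have E (rho : {measure set R -> \bar R}) :
    (\int[rho]_x ((1 + - 1 * (r < `|x - c|)%R%:R) * x ^+ 0)%:E =
     rho `[(c - r)%R, (c + r)%R]%classic)%E.
  rewrite -[in RHS](setIT `[_, _]%classic) -integral_indic//; apply: eq_integral => x _.
  rewrite expr0 mulr1 mulN1r indicE; congr EFin.
  have -> : (x \in `[(c - r)%R, (c + r)%R]%classic) = ~~ (r < `|x - c|).
    by rewrite -leNgt ler_distl; apply/idP/idP; rewrite inE/= in_itv.
  by case: (r < _)%R; rewrite /= ?subrr ?subr0.
by rewrite !E.
Qed.

End moment_class.

Section moment_uniqueness.
Context {R : realType} (rho1 rho2 : {measure set R -> \bar R}).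
Hypotheses (irho1 : exp_integrable rho1) (irho2 : exp_integrable rho2).

Lemma exp_integrable_setT (rho : {measure set R -> \bar R}) :
  exp_integrable rho -> (rho setT < +oo)%E.
Proof.
move=> /(_ 0); under eq_integral do rewrite mul0r expR0.
by rewrite integral_cst// mul1e.
Qed.

Lemma moment_unique :
  (forall j, \int[rho1]_x (x ^+ j)%:E = \int[rho2]_x (x ^+ j)%:E)%E ->
  forall A, measurable A -> rho1 A = rho2 A.
Proof.
move=> mom.
have same1 : same_moments rho1 rho2 (fun=> 1).
  split => //.
    by exists 1, 0; split => // x; rewrite normr1 mul0r expR0 mulr1.
  move=> j; have := mom j.
  by under eq_integral do rewrite -[X in X%:E]mul1r;
    under [in X in _ = X -> _]eq_integral do rewrite -[X in X%:E]mul1r.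
pose G : set (set R) := [set B | exists a b : R, B = `[a, b]%classic].
have GE : measurable = <<s G >> :> set (set R).
  apply/seteqP; split; last first.
    apply: smallest_sub; first exact: sigma_algebra_measurable.
    by move=> _ [a [b ->]].
  apply: smallest_sub; first exact: smallest_sigma_algebra.
  move=> _ [[a b] _ <-] /=.
  have -> : `]a, b]%classic = \bigcup_n `[(a + n.+1%:R^-1)%R, b]%classic.
    exact: itv_open_bnd_bigcup.
  apply: (@bigcup_measurable _ (g_sigma_algebraType G)) => n _.
  by apply: sub_sigma_algebra; exists (a + n.+1%:R^-1), b.
apply: (measure_unique G (fun n => `[- n%:R, n%:R]%classic)) => //.
- move=> _ _ [a [b ->]] [a' [b' ->]]; exists (Num.max a a'), (Num.min b b').
  apply/seteqP; split => x /=; rewrite !in_itv/= ge_max le_min.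
    by move=> [/andP[-> ->] /andP[-> ->]].
  by move=> /andP[/andP[-> ->] /andP[-> ->]].
- by move=> n; exists (- n%:R), n%:R.
- apply/seteqP; split => // x _; exists (Num.bound `|x|) => //=.
  by rewrite in_itv/= -ler_norml ltW// archi_boundP.
- move=> _ [a [b ->]]; have [ab|ab] := leP a b; last first.
    by rewrite set_itv_ge ?measure0// bnd_simp -ltNge.
  have := same_moments_closed_ball irho1 irho2 same1 ((a + b) / 2).
  move=> /(_ ((b - a) / 2)).
  have -> : (a + b) / 2 - (b - a) / 2 = a by field.
  have -> : (a + b) / 2 + (b - a) / 2 = b by field.
  by apply; lra.
- move=> k; apply: le_lt_trans (exp_integrable_setT irho1).
  by apply: le_measure; rewrite ?inE.
Qed.

Lemma exp_moment_cvg (rho : {measure set R -> \bar R}) (s : R) :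
  exp_integrable rho ->
  (\sum_(0 <= k < n) fine (\int[rho]_x (x ^+ k)%:E) / k`!%:R * s ^+ k
    @[n --> \oo] --> fine (\int[rho]_x (expR (s * x))%:E))%R.
Proof.
move=> irho.
have iX k : rho.-integrable setT (EFin \o (fun x : R => x ^+ k)).
  apply: (@exp_dominated_integrable _ rho _ 1 k%:R) => //.
  have : exp_dominated (fun=> 1 : R) 1 0.
    by move=> x; rewrite normr1 mul0r expR0 mulr1.
  by move=> /(exp_dominatedX k) h x; have := h x; rewrite mul1r add0r.
have h : (\int[rho]_x (series (exp_coeff (s * x)) n)%:E @[n --> \oo] -->
          \int[rho]_x (expR (s * x))%:E)%E.
  have [] := @dominated_convergence _ _ _ rho _ measurableT
    (fun n x => (series (exp_coeff (s * x)) n)%:E) (fun x => (expR (s * x))%:E)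
    (fun x => (expR (`|s| * `|x|))%:E) => //.
  - move=> n; apply/measurable_EFinP; rewrite /series/=.
    apply: measurable_sum => k; rewrite /exp_coeff/=.
    by mfun.
  - by mfun.
  - apply: aeW => x _; apply: cvg_EFin; first exact: nearW.
    exact: is_cvg_series_exp_coeff.
  - exact: exp_integrable_abs.
  - apply: aeW => x n _; rewrite lee_fin -normrM.
    apply: le_trans (series_exp_coeff_le n (normr_ge0 (s * x))).
    by rewrite -normed_series_exp_coeff/= ler_norm_sum.
have ifin : (\int[rho]_x (expR (s * x))%:E)%E \is a fin_num.
  rewrite ge0_fin_numE; first exact: irho.
  by apply: integral_ge0 => x _; rewrite lee_fin expR_ge0.
rewrite -(fineK ifin) in h.
apply: cvg_trans (fine_cvg h); apply: near_eq_cvg; apply: nearW => n /=; apply/esym.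
transitivity (fine (\int[rho]_x
    (\sum_(0 <= k < n) (s ^+ k / k`!%:R)%:E * (x ^+ k)%:E)))%E; last first.
  congr fine; apply: eq_integral => x _.
  rewrite /series/= -sumEFin; apply: eq_bigr => k _.
  by rewrite -EFinM /exp_coeff/= exprMn; congr EFin; ring.
rewrite integral_sum//; last first.
  by move=> k; apply: (@integrableZl _ _ _ rho _ measurableT _ _ (iX k)).
transitivity (fine (\sum_(0 <= k < n)
    (fine (\int[rho]_x (x ^+ k)%:E) / k`!%:R * s ^+ k)%:E)%E).
  by rewrite sumEFin.
congr fine; apply: eq_bigr => k _.
rewrite integralZl//; last exact: iX.
have fk : (\int[rho]_x (x ^+ k)%:E)%E \is a fin_num.
  exact: (@integrable_fin_num _ _ _ rho _ measurableT _ (iX k)).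
by rewrite -[X in (_ = _ * X)%E](fineK fk) -EFinM; congr EFin; ring.
Qed.

(** If the coefficients before a_k vanish, the terms after a_k s^k add up to at most 2 C |s|^(k+1)
    for |s| <= 1/2; hence |a_k| <= 2 C |s_n|, which tends to 0. *)
Lemma null_power_series (a s : nat -> R) (C : R) :
  (forall k, `|a k| <= C) -> (forall n, s n != 0) -> s n @[n --> \oo] --> 0 ->
  (forall n, \sum_(0 <= k < N) a k * s n ^+ k @[N --> \oo] --> 0) ->
  forall k, a k = 0.
Proof.
move=> aC sn0 s0 as0; elim/ltn_ind => k IH.
have C0 : 0 <= C by apply: le_trans (aC 0%N).
have bnd n : `|s n| <= 2^-1 -> `|a k| <= 2 * C * `|s n|.
  move=> sn.
  (* The factor 1 - |s|^m strengthens the bound so that the induction closes: its increment pays for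
     one more term because |s| <= 1/2. *)
  have step m : `|\sum_(0 <= j < k.+1 + m) a j * s n ^+ j - a k * s n ^+ k| <=
      2 * C * `|s n| ^+ k.+1 * (1 - `|s n| ^+ m).
    elim: m => [|m IHm].
      rewrite addn0 big_nat_recr//= big_nat big1 ?add0r ?subrr ?normr0 ?mulr0//.
      by move=> j /andP[_ jk]; rewrite IH// mul0r.
    rewrite addnS big_nat_recr//=.
    rewrite addrAC (le_trans (ler_normD _ _))//.
    apply: le_trans (lerD IHm (lexx _)) _.
    rewrite normrM normrX exprD.
    have : `|a (k.+1 + m)%N| * (`|s n| ^+ k.+1 * `|s n| ^+ m) <=
      C * (`|s n| ^+ k.+1 * `|s n| ^+ m) by rewrite ler_wpM2r// mulr_ge0 ?exprn_ge0.
    have : 0 <= C * `|s n| ^+ k.+1 * `|s n| ^+ m * (1 - 2 * `|s n|).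
      by rewrite !mulr_ge0// ?exprn_ge0//; lra.
    rewrite [`|s n| ^+ m.+1]exprS.
    set u := `|s n| ^+ k.+1; set v := `|s n| ^+ m; set w := `|a _|.
    lra.
  have h : `|0 - a k * s n ^+ k| <= 2 * C * `|s n| ^+ k.+1.
    apply: (cvgr_to_le (cvg_norm (cvgB (as0 n) (cvg_cst (a k * s n ^+ k))))).
    exists k.+1 => // N /= kN; rewrite -(subnKC kN).
    rewrite (le_trans (step _))//.
    rewrite ler_piMr ?mulr_ge0 ?exprn_ge0// gerBl exprn_ge0//.
  move: h; rewrite sub0r normrN normrM normrX exprS mulrA.
  by rewrite ler_pM2r// exprn_gt0// normr_gt0.
apply/eqP; rewrite -normr_le0.
have c0 : 2 * C * `|s n| @[n --> \oo] --> 0.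
  rewrite -(mulr0 (2 * C)); apply: cvgM; first exact: cvg_cst.
  by rewrite -(normr0 R); exact: cvg_norm.
apply: (cvgr_to_ge c0).
have /cvgrPdist_le := s0; move=> /(_ 2^-1 ltac:(by [])); apply: filterS => n.
by rewrite sub0r normrN; exact: bnd.
Qed.

(** Both transforms are power series in the moments, with coefficients bounded by the integral of
    exp |x|. Their difference vanishes along p/(n+1), which tends to 0 without reaching it, so all
    moments agree. *)
Lemma exp_moment_unique (p : R) : p != 0 ->
  (forall n : nat, \int[rho1]_x (expR (p / n.+1%:R * x))%:E =
             \int[rho2]_x (expR (p / n.+1%:R * x))%:E)%E ->
  forall A, measurable A -> rho1 A = rho2 A.
Proof.
move=> p0 E; apply: moment_unique => j.
have iX (rho : {measure set R -> \bar R}) : exp_integrable rho ->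
    forall k, rho.-integrable setT (EFin \o (fun x : R => x ^+ k)).
  move=> irho k; apply: (@exp_dominated_integrable _ rho _ 1 k%:R) => //.
  have : exp_dominated (fun=> 1 : R) 1 0.
    by move=> x; rewrite normr1 mul0r expR0 mulr1.
  by move=> /(exp_dominatedX k) h x; have := h x; rewrite mul1r add0r.
pose M (rho : {measure set R -> \bar R}) k := fine (\int[rho]_x (x ^+ k)%:E)%E.
have Mle (rho : {measure set R -> \bar R}) : exp_integrable rho ->
    forall k, `|M rho k / k`!%:R| <= fine (\int[rho]_x (expR `|x|)%:E)%E.
  move=> irho k.
  have iE : rho.-integrable setT (EFin \o (fun x : R => expR `|x|)).
    have := exp_integrable_abs irho ler01.
    by congr (_.-integrable _ _); apply/funext => x /=; rewrite mul1r.
  have fE := @integrable_fin_num _ _ _ rho _ measurableT _ iE.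
  have fX := @integrable_fin_num _ _ _ rho _ measurableT _ (iX _ irho k).
  rewrite normrM normfV [`|_%:R|]ger0_norm// ler_pdivrMr ?ltr0n ?fact_gt0//.
  rewrite -lee_fin EFinM (fineK fE) -abse_EFin /M (fineK fX).
  apply: le_trans (le_abse_integral _ _ _) _ => //.
    by mfun.
  rewrite muleC -integralZl//; apply: ge0_le_integral => //.
  - by apply: measurableT_comp => //; mfun.
  - by rewrite /=; mfun.
  - move=> x _ /=; rewrite lee_fin -ler_pdivrMl ?ltr0n ?fact_gt0// mulrC.
    apply: le_trans (series_exp_coeff_le k.+1 (normr_ge0 x)).
    rewrite /series/= big_nat_recr//= normrX -[leLHS]add0r lerD//.
    by apply: sumr_ge0 => i _; exact: exp_coeff_ge0.
suff /eqP : (M rho1 j - M rho2 j) / j`!%:R = 0.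
  rewrite mulf_eq0 invr_eq0 pnatr_eq0 -leqn0 leqNgt fact_gt0 orbF subr_eq0.
  move=> /eqP h.
  rewrite -(fineK (@integrable_fin_num _ _ _ rho1 _ measurableT _ (iX _ irho1 j))).
  by rewrite -(fineK (@integrable_fin_num _ _ _ rho2 _ measurableT _ (iX _ irho2 j))) -/(M _ _) h.
move: j; apply: (@null_power_series (fun k => (M rho1 k - M rho2 k) / k`!%:R)
  (fun n => p / n.+1%:R)
  (fine (\int[rho1]_x (expR `|x|)%:E)%E + fine (\int[rho2]_x (expR `|x|)%:E)%E)).
- move=> k; rewrite mulrBl (le_trans (ler_normB _ _))// lerD//; exact: Mle.
- by move=> n; rewrite mulf_neq0// invr_eq0 pnatr_eq0.
- rewrite -(mulr0 p); apply: cvgM; first exact: cvg_cst.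
  exact: cvg_harmonic.
- move=> n; rewrite (_ : (fun N => _) = (fun N =>
    \sum_(0 <= k < N) M rho1 k / k`!%:R * (p / n.+1%:R) ^+ k -
    \sum_(0 <= k < N) M rho2 k / k`!%:R * (p / n.+1%:R) ^+ k)).
    rewrite -[X in _ --> X](subrr (fine (\int[rho1]_x (expR (p / n.+1%:R * x))%:E)%E)).
    apply: cvgB; first exact: (exp_moment_cvg irho1).
    by rewrite E; exact: (exp_moment_cvg irho2).
  apply/funext => N; rewrite -sumrB; apply: eq_bigr => k _; rewrite /M; ring.
Qed.

End moment_uniqueness.

(** * Joint laws determined by weighted exponentials or by mixed moments *)

Lemma measurable_tuple_of {d d' : measure_display} {T : measurableType d}
    {S : measurableType d'} n (X : 'I_n -> T -> S) :
  (forall k, measurable_fun setT (X k)) ->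
  measurable_fun setT (fun x => [tuple X k x | k < n]).
Proof.
move=> mX; apply/measurable_fun_tnthP => k.
by rewrite (_ : _ \o _ = X k)//; apply/funext => x /=; rewrite tnth_mktuple.
Qed.

Lemma unit_weighted_lawP {R : realType} {d : measure_display}
    {T : measurableType d} (P : {measure set T -> \bar R}) (g X : T -> R) :
  (P setT < +oo)%E -> measurable_fun setT g -> (forall x, 0 <= g x <= 1) ->
  measurable_fun setT X -> (forall x, 0 <= X x <= 1) ->
  exists nu : {measure set R -> \bar R},
    [/\ forall A, measurable A -> (nu A = \int[P]_(x in X @^-1` A) (g x)%:E)%E,
        exp_integrable nu &
        forall j, (\int[nu]_x (x ^+ j)%:E = \int[P]_x (X x ^+ j * g x)%:E)%E].
Proof.
move=> Poo mg g01 mX X01.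
have g0 x : 0 <= g x by case/andP: (g01 x).
have [nu [nuE nuI]] := weighted_lawP P mg g0 mX.
exists nu; split => //.
  move=> s; rewrite nuI; last 2 first.
  - by mfun.
  - by move=> y; rewrite lee_fin expR_ge0.
  apply: (@le_lt_trans _ _ (\int[P]_x (expR `|s|)%:E)%E).
    apply: ge0_le_integral => //.
    - by move=> x _; rewrite -EFinM lee_fin mulr_ge0 ?expR_ge0.
    - by mfun.
    - move=> x _; rewrite -EFinM lee_fin -[leRHS]mulr1.
      have /andP[g1 g2] := g01 x; have /andP[X1 X2] := X01 x.
      apply: ler_pM; rewrite ?expR_ge0// ler_expR (le_trans (ler_norm _))//.
      by rewrite normrM ler_piMr// ger0_norm.
  by rewrite integral_cst// lte_mul_pinfty.
move=> j.
(* The formula for [nu] covers nonnegative integrands only; since [nu] does not charge the negative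
   numbers, x^j may be replaced by |x|^j. *)
transitivity (\int[nu]_x (`|x| ^+ j)%:E)%E; last first.
  rewrite nuI; last 2 first.
  - by mfun.
  - by move=> y; rewrite lee_fin exprn_ge0.
  apply: eq_integral => x _; rewrite EFinM ger0_norm//.
  by case/andP: (X01 x).
apply: ae_eq_integral => //.
- by mfun.
- by mfun.
exists (`]-oo, 0[%classic); split => //.
  rewrite nuE// (_ : X @^-1` _ = set0) ?integral_set0//.
  apply/seteqP; split => x //=; rewrite in_itv/= ltNge.
  by case/andP: (X01 x) => ->.
move=> x /= h; rewrite in_itv/= ltNge; apply/negP => x0; apply: h => _.
by rewrite ger0_norm.
Qed.

Section weighted_uniqueness.
Local Open Scope ereal_scope.
Context {R : realType} {d1 d2 : measure_display}
  {T1 : measurableType d1} {T2 : measurableType d2}.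
Variables (P1 : {measure set T1 -> \bar R}) (P2 : {measure set T2 -> \bar R}).

Lemma weighted_exp_unique (g1 : T1 -> R) (g2 : T2 -> R)
    (X1 : T1 -> R) (X2 : T2 -> R) (p : R) :
  measurable_fun setT g1 -> measurable_fun setT g2 ->
  (forall x, (0 <= g1 x)%R) -> (forall x, (0 <= g2 x)%R) ->
  measurable_fun setT X1 -> measurable_fun setT X2 ->
  (forall s : R, \int[P1]_x (expR (s * X1 x) * g1 x)%:E < +oo) ->
  (forall s : R, \int[P2]_x (expR (s * X2 x) * g2 x)%:E < +oo) ->
  p != 0%R ->
  (forall n : nat, \int[P1]_x (expR (p / n.+1%:R * X1 x) * g1 x)%:E =
                   \int[P2]_x (expR (p / n.+1%:R * X2 x) * g2 x)%:E) ->
  forall A, measurable A ->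
    \int[P1]_(x in X1 @^-1` A) (g1 x)%:E = \int[P2]_(x in X2 @^-1` A) (g2 x)%:E.
Proof.
move=> mg1 mg2 g10 g20 mX1 mX2 i1 i2 p0 E A mA.
have [nu1 [nu1E nu1I]] := weighted_lawP P1 mg1 g10 mX1.
have [nu2 [nu2E nu2I]] := weighted_lawP P2 mg2 g20 mX2.
have mexp s : measurable_fun [set: R] (fun x : R => (expR (s * x))%:E) by mfun.
have I1 s : \int[nu1]_x (expR (s * x))%:E =
    \int[P1]_x (expR (s * X1 x) * g1 x)%:E.
  by rewrite nu1I// => y; rewrite lee_fin expR_ge0.
have I2 s : \int[nu2]_x (expR (s * x))%:E =
    \int[P2]_x (expR (s * X2 x) * g2 x)%:E.
  by rewrite nu2I// => y; rewrite lee_fin expR_ge0.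
rewrite -nu1E// -nu2E//; apply: (exp_moment_unique _ _ p0) => //.
- by move=> s; rewrite I1.
- by move=> s; rewrite I2.
- by move=> n; rewrite I1 I2.
Qed.

Section boxes.
Variables (n : nat) (X1 : 'I_n -> T1 -> R) (X2 : 'I_n -> T2 -> R).
Hypotheses (mX1 : forall k, measurable_fun setT (X1 k))
  (mX2 : forall k, measurable_fun setT (X2 k)).
Variables (I : Type) (w1 : I -> T1 -> R) (w2 : I -> T2 -> R).
Hypotheses (mw1 : forall q, measurable_fun setT (w1 q))
  (mw2 : forall q, measurable_fun setT (w2 q))
  (w10 : forall q x, (0 <= w1 q x)%R) (w20 : forall q x, (0 <= w2 q x)%R).

(* The hypothesis [step] is uniqueness in one coordinate, for an arbitrary
   restriction of the weights. *)
Lemma weighted_boxes :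
  (forall D1 D2, measurable D1 -> measurable D2 ->
    (forall q, \int[P1]_x (w1 q x * \1_D1 x)%:E =
               \int[P2]_x (w2 q x * \1_D2 x)%:E) ->
    forall q i A, measurable A ->
    \int[P1]_(x in X1 i @^-1` A) (w1 q x * \1_D1 x)%:E =
    \int[P2]_(x in X2 i @^-1` A) (w2 q x * \1_D2 x)%:E) ->
  (forall q, \int[P1]_x (w1 q x)%:E = \int[P2]_x (w2 q x)%:E) ->
  (forall q, \int[P1]_x (w1 q x)%:E < +oo) ->
  forall q B, measurable B ->
    \int[P1]_(x in (fun x => [tuple X1 k x | k < n]) @^-1` B) (w1 q x)%:E =
    \int[P2]_(x in (fun x => [tuple X2 k x | k < n]) @^-1` B) (w2 q x)%:E.
Proof.
move=> step w12 w1oo q B mB.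
have mT1 := measurable_tuple_of mX1; have mT2 := measurable_tuple_of mX2.
have [nu1 [nu1E nu1I]] := weighted_lawP P1 (mw1 q) (w10 q) mT1.
have [nu2 [nu2E nu2I]] := weighted_lawP P2 (mw2 q) (w20 q) mT2.
rewrite -nu1E// -nu2E//; apply: measure_tuple_unique => //.
  by rewrite nu1E// preimage_setT.
move=> A mA.
pose D1 j := [set x | forall k : 'I_n, (k < j)%N -> A k (X1 k x)].
pose D2 j := [set x | forall k : 'I_n, (k < j)%N -> A k (X2 k x)].
have mD1 j : measurable (D1 j).
  rewrite [X in measurable X](_ : _ =
      \bigcap_(k in [set k : 'I_n | (k < j)%N]) (X1 k @^-1` A k)).
    apply: fin_bigcap_measurable => // k _.
    by rewrite -[X in measurable X]setTI; exact: mX1.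
  by apply/seteqP; split => x h k kj; exact: h.
have mD2 j : measurable (D2 j).
  rewrite [X in measurable X](_ : _ =
      \bigcap_(k in [set k : 'I_n | (k < j)%N]) (X2 k @^-1` A k)).
    apply: fin_bigcap_measurable => // k _.
    by rewrite -[X in measurable X]setTI; exact: mX2.
  by apply/seteqP; split => x h k kj; exact: h.
(* All weights are treated at once: passing to the next coordinate tests the current restriction
   against the whole family of weights. *)
have key j : forall r, \int[P1]_x (w1 r x * \1_(D1 j) x)%:E =
                       \int[P2]_x (w2 r x * \1_(D2 j) x)%:E.
  elim: j => [|j IH] r.
    have D10 : D1 0%N = setT by apply/seteqP; split => x //= _ k.
    have D20 : D2 0%N = setT by apply/seteqP; split => x //= _ k.
    rewrite D10 D20; have := w12 r; congr (_ = _); apply: eq_integral => x _.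
      by rewrite indicT mulr1.
    by rewrite indicT mulr1.
  have [jn|nj] := ltnP j n; last first.
    have D1S : D1 j.+1 = D1 j.
      apply/seteqP; split => x h k kj; apply: h; first exact: ltnW.
      exact: leq_trans (ltn_ord k) nj.
    have D2S : D2 j.+1 = D2 j.
      apply/seteqP; split => x h k kj; apply: h; first exact: ltnW.
      exact: leq_trans (ltn_ord k) nj.
    by rewrite D1S D2S.
  have := step _ _ (mD1 j) (mD2 j) IH r (Ordinal jn) _ (mA (Ordinal jn)).
  rewrite integral_mkcond [in X in _ = X -> _]integral_mkcond.
  have S1 : D1 j.+1 = X1 (Ordinal jn) @^-1` A (Ordinal jn) `&` D1 j.
    apply/seteqP; split => x /= => [h|[h1 h2] k].
      by split; [exact: h|move=> k kj; apply: h; exact: ltnW].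
    rewrite ltnS leq_eqVlt => /orP[/eqP kj|]; last exact: h2.
    by have -> : k = Ordinal jn by exact: val_inj.
  have S2 : D2 j.+1 = X2 (Ordinal jn) @^-1` A (Ordinal jn) `&` D2 j.
    apply/seteqP; split => x /= => [h|[h1 h2] k].
      by split; [exact: h|move=> k kj; apply: h; exact: ltnW].
    rewrite ltnS leq_eqVlt => /orP[/eqP kj|]; last exact: h2.
    by have -> : k = Ordinal jn by exact: val_inj.
  rewrite S1 S2; congr (_ = _); apply: eq_integral => x _; rewrite patchE.
    rewrite indicI /= !indicE; case: (x \in X1 _ @^-1` _); rewrite ?mul1r//.
    by rewrite mul0r mulr0.
  rewrite indicI /= !indicE; case: (x \in X2 _ @^-1` _); rewrite ?mul1r//.
  by rewrite mul0r mulr0.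
have mbox : measurable [set x : n.-tuple R | forall k, A k (tnth x k)].
  rewrite [X in measurable X](_ : _ =
      \bigcap_(k in [set: 'I_n]) ((fun x : n.-tuple R => tnth x k) @^-1` A k)).
    apply: fin_bigcap_measurable => // k _.
    by rewrite -[X in measurable X]setTI; exact: measurable_tnth.
  by apply/seteqP; split => x h k //; [move=> _; exact: h|exact: h].
rewrite nu1E// nu2E// integral_mkcond [RHS]integral_mkcond.
have := key n q; congr (_ = _); apply: eq_integral => x _; rewrite patchE.
  have -> : (x \in (fun x => [tuple X1 k x | k < n]) @^-1`
      [set x0 | forall k, A k (tnth x0 k)]) = (x \in D1 n).
    apply/idP/idP; rewrite !inE/= => h k; last by rewrite tnth_mktuple; exact: h.
    by move=> _; have := h k; rewrite tnth_mktuple.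
  by rewrite indicE; case: (x \in _); rewrite ?mulr1 ?mulr0.
have -> : (x \in (fun x => [tuple X2 k x | k < n]) @^-1`
    [set x0 | forall k, A k (tnth x0 k)]) = (x \in D2 n).
  apply/idP/idP; rewrite !inE/= => h k; last by rewrite tnth_mktuple; exact: h.
  by move=> _; have := h k; rewrite tnth_mktuple.
by rewrite indicE; case: (x \in _); rewrite ?mulr1 ?mulr0.
Qed.

End boxes.

Section multivariate.
Variables (n : nat) (X1 : 'I_n -> T1 -> R) (X2 : 'I_n -> T2 -> R).
Hypotheses (mX1 : forall k, measurable_fun setT (X1 k))
  (mX2 : forall k, measurable_fun setT (X2 k)).

(** The weights exp(sum a_k X_k) are stable under multiplication by exp(s X_i), which only changes
    a_i. Equality for all [a] thus contains the one-dimensional hypotheses for each coordinate,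
    which is what [weighted_boxes] asks for. *)
Lemma weighted_tuple_unique (g1 : T1 -> R) (g2 : T2 -> R) :
  measurable_fun setT g1 -> measurable_fun setT g2 ->
  (forall x, (0 <= g1 x)%R) -> (forall x, (0 <= g2 x)%R) ->
  (forall a : 'I_n -> R,
    \int[P1]_x (expR (\sum_(k < n) a k * X1 k x) * g1 x)%:E < +oo) ->
  (forall a : 'I_n -> R,
    \int[P1]_x (expR (\sum_(k < n) a k * X1 k x) * g1 x)%:E =
    \int[P2]_x (expR (\sum_(k < n) a k * X2 k x) * g2 x)%:E) ->
  forall B, measurable B ->
    \int[P1]_(x in (fun x => [tuple X1 k x | k < n]) @^-1` B) (g1 x)%:E =
    \int[P2]_(x in (fun x => [tuple X2 k x | k < n]) @^-1` B) (g2 x)%:E.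
Proof.
move=> mg1 mg2 g10 g20 foo E B mB.
pose w1 (a : 'I_n -> R) x := (expR (\sum_(k < n) a k * X1 k x) * g1 x)%R.
pose w2 (a : 'I_n -> R) x := (expR (\sum_(k < n) a k * X2 k x) * g2 x)%R.
have mw1 a : measurable_fun setT (w1 a).
  rewrite /w1; mfun; apply: measurable_sum => k; mfun; exact: mX1.
have mw2 a : measurable_fun setT (w2 a).
  rewrite /w2; mfun; apply: measurable_sum => k; mfun; exact: mX2.
have w10 a x : (0 <= w1 a x)%R by rewrite mulr_ge0 ?expR_ge0.
have w20 a x : (0 <= w2 a x)%R by rewrite mulr_ge0 ?expR_ge0.
have := @weighted_boxes n X1 X2 mX1 mX2 _ w1 w2 mw1 mw2 w10 w20 _ E foo
  (fun=> 0%R) B mB.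
have w1E : w1 (fun=> 0%R) = g1.
  by apply/funext => x; rewrite /w1 big1 ?expR0 ?mul1r// => k _; rewrite mul0r.
have w2E : w2 (fun=> 0%R) = g2.
  by apply/funext => x; rewrite /w2 big1 ?expR0 ?mul1r// => k _; rewrite mul0r.
rewrite w1E w2E; apply => D1 D2 mD1 mD2 ED a i A mA.
have shift (s : R) (X : 'I_n -> R) : (s * X i + \sum_(k < n) a k * X k =
    \sum_(k < n) (a k + (k == i)%:R * s) * X k)%R.
  rewrite addrC; under [RHS]eq_bigr do rewrite mulrDl.
  rewrite big_split/=; congr (_ + _)%R.
  rewrite (bigD1 i)//= eqxx mul1r big1 ?addr0// => k /negbTE ->.
  by rewrite !mul0r.
have I1 s : \int[P1]_x (expR (s * X1 i x) * (w1 a x * \1_D1 x))%:E =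
    \int[P1]_x (w1 (fun k => a k + (k == i)%:R * s)%R x * \1_D1 x)%:E.
  apply: eq_integral => x _; rewrite /w1 !mulrA -expRD.
  by rewrite (shift s (X1 ^~ x)).
have I2 s : \int[P2]_x (expR (s * X2 i x) * (w2 a x * \1_D2 x))%:E =
    \int[P2]_x (w2 (fun k => a k + (k == i)%:R * s)%R x * \1_D2 x)%:E.
  apply: eq_integral => x _; rewrite /w2 !mulrA -expRD.
  by rewrite (shift s (X2 ^~ x)).
have oo1 b : \int[P1]_x (w1 b x * \1_D1 x)%:E < +oo.
  apply: le_lt_trans (foo b); apply: ge0_le_integral => //.
  - by move=> x _; rewrite lee_fin mulr_ge0.
  - by apply/measurable_EFinP; apply: measurable_funM.
  - by apply/measurable_EFinP; exact: mw1.
  - by move=> x _; rewrite lee_fin indicE ler_piMr// lern1; case: (_ \in _).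
apply: (@weighted_exp_unique _ _ _ _ 1%R).
- by apply: measurable_funM.
- by apply: measurable_funM.
- by move=> x; rewrite mulr_ge0.
- by move=> x; rewrite mulr_ge0.
- exact: mX1.
- exact: mX2.
- by move=> s; rewrite I1.
- by move=> s; rewrite I2 -ED.
- by [].
- by move=> m; rewrite I1 I2.
- exact: mA.
Qed.

(** The same scheme with monomials in place of exponentials: multiplication by X_i^j only raises one
    exponent. *)
Lemma unit_tuple_moment_unique :
  P1 setT < +oo -> P2 setT < +oo ->
  (forall k x, (0 <= X1 k x <= 1)%R) -> (forall k x, (0 <= X2 k x <= 1)%R) ->
  (forall p : 'I_n -> nat,
    \int[P1]_x (\prod_(k < n) X1 k x ^+ p k)%:E =
    \int[P2]_x (\prod_(k < n) X2 k x ^+ p k)%:E) ->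
  forall B, measurable B ->
    P1 ((fun x => [tuple X1 k x | k < n]) @^-1` B) =
    P2 ((fun x => [tuple X2 k x | k < n]) @^-1` B).
Proof.
move=> P1oo P2oo X101 X201 E B mB.
pose w1 (p : 'I_n -> nat) x := (\prod_(k < n) X1 k x ^+ p k)%R.
pose w2 (p : 'I_n -> nat) x := (\prod_(k < n) X2 k x ^+ p k)%R.
have mw1 a : measurable_fun setT (w1 a).
  by rewrite /w1; apply: measurable_prod => k _; mfun; exact: mX1.
have mw2 a : measurable_fun setT (w2 a).
  by rewrite /w2; apply: measurable_prod => k _; mfun; exact: mX2.
have w101 a x : (0 <= w1 a x <= 1)%R.
  rewrite /w1; apply/andP; split.
    by apply: prodr_ge0 => k _; rewrite exprn_ge0//; case/andP: (X101 k x).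
  apply: prodr_ile1 => k _; have /andP[? ?] := X101 k x.
  by rewrite exprn_ge0//= exprn_ile1.
have w201 a x : (0 <= w2 a x <= 1)%R.
  rewrite /w2; apply/andP; split.
    by apply: prodr_ge0 => k _; rewrite exprn_ge0//; case/andP: (X201 k x).
  apply: prodr_ile1 => k _; have /andP[? ?] := X201 k x.
  by rewrite exprn_ge0//= exprn_ile1.
have w10 a x : (0 <= w1 a x)%R by case/andP: (w101 a x).
have w20 a x : (0 <= w2 a x)%R by case/andP: (w201 a x).
have foo a : \int[P1]_x (w1 a x)%:E < +oo.
  apply: (@le_lt_trans _ _ (\int[P1]_x (cst 1%:E) x)).
    apply: ge0_le_integral => //.
    - by move=> x _; rewrite lee_fin.
    - by apply/measurable_EFinP; exact: mw1.
    - by move=> x _; rewrite lee_fin; case/andP: (w101 a x).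
  by rewrite integral_cst// mul1e.
have := @weighted_boxes n X1 X2 mX1 mX2 _ w1 w2 mw1 mw2 w10 w20 _ E foo
  (fun=> 0%N) B mB.
have w1E : w1 (fun=> 0%N) = cst 1%R.
  by apply/funext => x; rewrite /w1 big1.
have w2E : w2 (fun=> 0%N) = cst 1%R.
  by apply/funext => x; rewrite /w2 big1.
have mpre d (T : measurableType d) (X : 'I_n -> T -> R) :
    (forall k, measurable_fun setT (X k)) ->
    measurable ((fun x => [tuple X k x | k < n]) @^-1` B).
  by move=> mX; rewrite -[X in measurable X]setTI; exact: measurable_tuple_of.
have int1 d (T : measurableType d) (P : {measure set T -> \bar R}) D :
    measurable D -> \int[P]_(x in D) (cst 1%R x)%:E = P D.
  by move=> mD; rewrite (integral_cst P mD 1) mul1e.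
rewrite w1E w2E int1 ?int1; [|exact: mpre|exact: mpre].
apply => D1 D2 mD1 mD2 ED p i A mA.
have shift (j : nat) (X : 'I_n -> R) : (X i ^+ j * \prod_(k < n) X k ^+ p k =
    \prod_(k < n) X k ^+ (p k + (k == i) * j))%R.
  under [RHS]eq_bigr do rewrite exprD.
  rewrite big_split/= mulrC; congr (_ * _)%R.
  rewrite (bigD1 i)//= eqxx mul1n big1 ?mulr1// => k /negbTE ->.
  by rewrite mul0n expr0.
have D01 d (T : measurableType d) (D : set T) (x : T) : (0 <= (\1_D x : R) <= 1)%R.
  by rewrite indicE lern1 ler0n; case: (_ \in _).
have [||||nu1 [nu1E e1 M1]] := @unit_weighted_lawP _ _ _ P1
    (fun x => w1 p x * \1_D1 x)%R (X1 i) P1oo.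
- by apply: measurable_funM => //.
- move=> x; have /andP[? ?] := w101 p x; have /andP[? ?] := D01 _ _ D1 x.
  by rewrite mulr_ge0//= mulr_ile1.
- exact: mX1.
- exact: X101.
have [||||nu2 [nu2E e2 M2]] := @unit_weighted_lawP _ _ _ P2
    (fun x => w2 p x * \1_D2 x)%R (X2 i) P2oo.
- by apply: measurable_funM => //.
- move=> x; have /andP[? ?] := w201 p x; have /andP[? ?] := D01 _ _ D2 x.
  by rewrite mulr_ge0//= mulr_ile1.
- exact: mX2.
- exact: X201.
rewrite -nu1E// -nu2E//; apply: moment_unique => // j.
rewrite M1 M2.
transitivity (\int[P1]_x (w1 (fun k => p k + (k == i) * j)%N x * \1_D1 x)%:E).
  by apply: eq_integral => x _; rewrite mulrA (shift j (X1 ^~ x)).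
rewrite ED.
by apply: eq_integral => x _; rewrite mulrA (shift j (X2 ^~ x)).
Qed.

End multivariate.

End weighted_uniqueness.

(** * Gaussian variables: transforms, mean and variance *)

Section real_inequalities.
Context {R : realType}.
Implicit Types x y z m v : R.

Lemma cosh_ge y : 2 + y ^+ 2 <= expR y + expR (- y).
Proof.
wlog y0 : y / 0 <= y.
  move=> h; have [|y0] := leP 0 y; first exact: h.
  have := h (- y); rewrite sqrrN opprK [expR (- y) + _]addrC; apply.
  by rewrite oppr_ge0 ltW.
(* As e^y + e^(-y) - 2 is the square of e^z - e^(-z), it is enough to show e^z - e^(-z) >= 2 z. *)
pose z := y / 2.
have z0 : 0 <= z by rewrite divr_ge0.
have yz : y = z + z by rewrite /z; field.
have e1 : 1 + z + z ^+ 2 / 2 <= expR z.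
  apply: le_trans (series_exp_coeff_le 3 z0).
  by rewrite /series/= !big_nat_recr//= big_geq// /exp_coeff/= expr0 !add0r divr1 expr1 divr1.
have e2 : expR z * expR (- z) = 1 by rewrite -expRD subrr expR0.
have e3 : 0 < expR (- z) by exact: expR_gt0.
have key : 2 * z <= expR z - expR (- z).
  set q := 1 + z + z ^+ 2 / 2 in e1.
  have q0 : 0 < q by rewrite /q; nra.
  have e4 : expR (- z) <= q^-1.
    by rewrite expRN lef_pV2 ?posrE// expR_gt0.
  have : 2 * z <= q - q^-1.
    rewrite lerBrDr -lerBrDl -[q^-1]mul1r ler_pdivrMr//.
    have : 0 <= (z ^+ 2) ^+ 2 by exact: sqr_ge0.
    rewrite /q; nra.
  by lra.
rewrite yz opprD !expRD; nra.
Qed.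

Lemma expR_le_quadratic z : 0 <= z <= 2^-1 -> expR z <= 1 + z + 2 * z ^+ 2.
Proof.
move=> /andP[z0 z1].
have h : 1 - z <= expR (- z) by exact: expR_ge1Dx.
have p : 0 < 1 - z by lra.
have -> : expR z = (expR (- z))^-1 by rewrite expRN invrK.
apply: (@le_trans _ _ (1 - z)^-1); first by rewrite lef_pV2 ?posrE ?expR_gt0.
rewrite -[leLHS]mul1r ler_pdivrMr//; nra.
Qed.

(** Near 0 a nonzero linear term beats a quadratic one. The hypothesis arises by integrating 1 + x
    <= exp x at x = s Y, where Y has mean [m] and transform exp(s^2 v/2). *)
Lemma eq0_of_exp_bound m v : 0 <= v ->
  (forall s, 1 + s * m <= expR (s ^+ 2 * v / 2)) -> m = 0.
Proof.
move=> v0 h; apply/eqP/negPn/negP => m0.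
have mp : 0 < `|m| by rewrite normr_gt0.
(* The size |m|/(v + 1) makes e v less than |m|; the extra factor |m| + 1 gives strictness and e (v
   + 1) < 1, so that [expR_le_quadratic] applies at e^2 v/2. *)
pose e := `|m| / ((v + 1) * (`|m| + 1)).
have e0 : 0 < e by rewrite divr_gt0// mulr_gt0; lra.
have em : e * ((v + 1) * (`|m| + 1)) = `|m|.
  by rewrite divfK// gt_eqF// mulr_gt0; lra.
have e1 : e * (v + 1) < 1.
  have : e * (v + 1) * (`|m| + 1) = `|m| by rewrite -mulrA.
  nra.
have ev : e ^+ 2 * v <= 1 by nra.
have bnd s : `|s| = e -> s * m <= e ^+ 2 * v.
  move=> se; have s2 : s ^+ 2 = e ^+ 2 by rewrite -se real_normK// num_real.
  have := h s; rewrite s2 => h1.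
  have := @expR_le_quadratic (e ^+ 2 * v / 2) => h2.
  have z0 : 0 <= e ^+ 2 * v by rewrite mulr_ge0// sqr_ge0.
  have : 0 <= e ^+ 2 * v / 2 <= 2^-1 by lra.
  by move=> /h2; nra.
have : e * `|m| <= e ^+ 2 * v.
  have [mge|mlt] := leP 0 m; first by rewrite ger0_norm// bnd// gtr0_norm.
  by rewrite ltr0_norm// mulrN -mulNr bnd// normrN gtr0_norm.
rewrite expr2 -mulrA ler_pM2l// => h1.
have : e * v <= e * (v + 1) by nra.
have : e * (v + 1) * (`|m| + 1) = `|m| by rewrite -mulrA.
nra.
Qed.

(** For a centred Y the hypotheses are 2 + (s Y)^2 <= e^(s Y) + e^(- s Y) and 1 - d Y^2 <= e^(- d
    Y^2), integrated. As s and d tend to 0 they give M <= v and v <= M, so the variance is found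
    without differentiating under the integral. *)
Lemma eq_of_second_moment_bounds M v : 0 <= v -> 0 <= M ->
  (forall s, 2 + s ^+ 2 * M <= 2 * expR (s ^+ 2 * v / 2)) ->
  (forall d, 0 <= d -> 1 - d * M <= (Num.sqrt (1 + 2 * d * v))^-1) -> M = v.
Proof.
move=> v0 M0 h1 h2; apply/eqP; rewrite eq_le; apply/andP; split.
  apply/ler_addgt0Pr => e e0.
  (* Here w = s^2, chosen small enough for w v <= 1 and w v^2 <= e. *)
  pose w := e / ((v + 1) ^+ 2 * (e + 1)).
  have p : 0 < (v + 1) ^+ 2 * (e + 1) by rewrite mulr_gt0// ?exprn_gt0//; lra.
  have w0 : 0 < w by rewrite divr_gt0.
  have wE : w * ((v + 1) ^+ 2 * (e + 1)) = e by rewrite divfK// gt_eqF.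
  have wE' : w * (v + 1) ^+ 2 * (e + 1) = e by rewrite -mulrA.
  have w1 : w * (v + 1) ^+ 2 < 1 by nra.
  have w2 : w * (v + 1) ^+ 2 <= e by have : 0 < w * (v + 1) ^+ 2 by [rewrite mulr_gt0// exprn_gt0//; lra]; nra.
  have wv : w * v <= 1 by nra.
  have := h1 (Num.sqrt w); rewrite (sqr_sqrtr (ltW w0)) => h3.
  have wv0 : 0 <= w * v by rewrite mulr_ge0// ltW.
  have : 0 <= w * v / 2 <= 2^-1 by lra.
  move=> /expR_le_quadratic h4.
  have h5 : w * M <= w * (v + w * v ^+ 2).
    have -> : w * (v + w * v ^+ 2) = w * v + (w * v) ^+ 2 by ring.
    nra.
  move: h5; rewrite ler_pM2l// => h5.
  have : w * v ^+ 2 <= w * (v + 1) ^+ 2 by rewrite ler_pM2l//; nra.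
  lra.
apply/ler_addgt0Pr => e e0.
(* The bound reached below is v <= M (1 + 2 d v); this [d] makes the error 2 d v M at most [e]. *)
pose d := e / (2 * v * M + 1).
have vM : 0 <= v * M by rewrite mulr_ge0.
have q0 : 0 < 2 * v * M + 1 by rewrite -mulrA; lra.
have d0 : 0 < d by rewrite divr_gt0.
have dE : d * (2 * v * M + 1) = e by rewrite divfK// gt_eqF.
have := h2 d (ltW d0).
set k := 1 + 2 * d * v.
have k1 : 1 <= k by rewrite /k; nra.
set r := (Num.sqrt k)^-1 => h.
have rk : r ^+ 2 * k = 1.
  by rewrite exprVn sqr_sqrtr ?mulVf// ?gt_eqF//; lra.
have r0 : 0 < r by rewrite invr_gt0 sqrtr_gt0; lra.
have r1 : r <= 1 by rewrite invf_le1 ?sqrtr_gt0//; [rewrite -[leLHS]sqrtr1 ler_sqrt//; lra|lra].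
have h3 : d * v * r ^+ 2 <= 1 - r.
  have : 1 - r ^+ 2 = 2 * (d * v) * r ^+ 2 by rewrite -{1}rk /k; ring.
  nra.
have h4 : v * r ^+ 2 <= M.
  by rewrite -(ler_pM2l d0) mulrA; lra.
have : v <= M * k.
  have -> : v = v * r ^+ 2 * k by rewrite -mulrA rk mulr1.
  by rewrite ler_wpM2r//; lra.
rewrite /k; nra.
Qed.

End real_inequalities.

Section normal_law.
Context {R : realType}.

(** The value of E exp(t (X - c) - dl (X - c)^2) for X normal with mean [mu] and variance [v], point
    masses included. The quadratic term serves twice: to identify the variance, and to integrate
    Gaussian test functions against the intensity. *)
Definition gauss_quad (t c dl mu v : R) : R :=
  (Num.sqrt (1 + 2 * dl * v))^-1 *
  expR ((t * (mu - c) - dl * (mu - c) ^+ 2 + t ^+ 2 * v / 2) / (1 + 2 * dl * v)).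

Lemma normal_quad_integral (mu sigma t c dl : R) : sigma != 0 -> 0 <= dl ->
  (\int[normal_prob mu sigma]_x
     (expR (t * (x - c) - dl * (x - c) ^+ 2))%:E =
   (gauss_quad t c dl mu (sigma ^+ 2))%:E)%E.
Proof.
move=> s0 dl0.
set k := 1 + 2 * dl * sigma ^+ 2.
have k0 : 0 < k by rewrite ltr_pwDl// mulr_ge0 ?sqr_ge0// mulr_ge0.
have sk0 : 0 < Num.sqrt k by rewrite sqrtr_gt0.
pose sigma' := sigma / Num.sqrt k.
have s'0 : sigma' != 0 by rewrite mulf_neq0// invr_eq0 gt_eqF.
(* Completing the square: the tilted density is the constant [gauss_quad] times the normal density
   with mean [mu'] and variance sigma^2/k. *)
pose mu' := (mu + t * sigma ^+ 2 + 2 * dl * sigma ^+ 2 * c) / k.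
have [nu [nuE nuI]] := weighted_lawP lebesgue_measure
  (measurable_normal_pdf mu sigma) (normal_pdf_ge0 mu sigma)
  (@measurable_id _ _ setT).
have mf (a b : R) : measurable_fun [set: R]
    (fun x : R => (expR (t * (x - a) - b * (x - a) ^+ 2))%:E).
  by mfun.
transitivity (\int[nu]_x (expR (t * (x - c) - dl * (x - c) ^+ 2))%:E)%E.
  by apply: eq_measure_integral => A mA _; rewrite nuE.
rewrite nuI; [|exact: mf|by move=> y; rewrite lee_fin expR_ge0].
transitivity (\int[lebesgue_measure]_x
   ((gauss_quad t c dl mu (sigma ^+ 2))%:E * (normal_pdf mu' sigma' x)%:E))%E.
  apply: eq_integral => x _; rewrite -!EFinM; congr EFin.
  rewrite /normal_pdf (negbTE s0) (negbTE s'0) /normal_peak /normal_fun /gauss_quad -/k.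
  have -> : Num.sqrt (sigma' ^+ 2 * pi *+ 2) =
      Num.sqrt (sigma ^+ 2 * pi *+ 2) / Num.sqrt k.
    rewrite -sqrtrV ?ltW// -sqrtrM; last first.
      by rewrite mulrn_wge0// mulr_ge0 ?sqr_ge0 ?pi_ge0.
    congr Num.sqrt; rewrite /sigma' exprMn exprVn sqr_sqrtr ?ltW//.
    by rewrite mulrnAl mulrAC.
  set p := Num.sqrt (_ *+ 2).
  have -> : (p / Num.sqrt k)^-1 = p^-1 * Num.sqrt k.
    by rewrite invfM invrK.
  set E1 := expR _; set E2 := expR _; set E3 := expR _; set E4 := expR _.
  have EE : E1 * E2 = E3 * E4.
    rewrite /E1 /E2 /E3 /E4 -!expRD; congr expR.
    rewrite /mu' /sigma' exprMn exprVn sqr_sqrtr ?ltW//.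
    rewrite /k; field.
    by rewrite s0 gt_eqF.
  have -> : (Num.sqrt k)^-1 * E3 * (p^-1 * Num.sqrt k * E4) =
      p^-1 * (E3 * E4) * ((Num.sqrt k)^-1 * Num.sqrt k) by ring.
  by rewrite mulVf ?gt_eqF// mulr1 -EE; ring.
rewrite ge0_integralZl//.
- by rewrite integral_normal_pdf mule1.
- apply/measurable_EFinP; exact: measurable_normal_pdf.
- by move=> x _; rewrite lee_fin normal_pdf_ge0.
- by rewrite lee_fin /gauss_quad mulr_ge0 ?expR_ge0// invr_ge0 sqrtr_ge0.
Qed.

End normal_law.

Section gaussian_variables.
Local Open Scope ereal_scope.
Context {R : realType} {d : measure_display} {T : measurableType d}.
Variables (P : probability T R).
Implicit Types X : T -> R.

Lemma gaussian_variable_quad X : measurable_fun setT X -> gaussian_variable P X ->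
  exists mu v : R, (0 <= v)%R /\ forall t c dl : R, (0 <= dl)%R ->
    \int[P]_w (expR (t * (X w - c) - dl * (X w - c) ^+ 2))%:E =
    (gauss_quad t c dl mu v)%:E.
Proof.
move=> mX [mu [sigma XE]]; exists mu, (sigma ^+ 2)%R; split; first exact: sqr_ge0.
move=> t c dl dl0.
pose f (x : R) := (expR (t * (x - c) - dl * (x - c) ^+ 2))%:E.
have mf : measurable_fun setT f by rewrite /f; mfun.
have f0 x : 0 <= f x by rewrite lee_fin expR_ge0.
have [s0|s0] := eqVneq sigma 0%R.
  transitivity (\int[\d_mu]_x f x).
    apply: (eq_law_integral (X1 := X) (X2 := id)) => // A mA.
    by have := XE A mA; rewrite s0 eqxx.
  rewrite integral_dirac// diracT mul1e /f /gauss_quad s0 expr0n/=.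
  by rewrite !(mulr0, mul0r, addr0, sqrtr1, invr1, mul1r, mulr1).
rewrite -normal_quad_integral//.
apply: (@eq_law_integral _ _ _ _ _ _ (measurableTypeR R) P
  (normal_prob mu sigma) X id mX (@measurable_id _ _ _) _ f mf f0) => A mA.
by have := XE A mA; rewrite (negbTE s0).
Qed.


Definition gauss_quad_law X (mu v : R) := (0 <= v)%R /\
  forall t c dl : R, (0 <= dl)%R ->
    \int[P]_w (expR (t * (X w - c) - dl * (X w - c) ^+ 2))%:E =
    (gauss_quad t c dl mu v)%:E.

Lemma gauss_quad_mgf X mu v : gauss_quad_law X mu v ->
  forall t, \int[P]_w (expR (t * X w))%:E = (expR (t * mu + t ^+ 2 * v / 2))%:E.
Proof.
move=> [v0 Xq] t; have := Xq t 0%R 0%R (lexx _).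
rewrite /gauss_quad !(mulr0, mul0r, addr0, subr0, sqrtr1, invr1, mul1r, mulr1).
by move=> <-; apply: eq_integral => w _; rewrite !subr0 mul0r subr0.
Qed.

Lemma gauss_quad_moments X mu v : measurable_fun setT X ->
  gauss_quad_law X mu v ->
  [/\ P.-integrable setT (EFin \o X),
      P.-integrable setT (EFin \o (fun w => (X w - mu) ^+ 2)%R),
      \int[P]_w (X w)%:E = mu%:E &
      \int[P]_w ((X w - mu) ^+ 2)%:E = v%:E].
Proof.
move=> mX [v0 Xq].
pose Y w := (X w - mu)%R.
have mY : measurable_fun setT Y by rewrite /Y; mfun.
have mgf s : \int[P]_w (expR (s * Y w))%:E = (expR (s ^+ 2 * v / 2))%:E.
  have := Xq s mu 0%R (lexx _).
  rewrite /gauss_quad subrr !(mulr0, mul0r, addr0, add0r, subr0, sqrtr1, invr1, mul1r, mulr1, expr0n, oppr0).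
  by move=> <-; apply: eq_integral => w _; rewrite mul0r subr0.
have iE s : P.-integrable setT (EFin \o (fun w => expR (s * Y w))).
  apply/integrableP; split; first by mfun.
  rewrite (_ : (fun x => _) = (fun w => (expR (s * Y w))%:E)) ?mgf ?ltry//.
  by apply/funext => w /=; rewrite ger0_norm ?expR_ge0.
have iEE : P.-integrable setT
    (fun w => (expR (1 * Y w))%:E + (expR (- 1 * Y w))%:E).
  by apply: integrableD => //; [exact: (iE 1%R)|exact: (iE (- 1)%R)].
have iY2 : P.-integrable setT (EFin \o (fun w => Y w ^+ 2)%R).
  apply: (@le_integrable _ _ _ P setT measurableT _ _ _ _ iEE); first by mfun.
  move=> w _ /=; rewrite lee_fin mul1r mulN1r.
  have := cosh_ge (Y w); have := sqr_ge0 (Y w).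
  by move=> h1 h2; rewrite !ger0_norm ?addr_ge0 ?expR_ge0//; lra.
have iY : P.-integrable setT (EFin \o Y).
  apply: (@le_integrable _ _ _ P setT measurableT _ _ _ _ iEE); first by mfun.
  move=> w _ /=; rewrite lee_fin mul1r mulN1r.
  have := cosh_ge (Y w); have := sqr_ge0 (`|Y w| - 1).
  rewrite sqrrB1 real_normK ?num_real// mulr2n => h1 h2.
  by rewrite [leRHS]ger0_norm ?addr_ge0 ?expR_ge0//; have := sqr_ge0 (Y w); lra.
pose m1 := fine (\int[P]_w (Y w)%:E).
pose m2 := fine (\int[P]_w (Y w ^+ 2)%:E).
have m1E : \int[P]_w (Y w)%:E = m1%:E.
  by rewrite /m1 fineK//; exact: (@integrable_fin_num _ _ _ P _ measurableT _ iY).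
have m2E : \int[P]_w (Y w ^+ 2)%:E = m2%:E.
  by rewrite /m2 fineK//; exact: (@integrable_fin_num _ _ _ P _ measurableT _ iY2).
have m20 : (0 <= m2)%R.
  by rewrite -lee_fin -m2E; apply: integral_ge0 => w _; rewrite lee_fin sqr_ge0.
have cst1 a : \int[P]_w (cst a%:E w) = a%:E.
  by rewrite integral_cst//= probability_setT mule1.
have icst a : P.-integrable setT (cst a%:E).
  exact: finite_measure_integrable_cst.
have m10 : m1 = 0%R.
  apply: (eq0_of_exp_bound v0) => s.
  rewrite -lee_fin -mgf EFinD EFinM -m1E -integralZl// -[1%:E]cst1.
  rewrite -integralD//; last by apply: (@integrableZl _ _ _ P _ measurableT _ _ iY).
  apply: le_integral => //.
  - apply: integrableD => //.
    by apply: (@integrableZl _ _ _ P _ measurableT _ _ iY).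
  - exact: iE.
  - by move=> w _ /=; rewrite -EFinM -EFinD lee_fin expR_ge1Dx.
have m2v : m2 = v.
  apply: eq_of_second_moment_bounds => //.
  - move=> s; rewrite -lee_fin EFinM -mgf EFinD EFinM -m2E -integralZl//.
    rewrite -[X in (X + _)%E]cst1 -integralD//; last first.
      by apply: (@integrableZl _ _ _ P _ measurableT _ _ iY2).
    have -> : (2%:E * \int[P]_w (expR (s * Y w))%:E =
       \int[P]_w ((expR (s * Y w))%:E + (expR (- s * Y w))%:E))%E.
      rewrite integralD//; [|exact: (iE s)|exact: (iE (- s)%R)].
      by rewrite !mgf sqrrN -EFinM -EFinD; congr EFin; ring.
    apply: le_integral => //.
    + apply: integrableD => //.
      by apply: (@integrableZl _ _ _ P _ measurableT _ _ iY2).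
    + by apply: integrableD => //; [exact: (iE s)|exact: (iE (- s)%R)].
    + move=> w _ /=; rewrite -EFinM -!EFinD lee_fin mulNr -exprMn.
      exact: cosh_ge.
  - move=> dl dl0.
    have := Xq 0%R mu dl dl0.
    rewrite /gauss_quad subrr expr0n/= !(mul0r, mulr0, subr0, addr0, expR0, mulr1).
    move=> h; rewrite -lee_fin -h EFinD EFinN EFinM -m2E -integralZl//.
    rewrite -[1%:E]cst1 -integralB//; last first.
      by apply: (@integrableZl _ _ _ P _ measurableT _ _ iY2).
    have iEd : P.-integrable setT
        (fun w => (expR (0 * (X w - mu) - dl * (X w - mu) ^+ 2))%:E).
      apply/integrableP; split; first by mfun.
      rewrite (_ : (fun x => _) = (fun w =>
        (expR (0 * (X w - mu) - dl * (X w - mu) ^+ 2))%:E)) ?h ?ltry//.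
      by apply/funext => w /=; rewrite ger0_norm ?expR_ge0.
    apply: le_integral => //.
    + apply: integrableB => //.
      by apply: (@integrableZl _ _ _ P _ measurableT _ _ iY2).
    + move=> w _ /=; rewrite -EFinD lee_fin mul0r add0r.
      exact: expR_ge1Dx.
split => //; last by rewrite -m2v -m2E.
  rewrite (_ : _ \o _ = (fun w => (Y w)%:E + cst mu%:E w)); last first.
    by apply/funext => w /=; rewrite -EFinD subrK.
  by apply: integrableD.
transitivity (\int[P]_w ((Y w)%:E + cst mu%:E w)).
  by apply: eq_integral => w _ /=; rewrite -EFinD subrK.
by rewrite integralD// m1E cst1 m10 add0e.
Qed.

End gaussian_variables.

Lemma integral_one {R : realType} {d : measure_display} {T : measurableType d}
    (Q : {measure set T -> \bar R}) D :
  measurable D -> (\int[Q]_(x in D) (1%R)%:E = Q D)%E.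
Proof. by move=> mD; rewrite (integral_cst Q mD 1%E) mul1e. Qed.

Lemma mgf_gaussian_variable {R : realType} {d : measure_display}
    {T : measurableType d} (P : probability T R) (X : T -> R) (mu v : R) :
  measurable_fun setT X -> 0 <= v ->
  (forall t, \int[P]_w (expR (t * X w))%:E = (expR (t * mu + t ^+ 2 * v / 2))%:E)%E ->
  gaussian_variable P X.
Proof.
move=> mX v0 mgf; exists mu, (Num.sqrt v) => A mA.
have m1 : measurable_fun [set: T] (fun=> 1 : R) by [].
have m2 : measurable_fun [set: measurableTypeR R] (fun=> 1 : R) by [].
have main (Q : {measure set (measurableTypeR R) -> \bar R}) :
    (forall t, \int[Q]_x (expR (t * x))%:E = (expR (t * mu + t ^+ 2 * v / 2))%:E)%E ->
    P (X @^-1` A) = Q A.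
  move=> QE.
  have := @weighted_exp_unique _ _ _ T (measurableTypeR R) P Q (fun=> 1) (fun=> 1)
    X id 1 m1 m2 (fun=> ler01) (fun=> ler01) mX (@measurable_id _ _ _) _ _ (oner_neq0 R) _ A mA.
  rewrite integral_one; last by rewrite -[X in measurable X]setTI; exact: mX.
  rewrite integral_one//; apply.
  - by move=> s; under eq_integral do rewrite mulr1; rewrite mgf ltry.
  - by move=> s; under eq_integral do rewrite mulr1; rewrite QE ltry.
  - move=> n; under eq_integral do rewrite mulr1.
    by under [RHS]eq_integral do rewrite mulr1; rewrite mgf QE.
case: ifPn => [|] /eqP s0.
  rewrite (main (@dirac _ (measurableTypeR R) mu R))// => t.
  have v00 : v = 0.
    by apply/eqP; rewrite eq_le v0 andbT -sqrtr_eq0 s0.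
  rewrite integral_dirac// ?diracT ?mul1e ?v00 ?mulr0 ?mul0r ?addr0//.
  by mfun.
apply: (main (normal_prob mu (Num.sqrt v))) => t.
have := @normal_quad_integral _ mu _ t 0 0 (introN eqP s0) (lexx _).
rewrite /gauss_quad !(mulr0, mul0r, addr0, subr0, sqrtr1, invr1, mul1r, mulr1).
rewrite sqr_sqrtr// => <-.
by apply: eq_integral => x _; rewrite subr0 mul0r subr0.
Qed.

Section eq_fdd_mgf.
Context {R : realType} {d1 d2 : measure_display}
  {T1 : measurableType d1} {T2 : measurableType d2} {I : Type}.
Variables (P1 : probability T1 R) (X1 : I -> T1 -> R)
  (P2 : probability T2 R) (X2 : I -> T2 -> R).
Hypotheses (mX1 : forall i, measurable_fun setT (X1 i))
  (mX2 : forall i, measurable_fun setT (X2 i)).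

Lemma eq_fdd_of_mgf :
  (forall n (t : n.-tuple I) (a : 'I_n -> R),
    \int[P1]_w (expR (\sum_(k < n) a k * X1 (tnth t k) w))%:E < +oo)%E ->
  (forall n (t : n.-tuple I) (a : 'I_n -> R),
    \int[P1]_w (expR (\sum_(k < n) a k * X1 (tnth t k) w))%:E =
    \int[P2]_w (expR (\sum_(k < n) a k * X2 (tnth t k) w))%:E)%E ->
  eq_fdd P1 X1 P2 X2.
Proof.
move=> foo E n t A mA.
have := @weighted_tuple_unique _ _ _ T1 T2 P1 P2 n (fun k => X1 (tnth t k))
  (fun k => X2 (tnth t k)) (fun k => mX1 _) (fun k => mX2 _) (fun=> 1) (fun=> 1)
  (measurable_cst _) (measurable_cst _) (fun=> ler01) (fun=> ler01) _ _ A mA.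
have mT1 := @measurable_tuple_of _ _ T1 R n (fun k => X1 (tnth t k)) (fun k => mX1 _).
have mT2 := @measurable_tuple_of _ _ T2 R n (fun k => X2 (tnth t k)) (fun k => mX2 _).
rewrite integral_one; last by rewrite -[X in measurable X]setTI; exact: mT1.
rewrite integral_one; last by rewrite -[X in measurable X]setTI; exact: mT2.
apply => a; first by under eq_integral do rewrite mulr1; exact: foo.
under eq_integral do rewrite mulr1.
by under [RHS]eq_integral do rewrite mulr1; exact: E.
Qed.

Lemma eq_fdd_mgf : eq_fdd P1 X1 P2 X2 ->
  forall n (t : n.-tuple I) (a : 'I_n -> R),
    (\int[P1]_w (expR (\sum_(k < n) a k * X1 (tnth t k) w))%:E =
     \int[P2]_w (expR (\sum_(k < n) a k * X2 (tnth t k) w))%:E)%E.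
Proof.
move=> E n t a.
have mT1 := @measurable_tuple_of _ _ T1 R n (fun k => X1 (tnth t k)) (fun k => mX1 _).
have mT2 := @measurable_tuple_of _ _ T2 R n (fun k => X2 (tnth t k)) (fun k => mX2 _).
have := @eq_law_integral _ _ _ _ _ _ _ P1 P2 _ _ mT1 mT2 (E n t)
  (fun x => (expR (\sum_(k < n) a k * tnth x k))%:E).
set f := fun x => _; have mf : measurable_fun [set: n.-tuple R] f.
  rewrite /f; mfun; apply: measurable_sum => k; mfun; exact: measurable_tnth.
move=> /(_ mf) h.
transitivity (\int[P1]_x f [tuple X1 (tnth t k) x | k < n])%E.
  apply: eq_integral => x _; rewrite /f; congr (expR _)%:E.
  by apply: eq_bigr => k _; rewrite tnth_mktuple.
rewrite h; last by move=> y; rewrite lee_fin expR_ge0.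
apply: eq_integral => x _; rewrite /f; congr (expR _)%:E.
by apply: eq_bigr => k _; rewrite tnth_mktuple.
Qed.

End eq_fdd_mgf.

(** * Gaussian processes through mean and covariance *)

Section gaussian_processes.
Context {R : realType} {d : measure_display} {T : measurableType d} {I : Type}.
Variables (P : probability T R) (X : I -> T -> R).
Hypothesis mX : forall i, measurable_fun setT (X i).

Definition quad_form (K : I -> I -> R) n (t : n.-tuple I) (a : 'I_n -> R) : R :=
  \sum_(j < n) \sum_(k < n) a j * a k * K (tnth t j) (tnth t k).

(** Together with a nonnegative [quad_form] this expresses Gaussianity of all finite-dimensional
    laws; shifts and increments are then compared by comparing exponents. *)
Definition gauss_mgf (mu : I -> R) (K : I -> I -> R) :=
  forall n (t : n.-tuple I) (a : 'I_n -> R),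
    (\int[P]_w (expR (\sum_(k < n) a k * X (tnth t k) w))%:E =
     (expR (\sum_(k < n) a k * mu (tnth t k) + quad_form K t a / 2))%:E)%E.

Lemma gaussian_processP : gaussian_process P X ->
  exists (mu : I -> R) (K : I -> I -> R),
    [/\ gauss_mgf mu K, (forall n (t : n.-tuple I) a, 0 <= quad_form K t a),
        (forall s t, K s t = K t s),
        (forall t, gauss_quad_law P (X t) (mu t) (K t t)) &
        forall t, ('E_P[X t] = (mu t)%:E /\ 'V_P[X t] = (K t t)%:E)%E].
Proof.
move=> GX.
have gX t : exists mv : R * R, gauss_quad_law P (X t) mv.1 mv.2.
  have gt : gaussian_variable P (X t).
    have := GX 1%N [tuple t] (fun=> 1); congr gaussian_variable.
    by apply/funext => w; rewrite big_ord1 mul1r tnth0.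
  have [mu [v h]] := gaussian_variable_quad (mX t) gt.
  by exists (mu, v).
have [mv mvE] := choice gX.
pose mu t := (mv t).1.
pose Y t w := X t w - mu t.
have mY t : measurable_fun setT (Y t) by rewrite /Y; mfun; exact: mX.
have M t := gauss_quad_moments (mX t) (mvE t).
have iYY s t : P.-integrable setT (EFin \o (fun w => Y s w * Y t w)).
  have [_ is2 _ _] := M s; have [_ it2 _ _] := M t.
  apply: (@le_integrable _ _ _ P setT measurableT _ _ _ _
    (integrableD measurableT is2 it2)); first by mfun.
  move=> w _ /=; rewrite lee_fin -/(Y s w) -/(Y t w).
  rewrite [leRHS]ger0_norm ?addr_ge0 ?sqr_ge0// normrM.
  rewrite -(real_normK (num_real (Y s w))) -(real_normK (num_real (Y t w))).
  have := sqr_ge0 (`|Y s w| - `|Y t w|).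
  have := normr_ge0 (Y s w); have := normr_ge0 (Y t w); nra.
pose K s t := fine (\int[P]_w (Y s w * Y t w)%:E)%E.
have KE s t : (\int[P]_w (Y s w * Y t w)%:E = (K s t)%:E)%E.
  by rewrite /K fineK//; exact: (@integrable_fin_num _ _ _ P _ measurableT _ (iYY s t)).
have Kv t : K t t = (mv t).2.
  have [_ _ _ h] := M t; apply/EFin_inj; rewrite -KE -h.
  by apply: eq_integral => w _; rewrite expr2.
have cst1 a : (\int[P]_w (cst a%:E w) = a%:E)%E.
  by rewrite integral_cst//= probability_setT mule1.
exists mu, K.
(* The definition of a Gaussian process only supplies some mean and variance for each combination;
   computing its first two moments identifies them. *)
have comb n (t : n.-tuple I) (a : 'I_n -> R) :
    gauss_quad_law P (fun w => \sum_(k < n) a k * X (tnth t k) w)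
      (\sum_(k < n) a k * mu (tnth t k)) (quad_form K t a).
  have mL : measurable_fun setT (fun w => \sum_(k < n) a k * X (tnth t k) w).
    by apply: measurable_sum => k; mfun; exact: mX.
  have [m [v h]] := gaussian_variable_quad mL (GX n t a).
  have [_ _ mE vE] := gauss_quad_moments mL h.
  have mE' : m = \sum_(k < n) a k * mu (tnth t k).
    apply/EFin_inj; rewrite -mE -sumEFin.
    transitivity (\int[P]_w (\sum_(k < n) (a k)%:E * (X (tnth t k) w)%:E))%E.
      by apply: eq_integral => w _; rewrite -sumEFin.
    rewrite integral_sum//.
      apply: eq_bigr => k _; have [iX _ XE _] := M (tnth t k).
      by rewrite integralZl// XE.
    move=> k; have [iX _ _ _] := M (tnth t k).
    exact: (@integrableZl _ _ _ P _ measurableT _ _ iX).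
  have vE' : v = quad_form K t a.
    apply/EFin_inj; rewrite -vE /quad_form -sumEFin.
    transitivity (\int[P]_w (\sum_(j < n) \sum_(k < n)
        (a j * a k)%:E * (Y (tnth t j) w * Y (tnth t k) w)%:E))%E.
      apply: eq_integral => w _; rewrite mE' -sumrB.
      under eq_bigr do rewrite -mulrBr.
      rewrite expr2 big_distrlr/= -sumEFin; apply: eq_bigr => j _.
      rewrite -sumEFin; apply: eq_bigr => k _.
      by rewrite -EFinM; congr EFin; rewrite /Y; ring.
    have iZ j k : P.-integrable setT (fun w =>
        ((a j * a k)%:E * (Y (tnth t j) w * Y (tnth t k) w)%:E)%E).
      exact: (@integrableZl _ _ _ P _ measurableT _ _ (iYY _ _)).
    rewrite integral_sum//; last by move=> j; apply: integrable_sum => // k _; exact: iZ.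
    apply: eq_bigr => j _; rewrite integral_sum// -sumEFin.
    by apply: eq_bigr => k _; rewrite integralZl//; [rewrite KE|exact: iYY].
  by rewrite -mE' -vE'.
split.
- move=> n t a; have := gauss_quad_mgf (comb n t a) 1.
  rewrite mul1r expr1n mul1r => <-.
  by apply: eq_integral => w _; rewrite mul1r.
- by move=> n t a; have [] := comb n t a.
- by move=> s t; rewrite /K; congr fine; apply: eq_integral => w _; rewrite mulrC.
- by move=> t; rewrite Kv.
move=> t; have [_ _ h1 h2] := M t.
have EX : ('E_P[X t] = (mu t)%:E)%E by rewrite unlock.
split => //; rewrite /variance unlock EX/= unlock -KE.
exact: eq_integral.
Qed.

Lemma gauss_mgf_gaussian_process mu K : gauss_mgf mu K ->
  (forall n (t : n.-tuple I) a, 0 <= quad_form K t a) -> gaussian_process P X.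
Proof.
move=> mgf K0 n t a.
apply: (@mgf_gaussian_variable _ _ _ _ _ (\sum_(k < n) a k * mu (tnth t k))
  (quad_form K t a)) => //.
  by apply: measurable_sum => k; mfun; exact: mX.
move=> s; have := mgf n t (fun k => s * a k).
have -> : quad_form K t (fun k => s * a k) = s ^+ 2 * quad_form K t a.
  rewrite /quad_form mulr_sumr; apply: eq_bigr => j _.
  by rewrite mulr_sumr; apply: eq_bigr => k _; ring.
have lin (b : 'I_n -> R) : \sum_(k < n) s * a k * b k = s * \sum_(k < n) a k * b k.
  by rewrite mulr_sumr; apply: eq_bigr => k _; rewrite mulrA.
by rewrite lin => <-; apply: eq_integral => w _; rewrite lin.
Qed.

End gaussian_processes.

(** * Averaging out independent marks *)

Lemma integral_weight_indic {R : realType} {d : measure_display}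
    {T : measurableType d} (P : {measure set T -> \bar R}) (V W : set T)
    (h : T -> R) :
  (\int[P]_(x in V) (h x * \1_W x)%:E = \int[P]_(x in V `&` W) (h x)%:E)%E.
Proof.
rewrite integral_mkcond [RHS]integral_mkcond; apply: eq_integral => x _.
rewrite !patchE in_setI indicE; case: (x \in V) => //=.
by case: (x \in W); rewrite ?mulr1 ?mulr0.
Qed.

Section marking.
Context {R : realType} {d dS : measure_display} {T : measurableType d}
  {S : measurableType dS}.
Variables (P : probability T R) (E : nat -> set T) (U : nat -> T -> R)
  (X : nat -> T -> S) (Q : {measure set S -> \bar R}) (calU : set (set T)).
Hypotheses (mE : forall i, measurable (E i))
  (mU : forall i, measurable_fun setT (U i))
  (mX : forall i, measurable_fun setT (X i)) (Q1 : Q setT = 1%E).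
Hypotheses (calU_measurable : calU `<=` measurable)
  (calUT : calU setT)
  (calU_diff : forall D i, calU D -> calU (D `\` E i))
  (calU_cap : forall D i A, calU D -> measurable A ->
     calU (D `&` (E i `&` U i @^-1` A))).
Hypothesis indep : forall (D : set T) (s : seq nat) (B : nat -> set S),
  calU D -> uniq s -> (forall i, measurable (B i)) ->
  (P (D `&` [set w | forall i, i \in s -> B i (X i w)]) =
   P D * \prod_(i <- s) Q (B i))%E.
Variable f : R * S -> R.
Hypotheses (mf : measurable_fun setT f) (f01 : forall z, 0 <= f z <= 1).

Definition mark_mean (u : R) : R := fine (\int[Q]_x (f (u, x))%:E)%E.

Let measurable_f u : measurable_fun setT (fun x => f (u, x)).
Proof. exact: (measurableT_comp mf (measurable_pair1 u)). Qed.

Lemma mark_meanE u : (\int[Q]_x (f (u, x))%:E = (mark_mean u)%:E)%E.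
Proof.
rewrite /mark_mean fineK// ge0_fin_numE; last first.
  by apply: integral_ge0 => x _; rewrite lee_fin; case/andP: (f01 (u, x)).
apply: (@le_lt_trans _ _ (\int[Q]_x (1%R)%:E)%E); last first.
  by rewrite integral_one// Q1 ltry.
apply: ge0_le_integral => //.
- by move=> x _; rewrite lee_fin; case/andP: (f01 (u, x)).
- by apply/measurable_EFinP; exact: measurable_f.
- by move=> x _; rewrite lee_fin; case/andP: (f01 (u, x)).
Qed.

Lemma mark_mean01 u : 0 <= mark_mean u <= 1.
Proof.
rewrite -!lee_fin -mark_meanE; apply/andP; split.
  by apply: integral_ge0 => x _; rewrite lee_fin; case/andP: (f01 (u, x)).
rewrite -[leRHS]Q1 -integral_one//.
apply: ge0_le_integral => //.
- by move=> x _; rewrite lee_fin; case/andP: (f01 (u, x)).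
- by apply/measurable_EFinP; exact: measurable_f.
- by move=> x _; rewrite lee_fin; case/andP: (f01 (u, x)).
Qed.

Lemma measurable_mark_mean : measurable_fun setT mark_mean.
Proof.
have Qoo : (Q setT < +oo)%E by rewrite Q1 ltry.
have [mu muE] := finite_measure_pack Qoo.
have mef : measurable_fun setT (EFin \o f) by exact/measurable_EFinP.
have ef0 z : (0 <= (EFin \o f) z)%E by rewrite lee_fin; case/andP: (f01 z).
have := @measurable_fun_fubini_tonelli_F _ _ R S R mu (EFin \o f) mef ef0.
move=> h; apply/measurable_EFinP; apply: eq_measurable_fun h => u _.
rewrite /= -mark_meanE; apply: eq_measure_integral => A mA _.
by have := congr1 (fun q : set S -> \bar R => q A) muE.
Qed.

(** An absent point contributes the neutral factor 1. In [mean_factor] the mark is replaced by its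
    average. *)
Definition mark_factor i w := if w \in E i then f (U i w, X i w) else 1.
Definition mean_factor i w := if w \in E i then mark_mean (U i w) else 1.

Lemma mark_factor01 i w : 0 <= mark_factor i w <= 1.
Proof. by rewrite /mark_factor; case: ifP => // _; rewrite ler01 lexx. Qed.

Lemma mean_factor01 i w : 0 <= mean_factor i w <= 1.
Proof.
by rewrite /mean_factor; case: ifP => // _; rewrite ?mark_mean01 ?ler01 ?lexx.
Qed.

Lemma measurable_ifE i (g : T -> R) : measurable_fun setT g ->
  measurable_fun setT (fun w => if w \in E i then g w else 1).
Proof.
move=> mg.
rewrite (_ : (fun w => _) = (fun w => g w * \1_(E i) w + \1_(~` E i) w)).
  apply: measurable_funD; last by apply: measurable_indic; exact: measurableC.
  by apply: measurable_funM => //; exact: measurable_indic.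
apply/funext => w; rewrite !indicE in_setC; case: (w \in E i).
  by rewrite mulr1 addr0.
by rewrite mulr0 add0r.
Qed.

Lemma measurable_mark_factor i : measurable_fun setT (mark_factor i).
Proof.
apply: measurable_ifE; apply: (measurableT_comp mf).
exact: measurable_fun_pair.
Qed.

Lemma measurable_mean_factor i : measurable_fun setT (mean_factor i).
Proof.
apply: measurable_ifE; apply: (measurableT_comp measurable_mark_mean).
exact: mU.
Qed.

Lemma measurable_marks (s : seq nat) (B : nat -> set S) :
  (forall i, measurable (B i)) ->
  measurable [set w | forall i, i \in s -> B i (X i w)].
Proof.
move=> mB.
rewrite [X in measurable X](_ : _ = \bigcap_(i in [set` s]) (X i @^-1` B i)).
  apply: fin_bigcap_measurable => // i _.
  by rewrite -[X in measurable X]setTI; exact: mX.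
by apply/seteqP; split => w h i iS; exact: h.
Qed.

(* Averages the marks out one at a time, from the first to the last. *)
Lemma marking_prod n (D : set T) (s : seq nat) (B : nat -> set S) :
  calU D -> uniq s -> (forall i, i \in s -> (n <= i)%N) ->
  (forall i, measurable (B i)) ->
  (\int[P]_(w in D `&` [set w | forall i, i \in s -> B i (X i w)])
     (\prod_(i < n) mark_factor i w)%:E =
   \prod_(i <- s) Q (B i) * \int[P]_(w in D) (\prod_(i < n) mean_factor i w)%:E)%E.
Proof.
have mprod (g : nat -> T -> R) k : (forall i, measurable_fun setT (g i)) ->
    measurable_fun setT (fun w => \prod_(i < k) g i w).
  by move=> mg; apply: measurable_prod => i _; exact: mg.
have p0 (g : nat -> T -> R) k w : (forall i w, 0 <= g i w <= 1) ->
    0 <= \prod_(i < k) g i w.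
  by move=> g01; apply: prodr_ge0 => i _; case/andP: (g01 i w).
pose C (s : seq nat) (B : nat -> set S) :=
  [set w | forall i, i \in s -> B i (X i w)].
elim: n D s B => [|n IH] D s B UD us sn mB.
  under eq_integral do rewrite big_ord0.
  under [in RHS]eq_integral do rewrite big_ord0.
  rewrite !integral_one.
  - by rewrite [RHS]muleC; exact: indep.
  - exact: calU_measurable.
  - by apply: measurableI; [exact: calU_measurable|exact: measurable_marks].
have mD := calU_measurable UD.
have mC s' B' : (forall i, measurable (B' i)) -> measurable (C s' B').
  by move=> mB'; exact: measurable_marks.
pose H w := \prod_(i < n) mark_factor i w.
pose Phi w := \prod_(i < n) mean_factor i w.
have mH : measurable_fun setT H by apply: mprod => i; exact: measurable_mark_factor.
have mPhi : measurable_fun setT Phi by apply: mprod => i; exact: measurable_mean_factor.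
have H0 w : 0 <= H w by apply: p0; exact: mark_factor01.
have Phi0 w : 0 <= Phi w by apply: p0; exact: mean_factor01.
(* Splits on the presence of point [n]; the part where it is absent is the induction hypothesis for
   D minus E n. *)
have split_int (A : set T) (g h : T -> R) : measurable A -> measurable_fun setT h ->
    measurable_fun setT g -> (forall w, 0 <= h w) -> (forall w, 0 <= g w) ->
    (\int[P]_(w in A) (h w * (if w \in E n then g w else 1))%:E =
     \int[P]_(w in A `\` E n) (h w)%:E +
     \int[P]_(w in A `&` E n) (h w * g w)%:E)%E.
  move=> mA mh mg h0 g0.
  have mhg : measurable_fun setT (fun w => (h w * (if w \in E n then g w else 1))%:E).
    by apply/measurable_EFinP; apply: measurable_funM => //; exact: measurable_ifE.
  rewrite -[in LHS](setUIDK A (E n)) setUC ge0_integral_setU//.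
  - congr (_ + _)%E; apply: eq_integral => w; rewrite inE => -[Aw Ew].
      by rewrite (memNset Ew) mulr1.
    by rewrite (mem_set Ew).
  - exact: measurableD.
  - exact: measurableI.
  - exact: measurable_funS mhg.
  - by move=> w _; rewrite lee_fin mulr_ge0//; case: ifP.
  - by apply/disj_setPS => w [[_ ?] [_ ?]].
have [c cE] : exists c : R, (\prod_(i <- s) Q (B i) = c%:E)%E.
  exists (\prod_(i <- s) fine (Q (B i))); rewrite -prodEFin; apply: eq_bigr => i _.
  rewrite fineK// ge0_fin_numE// (@le_lt_trans _ _ (Q setT))//.
    by apply: le_measure; rewrite ?inE.
  by rewrite Q1 ltry.
have c0 : 0 <= c by rewrite -lee_fin -cE; apply: prode_ge0.
pose g w := f (U n w, X n w); pose gm w := mark_mean (U n w).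
have mZ : measurable_fun setT (fun w => (U n w, X n w)).
  exact: measurable_fun_pair.
have mg : measurable_fun setT g by exact: (measurableT_comp mf mZ).
have mgm : measurable_fun setT gm by exact: (measurableT_comp measurable_mark_mean (mU n)).
have g0 w : 0 <= g w by case/andP: (f01 (U n w, X n w)).
have gm0 w : 0 <= gm w by case/andP: (mark_mean01 (U n w)).
have mA : measurable (D `&` C s B) by apply: measurableI => //; exact: mC.
have snn i : i \in s -> (n <= i)%N by move=> /sn /ltnW.
have ns : n \notin s by apply/negP => /sn; rewrite ltnn.
transitivity (\int[P]_(w in D `&` C s B)
    (H w * (if w \in E n then g w else 1))%:E)%E.
  by apply: eq_integral => w _; rewrite big_ord_recr.
rewrite split_int//.
have -> : (\int[P]_(w in D) (\prod_(i < n.+1) mean_factor i w)%:E =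
    \int[P]_(w in D) (Phi w * (if w \in E n then gm w else 1))%:E)%E.
  by apply: eq_integral => w _; rewrite big_ord_recr.
rewrite split_int// cE ge0_muleDr; last 2 first.
- by apply: integral_ge0 => w _; rewrite lee_fin.
- by apply: integral_ge0 => w _; rewrite lee_fin mulr_ge0.
congr (_ + _)%E.
  rewrite -cE -IH//; last exact: calU_diff.
  by congr (integral _ _ _); rewrite setDE setIAC -setDE.
have mDE : measurable (D `&` E n) by exact: measurableI.
have mAE : measurable (D `&` C s B `&` E n) by exact: measurableI.
pose h1 w := H w * \1_(D `&` C s B `&` E n) w.
have mh1 : measurable_fun setT h1.
  by apply: measurable_funM => //; exact: measurable_indic.
have h10 w : 0 <= h1 w by rewrite mulr_ge0.
pose h2 w := c * Phi w * \1_(D `&` E n) w.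
have mh2 : measurable_fun setT h2.
  apply: measurable_funM; last exact: measurable_indic.
  by apply: measurable_funM.
have h20 w : 0 <= h2 w by rewrite !mulr_ge0.
have [nu [nuE nuI]] := weighted_lawP P mh1 h10 mZ.
have [nu1 [nu1E nu1I]] := weighted_lawP P mh2 h20 (mU n).
(* On a rectangle, the event U n in V is absorbed into [D] and X n in W into the mark constraints,
   so the induction hypothesis evaluates [nu]. For this the claim is proved for all [D], [s] and
   [B]. *)
have nuR (V : set R) (W : set S) : measurable V -> measurable W ->
    (nu (V `*` W) = nu1 V * Q W)%E.
  move=> mV mW; rewrite nuE; last exact: measurableX.
  rewrite nu1E// !integral_weight_indic.
  pose B' i := if i == n then W else B i.
  have mB' i : measurable (B' i) by rewrite /B'; case: ifP.
  have -> : (fun w => (U n w, X n w)) @^-1` (V `*` W) `&` (D `&` C s B `&` E n) =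
      (D `&` (E n `&` U n @^-1` V)) `&` C (n :: s) B'.
    apply/seteqP; split => w /=.
      move=> [[Vw Ww] [[Dw Cw] Ew]]; split => // i.
      rewrite inE /B' => /orP[/eqP ->|iS]; first by rewrite eqxx.
      by case: eqP => [->//|_]; exact: Cw.
    move=> [[Dw [Ew Vw]] Cw]; split.
      by split => //; have := Cw n; rewrite mem_head /B' eqxx; exact.
    split => //; split => // i iS; have := Cw i; rewrite inE iS orbT /B'.
    by case: eqP => [ni|_]; [rewrite -ni iS in ns|exact].
  rewrite IH//; last 3 first.
  - exact: calU_cap.
  - by rewrite /= ns.
  - by move=> i; rewrite inE => /orP[/eqP ->//|/snn].
  rewrite big_cons {1}/B' eqxx.
  have -> : (\prod_(i <- s) Q (B' i) = c%:E)%E.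
    rewrite -cE; apply: eq_big_seq => i iS; rewrite /B'.
    by case: eqP => // ni; rewrite -ni iS in ns.
  have -> : U n @^-1` V `&` (D `&` E n) = D `&` (E n `&` U n @^-1` V).
    by rewrite setIC setIA.
  under [in RHS]eq_integral do rewrite EFinM.
  rewrite ge0_integralZl//.
  - by rewrite [RHS]muleC muleA.
  - apply: measurableI => //; apply: measurableI => //.
    by rewrite -[X in measurable X]setTI; exact: mU.
  - by apply: measurable_funTS; exact/measurable_EFinP.
  - by move=> w _; rewrite lee_fin.
transitivity (\int[nu]_z (f z)%:E)%E.
  rewrite nuI; last 2 first.
  - exact/measurable_EFinP.
  - by move=> z; rewrite lee_fin; case/andP: (f01 z).
  rewrite -[in LHS](setTI (_ `&` E n)) -integral_weight_indic.
  by apply: eq_integral => w _; rewrite /h1 -EFinM /g; congr EFin; ring.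
rewrite (integral_rectangle_unique _ _ nuR); last 4 first.
- rewrite nu1E// preimage_setT; apply: (@le_lt_trans _ _ (\int[P]_x c%:E)%E).
    apply: ge0_le_integral => //.
    + by move=> w _; rewrite lee_fin.
    + by apply/measurable_EFinP.
    + move=> w _; rewrite lee_fin /h2 -mulrA ler_piMr//.
      have /andP[p1 p2] : 0 <= Phi w <= 1.
        apply/andP; split => //; apply: prodr_ile1 => i _.
        by have := mean_factor01 i w.
      by rewrite mulr_ile1// indicE lern1; case: (_ \in _).
  by rewrite integral_cst//= probability_setT mule1 ltry.
- by rewrite Q1 ltry.
- exact/measurable_EFinP.
- by move=> z; rewrite lee_fin; case/andP: (f01 z).
under eq_integral do rewrite mark_meanE.
rewrite nu1I; last 2 first.
- by apply/measurable_EFinP; exact: measurable_mark_mean.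
- by move=> u; rewrite lee_fin; case/andP: (mark_mean01 u).
rewrite -ge0_integralZl//; last 2 first.
- by apply: measurable_funTS; apply/measurable_EFinP; exact: measurable_funM.
- by move=> w _; rewrite lee_fin mulr_ge0.
under [RHS]eq_integral do rewrite -EFinM.
rewrite -[in RHS](setTI (_ `&` E n)) -integral_weight_indic.
by apply: eq_integral => w _; rewrite /h2 -EFinM /gm; congr EFin; ring.
Qed.

End marking.

(** * Expectations of products of independent variables *)

Section independent_products.
Context {R : realType} {d dS : measure_display} {T : measurableType d}
  {S : measurableType dS} {I : choiceType}.
Variables (P : probability T R) (N : I -> T -> S) (y : I -> S -> R).
Hypotheses (mN : forall i, measurable_fun setT (N i))
  (my : forall i, measurable_fun setT (y i)) (y01 : forall i x, 0 <= y i x <= 1).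
Hypothesis indep : mutually_independent P
  (fun i => preimage_set_system setT (N i) measurable).

(** Indices in [r] carry functions and those in [s] carry events. The induction turns one function
    at a time into an event, because equality on events extends to functions of N_j. *)
Lemma independent_prod_aux (r s : seq I) (A : I -> set S) :
  uniq (r ++ s) -> (forall i, measurable (A i)) ->
  (\int[P]_(w in [set w | forall i, i \in s -> A i (N i w)])
     (\prod_(j <- r) y j (N j w))%:E =
   \prod_(j <- r) \int[P]_w (y j (N j w))%:E * \prod_(i <- s) P (N i @^-1` A i))%E.
Proof.
pose C (s : seq I) (A : I -> set S) := [set w : T | forall i, i \in s -> A i (N i w)].
have CE s' A' : C s' A' = \bigcap_(i in [set` s']) (N i @^-1` A' i).
  by apply/seteqP; split => w h i iS; exact: h.
have mC s' A' : (forall i, measurable (A' i)) -> measurable (C s' A').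
  move=> mA; rewrite CE; apply: fin_bigcap_measurable => // i _.
  by rewrite -[X in measurable X]setTI; exact: mN.
have myN i : measurable_fun setT (fun w => y i (N i w)).
  exact: (measurableT_comp (my i) (mN i)).
have y0 i x : 0 <= y i x by case/andP: (y01 i x).
elim: r s A => [|j r IH] s A.
  move=> /= us mA; rewrite big_nil mul1e.
  under eq_integral do rewrite big_nil.
  rewrite integral_one; last exact: mC.
  have := CE s A; rewrite /C => ->; apply: indep => // i _.
  by exists (A i) => //; rewrite setTI.
move=> urs mA.
have urjs : uniq (r ++ j :: s).
  by rewrite (perm_uniq (_ : perm_eq _ (j :: r ++ s)))// -cat1s perm_catCA.
have urs' : uniq (r ++ s) by move: urs => /= /andP[].
have js : j \notin s.
  by move: urs => /= /andP[]; rewrite mem_cat negb_or => /andP[].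
pose H w := \prod_(i <- r) y i (N i w).
have mH : measurable_fun setT H by apply: measurable_prod => i _.
have H0 w : 0 <= H w by apply: prodr_ge0.
pose h w := H w * \1_(C s A) w.
have mh : measurable_fun setT h.
  by apply: measurable_funM => //; apply: measurable_indic; exact: mC.
have h0 w : 0 <= h w by rewrite mulr_ge0.
have fin_y i : exists c : R, 0 <= c /\ (\int[P]_w (y i (N i w))%:E = c%:E)%E.
  exists (fine (\int[P]_w (y i (N i w))%:E)%E).
  have p : (0 <= \int[P]_w (y i (N i w))%:E)%E.
    by apply: integral_ge0 => w _; rewrite lee_fin.
  rewrite fine_ge0// fineK// ge0_fin_numE//.
  apply: (@le_lt_trans _ _ (\int[P]_w (1%R)%:E)%E).
    apply: ge0_le_integral => //.
    - by move=> w _; rewrite lee_fin.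
    - exact/measurable_EFinP.
    - by move=> w _; rewrite lee_fin; case/andP: (y01 i (N i w)).
  by rewrite integral_one//= probability_setT ltry.
have [c cE] := choice fin_y.
pose K := \prod_(i <- r) c i * \prod_(i <- s) fine (P (N i @^-1` A i)).
have K0 : 0 <= K.
  rewrite mulr_ge0//; first by apply: prodr_ge0 => i _; case: (cE i).
  by apply: prodr_ge0 => i _; apply: fine_ge0.
have mNA i B : measurable B -> measurable (N i @^-1` B).
  by move=> mB; rewrite -[X in measurable X]setTI; exact: mN.
have KE : (\prod_(i <- r) \int[P]_w (y i (N i w))%:E *
    \prod_(i <- s) P (N i @^-1` A i) = K%:E)%E.
  rewrite /K EFinM -!prodEFin; congr (_ * _)%E.
    by apply: eq_bigr => i _; case: (cE i).
  by apply: eq_bigr => i _; rewrite fineK// fin_num_measure//; exact: mNA.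
transitivity (\int[P]_w ((y j (N j w))%:E * (h w)%:E))%E.
  under eq_integral do rewrite big_cons.
  rewrite -[in LHS](setTI [set w | _]) -integral_weight_indic.
  by apply: eq_integral => w _; rewrite -EFinM mulrA.
rewrite (@eq_weighted_integral _ _ _ _ _ _ _ P P h (fun=> K) (N j) (N j) mh
  (measurable_cst _) h0 (fun=> K0) (mN j) (mN j) _ (EFin \o y j)).
- rewrite big_cons -muleA KE /=; under eq_integral do rewrite muleC.
  rewrite ge0_integralZl//; first by rewrite muleC.
  + exact/measurable_EFinP.
  + by move=> w _; rewrite lee_fin.
- move=> B mB; rewrite integral_weight_indic.
  pose A' i := if i == j then B else A i.
  have mA' i : measurable (A' i) by rewrite /A'; case: ifP.
  have -> : N j @^-1` B `&` C s A = C (j :: s) A'.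
    apply/seteqP; split => w /=.
      move=> [Bw Cw] i; rewrite inE /A' => /orP[/eqP ->|iS]; first by rewrite eqxx.
      by case: eqP => [->//|_]; exact: Cw.
    move=> Cw; split; first by have := Cw j; rewrite mem_head /A' eqxx; exact.
    move=> i iS; have := Cw i; rewrite inE iS orbT /A'.
    by case: eqP => [ij|_]; [rewrite -ij iS in js|exact].
  rewrite IH// big_cons {1}/A' eqxx.
  have -> : (\prod_(i <- s) P (N i @^-1` A' i) = \prod_(i <- s) P (N i @^-1` A i))%E.
    apply: eq_big_seq => i iS; rewrite /A'.
    by case: eqP => // ij; rewrite -ij iS in js.
  rewrite muleCA KE (integral_cst P (mNA j B mB) K%:E).
  exact: muleC.
- exact/measurable_EFinP.
- by move=> x; rewrite lee_fin.
Qed.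

Lemma independent_prod (r : seq I) : uniq r ->
  (\int[P]_w (\prod_(j <- r) y j (N j w))%:E =
   \prod_(j <- r) \int[P]_w (y j (N j w))%:E)%E.
Proof.
move=> ur; have := @independent_prod_aux r [::] (fun=> setT).
rewrite cats0 big_nil mule1 => <-//.
by congr (integral _ _ _); apply/seteqP; split.
Qed.

End independent_products.

(** * Counting variables and the Poisson functional *)

Section counting.
Context {R : realType} {d dS : measure_display} {T : measurableType d}
  {S : measurableType dS}.
Variables (P : probability T R) (E : nat -> set T) (Z : nat -> T -> S).
Hypotheses (mE : forall i, measurable (E i))
  (mZ : forall i, measurable_fun setT (Z i)).

Definition count_points (B : set S) (w : T) (n : nat) : nat :=
  \sum_(0 <= i < n) (w \in E i `&` Z i @^-1` B).

Lemma measurable_hit i (B : set S) : measurable B ->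
  measurable (E i `&` Z i @^-1` B).
Proof.
move=> mB; apply: measurableI => //.
by rewrite -[X in measurable X]setTI; exact: mZ.
Qed.

Lemma measurable_npoints B : measurable B ->
  measurable_fun setT (npoints (R := R) E Z B).
Proof.
move=> mB; apply: ge0_emeasurable_sum => [k w _ _|k _]; first by rewrite lee_fin.
by apply/measurable_EFinP; apply: measurable_indic; exact: measurable_hit.
Qed.

Lemma count_points_cvg B w :
  ((count_points B w n)%:R%:E @[n --> \oo] --> npoints (R := R) E Z B w)%E.
Proof.
have -> : (fun n => (count_points B w n)%:R%:E) =
    (fun n => \sum_(0 <= i < n) ((\1_(E i `&` Z i @^-1` B) w)%:E : \bar R))%E.
  apply/funext => n; rewrite sumEFin /count_points natr_sum.
  by congr EFin; apply: eq_bigr => i _; rewrite indicE.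
by apply: is_cvg_nneseries => i _ _; rewrite lee_fin.
Qed.

Lemma count_points_le B w m n : (m <= n)%N ->
  (count_points B w m <= count_points B w n)%N.
Proof.
by move=> mn; rewrite /count_points [leqRHS](big_cat_nat (n := m))//= leq_addr.
Qed.

Lemma npoints_ge_count B w n :
  ((count_points B w n)%:R%:E <= npoints (R := R) E Z B w)%E.
Proof.
have h := @count_points_cvg B w.
rewrite -(cvg_lim (@ereal_hausdorff R) h); apply: lime_ge.
  by apply/cvg_ex; eexists; exact: h.
by exists n => // k /= nk; rewrite lee_fin ler_nat count_points_le.
Qed.

Lemma npoints_cases B w : (exists k : nat, npoints (R := R) E Z B w = k%:R%:E) \/
  (npoints (R := R) E Z B w = +oo%E).
Proof.
have h := @count_points_cvg B w.
have [[M bM]|unb] := pselect (exists M : nat, forall n, (count_points B w n <= M)%N).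
  left; have [k kP kmax] := @ex_maxnP (fun k => `[< exists n, count_points B w n = k >]) M
    (ex_intro _ (count_points B w 0) (asboolT (ex_intro _ 0%N erefl)))
    (fun k => ltac:(by move=> /asboolP[n <-])).
  exists k; move: kP => /asboolP[n0 n0k].
  apply/(cvg_unique (@ereal_hausdorff R) h).
  apply: (@cvg_near_cst _ _ (k%:R%:E : \bar R)); exists n0 => // n /= nn.
  congr (_%:R%:E); apply/eqP; rewrite eqn_leq; apply/andP; split.
    by apply: kmax; apply/asboolP; exists n.
  by rewrite -n0k count_points_le.
right; apply/eq_infty => r.
apply: contrapT => /negP; rewrite -ltNge => rN; apply: unb.
exists (Num.bound `|r|) => n; rewrite leqNgt; apply/negP => cn.
have := npoints_ge_count B w n; rewrite leNgt => /negP; apply.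
apply: lt_trans rN _; rewrite lte_fin (le_lt_trans (ler_norm r))//.
by rewrite (lt_trans (archi_boundP (normr_ge0 r)))// ltr_nat.
Qed.

End counting.

Section poisson_pmf_facts.
Context {R : realType}.

Lemma poisson_prob_set1 (a : R) k : 0 <= a ->
  poisson_prob a 0 [set k] = (expR (- a) * (a ^+ k / k`!%:R))%:E.
Proof.
rewrite /poisson_prob le_eqVlt => /predU1P[<-|a0].
  rewrite ltxx oppr0 expR0 mul1r diracE expr0n.
  case: k => [|k]; first by rewrite mem_set//= fact0 divr1.
  by rewrite memNset//= mul0r.
rewrite a0 esum_set1 ?lee_fin ?poisson_pmf_ge0// /poisson_pmf a0.
by congr EFin; rewrite mulrC.
Qed.

Lemma exp_eseries (a c : R) :
  (\sum_(0 <= k <oo) (c * (a ^+ k / k`!%:R))%:E = (c * expR a)%:E)%E.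
Proof.
apply/cvg_lim => //.
rewrite (_ : (fun n => _) = EFin \o (fun n => c * series (exp_coeff a) n)).
  apply: cvg_EFin; first exact: nearW.
  by apply: cvgM; [exact: cvg_cst|exact: is_cvg_series_exp_coeff].
by apply/funext => n /=; rewrite sumEFin /series/= mulr_sumr.
Qed.

End poisson_pmf_facts.

Lemma cvg_big_prod {R : realType} (I : Type) (r : seq I) (f : I -> nat -> R)
    (l : I -> R) : (forall j, f j n @[n --> \oo] --> l j) ->
  \prod_(j <- r) f j n @[n --> \oo] --> \prod_(j <- r) l j.
Proof.
move=> fl; elim: r => [|j r IH].
  under eq_fun do rewrite big_nil; rewrite big_nil; exact: cvg_cst.
by under eq_fun do rewrite big_cons; rewrite big_cons; apply: cvgM.
Qed.

Lemma count_points_stationary {R : realType} {d dS : measure_display}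
    {T : measurableType d} {S : measurableType dS} (E : nat -> set T)
    (Z : nat -> T -> S) B w (k : nat) :
  npoints (R := R) E Z B w = (k%:R)%:E ->
  \forall n \near \oo, count_points E Z B w n = k.
Proof.
move=> Nk; have := @count_points_cvg R _ _ _ _ E Z B w; rewrite Nk.
move=> /fine_cvg /cvgrPdist_lt /(_ 1 ltr01); apply: filterS => n /=.
rewrite ltr_norml => /andP[h1 h2]; apply/eqP; rewrite eqn_leq.
apply/andP; split; rewrite leqNgt; apply/negP; rewrite -(ler_nat R) -natr1; lra.
Qed.

Section poisson_functional.
Context {R : realType} {d dS : measure_display} {T : measurableType d}
  {S : measurableType dS}.
Variables (P : probability T R) (E : nat -> set T) (Z : nat -> T -> S)
  (m : {measure set S -> \bar R}).
Hypotheses (mE : forall i, measurable (E i))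
  (mZ : forall i, measurable_fun setT (Z i))
  (PP : poisson_process m P E Z).

Local Notation N := (npoints (R := R) E Z).

Let level B k := [set w | N B w = (k%:R)%:E].

Let measurable_level B k : measurable B -> measurable (level B k).
Proof.
move=> mB; rewrite -[X in measurable X]setTI.
exact: (measurable_npoints mE mZ mB measurableT (emeasurable_set1 (k%:R)%:E)).
Qed.

Let level_prob B k : measurable B -> (m B < +oo)%E ->
  P (level B k) = (expR (- fine (m B)) * (fine (m B) ^+ k / k`!%:R))%:E.
Proof.
by move=> mB mBoo; rewrite PP.1// poisson_prob_set1// fine_ge0.
Qed.

Let trivIset_level B : trivIset setT (level B).
Proof.
apply/trivIsetP => i j _ _ /negP ij; apply/seteqP; split => // w [].
rewrite /level/= => -> [] /eqP; rewrite eqr_nat => /eqP h; apply: ij.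
by rewrite h.
Qed.

Let fin_level B : measurable B -> (m B < +oo)%E ->
  P (\bigcup_k level B k) = 1%E.
Proof.
move=> mB mBoo.
rewrite measure_semi_bigcup//; last 2 first.
- by move=> k; exact: measurable_level.
- by apply: bigcup_measurable => k _; exact: measurable_level.
transitivity (\sum_(0 <= k <oo) (expR (- fine (m B)) * (fine (m B) ^+ k / k`!%:R))%:E)%E.
  by apply: eq_eseriesr => k _; exact: level_prob.
by rewrite exp_eseries -expRD addNr expR0.
Qed.

Lemma ae_npoints_finite B : measurable B -> (m B < +oo)%E ->
  {ae P, forall w, exists k : nat, N B w = k%:R%:E}.
Proof.
move=> mB mBoo; exists (~` \bigcup_k level B k); split.
- by apply: measurableC; apply: bigcup_measurable => k _; exact: measurable_level.
- rewrite probability_setC; last first.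
    by apply: bigcup_measurable => k _; exact: measurable_level.
  by rewrite fin_level// subee.
- by move=> w /= h [k _ wk]; apply: h; exists k.
Qed.

Lemma measurable_powR_npoints b B : measurable B ->
  measurable_fun setT (fun w => b `^ fine (N B w)).
Proof.
move=> mB; apply: (measurableT_comp (f := fun x : \bar R => b `^ fine x)).
  by apply: (measurableT_comp (measurable_powRr b)); exact: fine_measurable.
exact: measurable_npoints.
Qed.

Lemma poisson_gf b B : 0 <= b <= 1 -> measurable B -> (m B < +oo)%E ->
  (\int[P]_w ((1 - b) `^ fine (N B w))%:E = (expR (- (b * fine (m B))))%:E)%E.
Proof.
move=> /andP[b0 b1] mB mBoo.
have mU : measurable (\bigcup_k level B k).
  by apply: bigcup_measurable => k _; exact: measurable_level.
have mf : measurable_fun setT (fun w => ((1 - b) `^ fine (N B w))%:E).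
  by apply/measurable_EFinP; exact: measurable_powR_npoints.
(* Infinite counts, at which [fine] returns 0, form a null set. *)
have PC : P (~` \bigcup_k level B k) = 0%E.
  by rewrite probability_setC// fin_level// subee.
rewrite -(setUv (\bigcup_k level B k)) ge0_integral_setU//; last 4 first.
- exact: measurableC.
- by rewrite setUv.
- by move=> w _; rewrite lee_fin powR_ge0.
- by apply/disj_setPS => w [].
rewrite [X in (_ + X)%E](_ : _ = 0)%E ?adde0; last first.
  apply: null_set_integral => //; first exact: measurableC.
  exact: measurable_funTS.
rewrite ge0_integral_bigcup//; last 3 first.
- by move=> k; exact: measurable_level.
- exact: measurable_funTS.
- by move=> w _; rewrite lee_fin powR_ge0.
transitivity (\sum_(0 <= k <oo) (expR (- fine (m B)) *
   (((1 - b) * fine (m B)) ^+ k / k`!%:R))%:E)%E.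
  apply: eq_eseriesr => k _.
  transitivity (\int[P]_(w in level B k) ((1 - b) ^+ k)%:E)%E.
    apply: eq_integral => w; rewrite inE /level/= => -> /=.
    by rewrite powR_mulrn// subr_ge0.
  transitivity (((1 - b) ^+ k)%:E * P (level B k))%E.
    exact: (integral_cst P (measurable_level k mB) ((1 - b) ^+ k)%:E).
  by rewrite level_prob// -EFinM exprMn; congr EFin; ring.
by rewrite exp_eseries -expRD; congr (expR _)%:E; ring.
Qed.

(** Given the points, the probability that point [i] survives when a present point at z is deleted
    with probability g z. *)
Definition thin_factor (g : S -> R) i w := if w \in E i then 1 - g (Z i w) else 1.

Lemma hit_prod B (b : R) w n :
  \prod_(i < n) (if w \in E i `&` Z i @^-1` B then 1 - b else 1) =
  (1 - b) ^+ count_points E Z B w n.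
Proof.
rewrite /count_points -(big_mkord xpredT (fun i =>
   if w \in E i `&` Z i @^-1` B then 1 - b else 1)).
elim: n => [|n IH]; first by rewrite !big_geq.
rewrite !big_nat_recr//= exprD IH; congr (_ * _).
by case: (w \in _).
Qed.

Lemma poisson_functional_boxes J (b : 'I_J -> R) (B : 'I_J -> set S) :
  (forall j, 0 <= b j <= 1) -> (forall j, measurable (B j)) ->
  (forall j, (m (B j) < +oo)%E) -> trivIset setT B ->
  (\int[P]_w (\prod_(i < n) \prod_(j < J)
      (if w \in E i `&` Z i @^-1` B j then 1 - b j else 1))%:E @[n --> \oo] -->
   (expR (- \sum_(j < J) b j * fine (m (B j))))%:E)%E.
Proof.
move=> b01 mB mBoo tB.
(* The indicator forces values in [0, 1] on the whole extended line, as [independent_prod] requires;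
   on counts it equals 1. *)
pose y (j : 'I_J) (x : \bar R) :=
  (1 - b j) `^ fine x * \1_[set x : \bar R | (0 <= x)%E] x.
have my j : measurable_fun setT (y j).
  apply: measurable_funM.
    by apply: (measurableT_comp (measurable_powRr _)); exact: fine_measurable.
  apply: measurable_indic; rewrite -[X in measurable X]setTI.
  exact: emeasurable_fun_c_infty.
have y01 j x : 0 <= y j x <= 1.
  rewrite /y indicE; have /andP[? ?] := b01 j.
  case: (boolP (x \in _)) => [|_]; last by rewrite mulr0 lexx ler01.
  have p1 : 1 `^ fine x = 1 :> R by rewrite powR1.
  rewrite inE/= mulr1 powR_ge0/= => x0; rewrite -{2}p1.
  by apply: ge0_ler_powR; rewrite ?fine_ge0// ?nnegrE//; lra.
have indepN : mutually_independent P
    (fun j => preimage_set_system setT (N (B j)) measurable).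
  exact: PP.2.
have mN j : measurable_fun setT (N (B j)) by exact: measurable_npoints.
have yN j w : y j (N (B j) w) = (1 - b j) `^ fine (N (B j) w).
  rewrite /y indicE mem_set ?mulr1//=.
  by apply: nneseries_ge0 => i _ _; rewrite lee_fin.
have -> : (expR (- \sum_(j < J) b j * fine (m (B j))))%:E =
    (\int[P]_w (\prod_(j <- index_enum 'I_J) y j (N (B j) w))%:E)%E.
  rewrite (independent_prod mN my y01 indepN) ?index_enum_uniq//.
  transitivity (\prod_(j < J) (expR (- (b j * fine (m (B j)))))%:E)%E.
    by rewrite prodEFin -expR_sum sumrN.
  apply: eq_bigr => j _; rewrite -poisson_gf//.
  by apply: eq_integral => w _; rewrite yN.
have fac01 j w i : 0 <= (if w \in E i `&` Z i @^-1` B j then 1 - b j else 1) <= 1.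
  by have /andP[? ?] := b01 j; case: ifP => _; rewrite ?subr_ge0 ?gerBl ?ler01 ?lexx//; apply/andP; split.
have [] := @dominated_convergence _ _ _ P _ measurableT
  (fun n w => (\prod_(i < n) \prod_(j < J)
      (if w \in E i `&` Z i @^-1` B j then 1 - b j else 1))%:E)
  (fun w => (\prod_(j <- index_enum 'I_J) y j (N (B j) w))%:E) (cst 1%E) => //.
- move=> n; apply/measurable_EFinP; apply: measurable_prod => i _.
  apply: measurable_prod => j _.
  exact: (measurable_ifE (E := fun=> E i `&` Z i @^-1` B j)
    (fun=> measurable_hit mE mZ i (mB j)) 0%N (measurable_cst _)).
- apply/measurable_EFinP; apply: measurable_prod => j _.
  exact: (measurableT_comp (my j) (mN j)).
- have aeN : {ae P, forall w, forall j, exists k : nat, N (B j) w = k%:R%:E}.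
    by apply: filter_forall => j; exact: ae_npoints_finite.
  apply: filterS aeN => w Nw _.
  apply: cvg_EFin; first exact: nearW.
  under eq_fun do rewrite exchange_big/=.
  apply: cvg_big_prod => j; under eq_fun do rewrite hit_prod.
  have [k Nk] := Nw j; rewrite yN Nk /= powR_mulrn; last first.
    by have := b01 j; lra.
  by apply: cvg_near_cst; apply: filterS (count_points_stationary Nk) => n ->.
- exact: finite_measure_integrable_cst.
- apply: aeW => w n _; rewrite lee_fin ger0_norm.
    apply: prodr_ile1 => i _; rewrite prodr_ge0/=; last by move=> j _; case/andP: (fac01 j w i).
    by apply: prodr_ile1 => j _; exact: fac01.
  apply: prodr_ge0 => i _; apply: prodr_ge0 => j _.
  by case/andP: (fac01 j w i).
Qed.


End poisson_functional.

Section poisson_functional_general.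
Context {R : realType} {d dS : measure_display} {T : measurableType d}
  {S : measurableType dS}.
Variables (P : probability T R) (E : nat -> set T) (Z : nat -> T -> S)
  (m : {measure set S -> \bar R}).
Hypotheses (mE : forall i, measurable (E i))
  (mZ : forall i, measurable_fun setT (Z i))
  (PP : poisson_process m P E Z).

Local Notation N := (npoints (R := R) E Z).

Variable K_ : nat -> set S.
Hypotheses (mK : forall k, measurable (K_ k)) (mKoo : forall k, (m (K_ k) < +oo)%E)
  (ndK : forall k l, (k <= l)%N -> K_ k `<=` K_ l)
  (covK : forall x, exists k, K_ k x).

Lemma measurable_thin_factor (g : S -> R) i : measurable_fun setT g ->
  measurable_fun setT (thin_factor E Z g i).
Proof.
move=> mg; apply: measurable_ifE => //.
by apply: measurable_funB => //; exact: (measurableT_comp mg (mZ i)).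
Qed.

Lemma thin_factor01 (g : S -> R) i w : (forall x, 0 <= g x <= 1) -> 0 <= thin_factor E Z g i w <= 1.
Proof.
move=> g01; rewrite /thin_factor; case: ifP => _; last by rewrite ler01 lexx.
by have /andP[? ?] := g01 (Z i w); rewrite subr_ge0 gerBl; apply/andP.
Qed.

Lemma measurable_thin_prod (g : S -> R) n : measurable_fun setT g ->
  measurable_fun setT (fun w => \prod_(i < n) thin_factor E Z g i w).
Proof. by move=> mg; apply: measurable_prod => i _; exact: measurable_thin_factor. Qed.

Import HBNNSimple.

(** The level sets of [s] inside [K] are finitely many disjoint sets of finite measure, so the box
    case applies. *)
Lemma poisson_functional_simple (s : {nnsfun S >-> R}) K :
  (forall x, s x <= 1) -> measurable K -> (m K < +oo)%E ->
  (\int[P]_w (\prod_(i < n) thin_factor E Z (fun x => s x * \1_K x) i w)%:E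
      @[n --> \oo] -->
   expeR (- \int[m]_x (s x * \1_K x)%:E))%E.
Proof.
move=> s1 mK' mKoo'.
have /finite_seqP[r0 r0E] : finite_set (range s) by exact: fimfunP.
pose r := undup r0.
have ur : uniq r by exact: undup_uniq.
have rP x : s x \in r.
  have : range s (s x) by exists x.
  by rewrite r0E /= /r mem_undup.
have rV v : v \in r -> exists x, s x = v.
  rewrite /r mem_undup => vr.
  have : [set` r0] v by [].
  by rewrite -r0E => -[x _ <-]; exists x.
pose J := size r.
pose b (j : 'I_J) := nth 0 r j.
pose B (j : 'I_J) := K `&` s @^-1` [set b j].
have b01 j : 0 <= b j <= 1.
  rewrite /b; have [x <-] := rV _ (mem_nth 0 (ltn_ord j)).
  by rewrite s1 fun_ge0.
have mB j : measurable (B j) by apply: measurableI.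
have mBoo j : (m (B j) < +oo)%E.
  by apply: le_lt_trans mKoo'; apply: le_measure; rewrite ?inE// => x [].
have tB : trivIset setT B.
  apply/trivIsetP => i j _ _ /negP ij; apply/seteqP; split => // x [[_ h1] [_ h2]].
  apply: ij; apply/eqP/val_inj/eqP => /=.
  rewrite -(nth_uniq 0 (ltn_ord i) (ltn_ord j) ur).
  by apply/eqP; rewrite -[LHS]h1 -[RHS]h2.
have jP x : exists j0 : 'I_J, b j0 = s x /\ forall j, b j = s x -> j = j0.
  have jx : (index (s x) r < J)%N by rewrite index_mem.
  exists (Ordinal jx); rewrite /b /= nth_index//; split => // j jE.
  by apply: val_inj => /=; rewrite -jE /b index_uniq.
have -> : (fun n => \int[P]_w (\prod_(i < n)
      thin_factor E Z (fun x => s x * \1_K x) i w)%:E)%E =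
  (fun n => \int[P]_w (\prod_(i < n) \prod_(j < J)
      (if w \in E i `&` Z i @^-1` B j then 1 - b j else 1))%:E)%E.
  apply/funext => n; apply: eq_integral => w _; congr EFin.
  apply: eq_bigr => i _; rewrite /thin_factor.
  have [wE|wE] := boolP (w \in E i); last first.
    by rewrite big1// => j _; rewrite in_setI (negbTE wE).
  have [j0 [bj0 j0U]] := jP (Z i w).
  rewrite (bigD1 j0)//= big1 ?mulr1; last first.
    move=> j jj0; rewrite in_setI wE /=; case: ifP => //.
    rewrite inE /B /= => -[_ /esym /j0U h]; by rewrite h eqxx in jj0.
  rewrite in_setI wE /= indicE -bj0.
  have -> : (w \in Z i @^-1` B j0) = (Z i w \in K).
    by apply/idP/idP; rewrite !inE /B /=; [case|split].
  by case: (_ \in K); rewrite ?mulr1// mulr0 subr0.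
have -> : (expeR (- \int[m]_x (s x * \1_K x)%:E) =
    (expR (- \sum_(j < J) b j * fine (m (B j))))%:E)%E.
  have -> : (\int[m]_x (s x * \1_K x)%:E = (\sum_(j < J) b j * fine (m (B j)))%:E)%E.
    transitivity (\int[m]_x (\sum_(j < J) (b j)%:E * (\1_(B j) x)%:E))%E.
      apply: eq_integral => x _; have [j0 [bj0 j0U]] := jP x.
      rewrite (bigD1 j0)//= big1 ?adde0; last first.
        move=> j jj0; rewrite indicE; case: (boolP (x \in B j)); rewrite ?mule0//.
        by rewrite inE => -[_ /esym /j0U h]; rewrite h eqxx in jj0.
      rewrite -EFinM -bj0 !indicE; congr (_ * (nat_of_bool _)%:R)%:E.
      by apply/idP/idP; rewrite !inE /B /=; [split|case].
    rewrite ge0_integral_sum//.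
    - rewrite -sumEFin; apply: eq_bigr => j _.
      rewrite ge0_integralZl//.
      + rewrite integral_indic// setIT EFinM fineK// ge0_fin_numE//.
      + by apply/measurable_EFinP; exact: measurable_indic.
      + by rewrite lee_fin; case/andP: (b01 j).
    - by move=> j; apply/measurable_EFinP; apply: measurable_funM.
    - by move=> j x _; rewrite -EFinM lee_fin mulr_ge0//; case/andP: (b01 j).
  by [].
exact: poisson_functional_boxes.
Qed.

(** Let G_f(n) be the expectation and L_f the claimed limit. For simple h_k increasing to g, L_g <=
    L_(h_k) <= G_(h_k)(n); letting k grow gives L_g <= G_g(n). Conversely G_g <= G_(h_k) bounds the
    limit of G_g by L_(h_k), which tends to L_g. *)
Lemma poisson_functional (g : S -> R) : measurable_fun setT g -> (forall x, 0 <= g x <= 1) ->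
  (\int[P]_w (\prod_(i < n) thin_factor E Z g i w)%:E @[n --> \oo] -->
   expeR (- \int[m]_x (g x)%:E))%E.
Proof.
move=> mg g01.
have g0 x : 0 <= g x by case/andP: (g01 x).
have mg' : measurable_fun setT (EFin \o g) by exact/measurable_EFinP.
pose s := nnsfun_approx measurableT mg'.
have s_nd k l x : (k <= l)%N -> s k x <= s l x.
  by move=> kl; exact/lefP/nd_nnsfun_approx.
have s_cvg x : (s k x)%:E @[k --> \oo] --> (g x)%:E.
  by apply: (cvg_nnsfun_approx measurableT mg') => // y _; rewrite lee_fin.
have s_le k x : s k x <= g x.
  rewrite -lee_fin -(cvg_lim (@ereal_hausdorff R) (s_cvg x)); apply: lime_ge.
    by apply/cvg_ex; eexists; exact: s_cvg.
  by exists k => // l /= kl; rewrite lee_fin s_nd.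
pose h k x : R := s k x * \1_(K_ k) x.
have mh k : measurable_fun setT (h k).
  by apply: measurable_funM => //; exact: measurable_indic.
have h0 k x : 0 <= h k x by rewrite mulr_ge0.
have h_nd k l x : (k <= l)%N -> h k x <= h l x.
  move=> kl; rewrite /h; apply: ler_pM => //; first exact: s_nd.
  rewrite !indicE ler_nat; case: (boolP (x \in K_ k)) => //=.
  by rewrite inE => /(ndK kl) xl; rewrite mem_set.
have h_le k x : h k x <= g x.
  apply: le_trans (s_le k x); rewrite /h.
  have i1 : (\1_(K_ k) x : R) <= 1 by rewrite indicE lern1; case: (_ \in _).
  by rewrite ler_piMr.
have h01 k x : 0 <= h k x <= 1.
  by rewrite h0 (le_trans (h_le k x))//; case/andP: (g01 x).
have h_cvg x : h k x @[k --> \oo] --> g x.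
  have [k0 xk0] := covK x.
  have /fine_cvg hs : (s k x)%:E @[k --> \oo] --> (g x)%:E by exact: s_cvg.
  apply: cvg_trans hs; apply: near_eq_cvg; exists k0 => // k /= kk0.
  by rewrite /h indicE mem_set ?mulr1//; exact: ndK xk0.
pose G (f : S -> R) n := (\int[P]_w (\prod_(i < n) thin_factor E Z f i w)%:E)%E.
pose L (f : S -> R) := expeR (- \int[m]_x (f x)%:E)%E.
have G_ni (f : S -> R) : measurable_fun setT f -> (forall x, 0 <= f x <= 1) ->
    forall k l, (k <= l)%N -> (G f l <= G f k)%E.
  move=> mf f01 k l kl; apply: ge0_le_integral => //.
  - move=> w _; rewrite lee_fin; apply: prodr_ge0 => i _.
    by case/andP: (thin_factor01 i w f01).
  - by apply/measurable_EFinP; exact: measurable_thin_prod.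
  - by apply/measurable_EFinP; exact: measurable_thin_prod.
  - move=> w _; rewrite lee_fin -!(big_mkord xpredT (fun i => thin_factor E Z f i w)).
    rewrite (big_cat_nat (n := k))//= ler_piMr//.
      by apply: prodr_ge0 => i _; case/andP: (thin_factor01 i w f01).
    by apply: prodr_ile1 => i _; exact: thin_factor01.
have GL k : G (h k) n @[n --> \oo] --> L (h k).
  apply: poisson_functional_simple => // x.
  by rewrite (le_trans (s_le k x))//; case/andP: (g01 x).
have Gge k n : (L (h k) <= G (h k) n)%E.
  rewrite -(cvg_lim (@ereal_hausdorff R) (GL k)); apply: lime_le.
    by apply/cvg_ex; eexists; exact: GL.
  by exists n => // l /= nl; exact: G_ni.
have L_ge k : (L g <= L (h k))%E.
  rewrite lee_expeR leeN2; apply: ge0_le_integral => //.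
  - by move=> x _; rewrite lee_fin.
  - exact/measurable_EFinP.
  - by move=> x _; rewrite lee_fin.
have Gcvg n : G (h k) n @[k --> \oo] --> G g n.
  have [] := @dominated_convergence _ _ _ P _ measurableT
    (fun k w => (\prod_(i < n) thin_factor E Z (h k) i w)%:E)
    (fun w => (\prod_(i < n) thin_factor E Z g i w)%:E) (cst 1%E) => //.
  - by move=> k; apply/measurable_EFinP; exact: measurable_thin_prod.
  - by apply/measurable_EFinP; exact: measurable_thin_prod.
  - apply: aeW => w _; apply: cvg_EFin; first exact: nearW.
    apply: (@cvg_big_prod _ _ _ (fun (i : 'I_n) k => thin_factor E Z (h k) i w)) => i.
    rewrite /thin_factor; case: ifP => _; last exact: cvg_cst.
    by apply: cvgB; [exact: cvg_cst|exact: h_cvg].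
  - exact: finite_measure_integrable_cst.
  - apply: aeW => w k _; rewrite lee_fin ger0_norm.
      by apply: prodr_ile1 => i _; exact: thin_factor01.
    by apply: prodr_ge0 => i _; case/andP: (thin_factor01 i w (h01 k)).
have Glow n : (L g <= G g n)%E.
  rewrite -(cvg_lim (@ereal_hausdorff R) (Gcvg n)); apply: lime_ge.
    by apply/cvg_ex; eexists; exact: Gcvg.
  by apply: nearW => k; exact: le_trans (L_ge k) (Gge k n).
have Gh k n : (G g n <= G (h k) n)%E.
  apply: ge0_le_integral => //.
  - move=> w _; rewrite lee_fin; apply: prodr_ge0 => i _.
    by case/andP: (thin_factor01 i w g01).
  - by apply/measurable_EFinP; exact: measurable_thin_prod.
  - by apply/measurable_EFinP; exact: measurable_thin_prod.
  - move=> w _; rewrite lee_fin; apply: ler_prod => i _.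
    have /andP[-> _] := thin_factor01 i w g01; rewrite /thin_factor.
    by case: ifP => //= _; rewrite lerD2l lerN2.
have cG : cvgn (G g).
  by apply: ereal_nonincreasing_is_cvgn => k l kl; exact: G_ni.
have -> : expeR (- \int[m]_x (g x)%:E)%E = L g by [].
suff <- : limn (G g) = L g by exact: cG.
apply/eqP; rewrite eq_le; apply/andP; split; last first.
  by apply: lime_ge => //; apply: nearW => n; exact: Glow.
have ub k : (limn (G g) <= L (h k))%E.
  rewrite -(cvg_lim (@ereal_hausdorff R) (GL k)); apply: lee_lim => //.
    by apply/cvg_ex; eexists; exact: GL.
  by apply: nearW => n; exact: Gh.
have Ih_cvg : (\int[m]_x (h k x)%:E @[k --> \oo] --> \int[m]_x (g x)%:E)%E.
  rewrite [X in _ --> X](_ : _ = \int[m]_x limn (fun k => (h k x)%:E))%E; last first.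
    apply: eq_integral => x _; apply/esym/cvg_lim => //.
    by apply: cvg_EFin; [exact: nearW|exact: h_cvg].
  apply: cvg_monotone_convergence => //.
  - by move=> k; exact/measurable_EFinP.
  - by move=> k x _; rewrite lee_fin.
  - by move=> x _ k l kl; rewrite lee_fin h_nd.
have Ifin k : (\int[m]_x (h k x)%:E)%E \is a fin_num.
  rewrite ge0_fin_numE; last by apply: integral_ge0 => x _; rewrite lee_fin.
  apply: (@le_lt_trans _ _ (\int[m]_(x in K_ k) (1%R)%:E)%E).
    rewrite [leRHS]integral_mkcond; apply: ge0_le_integral => //.
    - by move=> x _; rewrite lee_fin.
    - exact/measurable_EFinP.
    - apply/(measurable_restrictT _ _).1 => //.
    - move=> x _; rewrite patchE /h indicE; case: ifPn => xK; rewrite lee_fin.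
        by rewrite mulr1 (le_trans (s_le k x))//; case/andP: (g01 x).
      by rewrite mulr0.
  by rewrite integral_one.
pose I k := fine (\int[m]_x (h k x)%:E)%E.
have LI k : L (h k) = (expR (- I k))%:E.
  by rewrite /L /I -[in LHS](fineK (Ifin k)).
have Ig0 : (0 <= \int[m]_x (g x)%:E)%E.
  by apply: integral_ge0 => x _; rewrite lee_fin.
have IE : (fun k => \int[m]_x (h k x)%:E)%E = EFin \o I.
  by apply/funext => k; rewrite /= /I fineK.
rewrite IE in Ih_cvg.
have Lcvg : L (h k) @[k --> \oo] --> L g.
  under eq_fun do rewrite LI.
  (* An infinite integral is allowed: [expeR] sends -oo to 0. *)
  rewrite /L; case: (\int[m]_x (g x)%:E)%E Ih_cvg Ig0 => [r||] //= Ig _.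
  - apply: cvg_EFin; first exact: nearW.
    have hr : expR (- I k) @[k --> \oo] --> expR (- r).
      apply: continuous_cvg; first exact: continuous_expR.
      by apply: cvgN; exact: (fine_cvg Ig).
    exact: hr.
  - apply: cvg_EFin; first exact: nearW.
    have hr : expR (- I k) @[k --> \oo] --> (0 : R).
      exact: (cvg_comp _ _ ((cvgeryP _).1 Ig) (@cvgr_expR R)).
    exact: hr.
rewrite -(cvg_lim (@ereal_hausdorff R) Lcvg); apply: lime_ge.
  by apply/cvg_ex; eexists; exact: Lcvg.
by apply: nearW => k; exact: ub.
Qed.

End poisson_functional_general.

(** With this thinning the product over all points is prod_j exp(- p_j N(B_j)), whose expectation is
    a joint Laplace transform of the counts at an integer point. *)
Definition exp_thin {R : realType} {S : Type} n (B : 'I_n -> set S)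
    (p : 'I_n -> nat) (x : S) : R :=
  1 - \prod_(j < n) expR (- (p j)%:R * \1_(B j) x).

Lemma exp_thin01 {R : realType} {S : Type} n (B : 'I_n -> set S)
    (p : 'I_n -> nat) (x : S) : 0 <= (exp_thin B p x : R) <= 1.
Proof.
rewrite /exp_thin subr_ge0 gerBl; apply/andP; split.
  apply: prodr_ile1 => j _; rewrite expR_ge0/= -expR0 ler_expR mulNr oppr_le0.
  by rewrite mulr_ge0.
by apply: prodr_ge0 => j _; exact: expR_ge0.
Qed.

Lemma measurable_exp_thin {R : realType} {dS : measure_display}
    {S : measurableType dS} n (B : 'I_n -> set S) (p : 'I_n -> nat) :
  (forall j, measurable (B j)) ->
  measurable_fun setT (exp_thin B p : S -> R).
Proof.
move=> mB; apply: measurable_funB => //; apply: measurable_prod => j _.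
apply: (measurableT_comp (f := expR)); first exact: measurable_expR.
by apply: measurable_funM => //; exact: measurable_indic.
Qed.

(** * Laws of counts determined by thinning functionals *)

Section counting_laws.
Context {R : realType} {d dS : measure_display} {T : measurableType d}
  {S : measurableType dS}.
Variables (P : probability T R) (E : nat -> set T) (Z : nat -> T -> S).
Hypotheses (mE : forall i, measurable (E i))
  (mZ : forall i, measurable_fun setT (Z i)).

Local Notation N := (npoints (R := R) E Z).

(** Deleting every point of [B] makes the product 0 to the power N(B), with 0^0 = 1. *)
Lemma void_probability_cvg B : measurable B ->
  (\int[P]_w (\prod_(i < n) thin_factor E Z (\1_B : S -> R) i w)%:E @[n --> \oo] -->
   P [set w | N B w = 0%E])%E.
Proof.
move=> mB.
have m0 : measurable [set w | N B w = 0%E].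
  rewrite -[X in measurable X]setTI.
  exact: (measurable_npoints mE mZ mB measurableT (emeasurable_set1 0%E)).
have thinE i w : thin_factor E Z (\1_B : S -> R) i w =
    if w \in E i `&` Z i @^-1` B then 1 - 1 else 1.
  rewrite /thin_factor in_setI indicE; case: (w \in E i) => //=.
  have -> : (w \in Z i @^-1` B) = (Z i w \in B) by apply/idP/idP; rewrite !inE.
  by case: (_ \in B); rewrite ?subr0.
have -> : P [set w | N B w = 0%E] =
    (\int[P]_w (\1_[set w | N B w = 0%E] w)%:E)%E by rewrite integral_indic// setIT.
have [] := @dominated_convergence _ _ _ P _ measurableT
  (fun n w => (\prod_(i < n) thin_factor E Z (\1_B : S -> R) i w)%:E)
  (fun w => (\1_[set w | N B w = 0%E] w)%:E) (cst 1%E) => //.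
- move=> n; apply/measurable_EFinP; apply: measurable_thin_prod => //.
- by apply/measurable_EFinP; exact: measurable_indic.
- apply: aeW => w _; apply: cvg_EFin; first exact: nearW.
  have -> : fine \o (fun n => (\prod_(i < n) thin_factor E Z (\1_B : S -> R) i w)%:E) =
      (fun n => (0 : R) ^+ count_points E Z B w n).
    apply/funext => n /=; rewrite -(subrr 1) -hit_prod.
    by apply: eq_bigr => i _; rewrite thinE.
  apply: cvg_near_cst; rewrite /= indicE.
  have [[k Nk]|Noo] := @npoints_cases R _ _ _ _ E Z B w.
    apply: filterS (count_points_stationary Nk) => n ->.
    rewrite expr0n; congr (_%:R); case: k Nk => [|k] Nk /=.
      by rewrite mem_set.
    rewrite memNset//= Nk => -[] /eqP; by rewrite pnatr_eq0.
  rewrite memNset/=; last by rewrite Noo.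
  have := @count_points_cvg R _ _ _ _ E Z B w; rewrite Noo => /cvgeyPge /(_ 1).
  apply: filterS => n; rewrite lee_fin ler1n => n0.
  by rewrite expr0n eqn0Ngt n0.
- exact: finite_measure_integrable_cst.
- apply: aeW => w n _; rewrite lee_fin ger0_norm.
    apply: prodr_ile1 => i _; rewrite thinE; case: ifP => _; lra.
  by apply: prodr_ge0 => i _; rewrite thinE; case: ifP => _; lra.
Qed.

(** The map exp(-x) from [0, +oo] into [0, 1], with +oo sent to 0, inverted by [undamp]: counts can
    be infinite, whereas moments determine the law of bounded variables. *)
Definition damp (x : \bar R) : R := if (x < +oo)%E then expR (- fine x) else 0.

Lemma damp_count_cvg B w :
  expR (- (count_points E Z B w n)%:R) @[n --> \oo] --> damp (N B w).
Proof.
have [[k Nk]|Noo] := @npoints_cases R _ _ _ _ E Z B w.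
  rewrite /damp Nk ltry /=; apply: cvg_near_cst.
  by apply: filterS (count_points_stationary Nk) => n ->.
rewrite /damp Noo ltxx.
have := @count_points_cvg R _ _ _ _ E Z B w; rewrite Noo => /cvgeryP h.
exact: (cvg_comp _ _ h (@cvgr_expR R)).
Qed.

Lemma measurable_damp : measurable_fun setT damp.
Proof.
apply: measurable_fun_ifT => //.
- exact: measurable_fun_lte.
- apply: (measurableT_comp (f := expR)); first exact: measurable_expR.
  apply: measurableT_comp => //; exact: fine_measurable.
Qed.

Definition undamp (y : R) : \bar R := if 0 < y then (- ln y)%:E else +oo%E.

Lemma measurable_undamp : measurable_fun setT undamp.
Proof.
apply: measurable_fun_ifT => //.
- exact: measurable_fun_ltr.
- apply/measurable_EFinP; apply: measurableT_comp => //; exact: measurable_ln.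
Qed.

Lemma npoints_ge0 B w : (0 <= N B w)%E.
Proof. by apply: nneseries_ge0 => i _ _; rewrite lee_fin. Qed.

Lemma dampK B w : undamp (damp (N B w)) = N B w.
Proof.
have := npoints_ge0 B w; rewrite /damp /undamp.
case: (N B w) => [r r0||//] /=; last by rewrite ltxx.
by rewrite ltry expR_gt0 expRK opprK.
Qed.

Lemma damp01 B w : 0 <= damp (N B w) <= 1.
Proof.
rewrite /damp; case: ifP => _; last by rewrite lexx ler01.
by rewrite expR_ge0/= -expR0 ler_expR oppr_le0 fine_ge0// npoints_ge0.
Qed.

Lemma damp_moments_cvg n (B : 'I_n -> set S) (p : 'I_n -> nat) :
  (forall j, measurable (B j)) ->
  (\int[P]_w (\prod_(i < l)
      thin_factor E Z (exp_thin B p) i w)%:E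
     @[l --> \oo] -->
   \int[P]_w (\prod_(j < n) damp (N (B j) w) ^+ p j)%:E)%E.
Proof.
move=> mB.
pose h : S -> R := exp_thin B p.
have h01 : forall x, 0 <= h x <= 1 := @exp_thin01 R S n B p.
have mh : measurable_fun setT h := measurable_exp_thin p mB.
have [] := @dominated_convergence _ _ _ P _ measurableT
  (fun l w => (\prod_(i < l) thin_factor E Z h i w)%:E)
  (fun w => (\prod_(j < n) damp (N (B j) w) ^+ p j)%:E) (cst 1%E) => //.
- by move=> l; apply/measurable_EFinP; apply: measurable_thin_prod.
- apply/measurable_EFinP; apply: measurable_prod => j _; apply: measurable_funX.
  apply: (measurableT_comp measurable_damp); exact: measurable_npoints.
- apply: aeW => w _; apply: cvg_EFin; first exact: nearW.
  have -> : fine \o (fun l => (\prod_(i < l) thin_factor E Z h i w)%:E) =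
      (fun l => \prod_(j < n) (expR (- (count_points E Z (B j) w l)%:R)) ^+ p j).
    apply/funext => l /=.
    transitivity (\prod_(i < l) \prod_(j < n)
      (if w \in E i `&` Z i @^-1` (B j) then 1 - (1 - expR (- (p j)%:R)) else 1 : R)).
      apply: eq_bigr => i _; rewrite /thin_factor /h /exp_thin.
      have [wE|wE] := boolP (w \in E i); last first.
        by rewrite big1// => j _; rewrite in_setI (negbTE wE).
      rewrite opprB addrC subrK; apply: eq_bigr => j _.
      rewrite in_setI wE /= indicE.
      have -> : (w \in Z i @^-1` B j) = (Z i w \in B j) by apply/idP/idP; rewrite !inE.
      case: (_ \in B j); first by rewrite mulr1 opprB addrC subrK.
      by rewrite mulr0 expR0.
    rewrite exchange_big/=; apply: eq_bigr => j _; rewrite hit_prod.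
    by rewrite opprB addrC subrK -!expRM_natr; congr expR; ring.
  apply: (@cvg_big_prod _ _ _ (fun (j : 'I_n) l =>
    (expR (- (count_points E Z (B j) w l)%:R)) ^+ p j)) => j.
  have c := @damp_count_cvg (B j) w.
  elim: (p j) => [|k IH]; first exact: cvg_cst.
  rewrite exprS (_ : (fun l => _) = (fun l => expR (- (count_points E Z (B j) w l)%:R) *
    expR (- (count_points E Z (B j) w l)%:R) ^+ k)); last first.
    by apply/funext => l; rewrite exprS.
  exact: cvgM.
- exact: finite_measure_integrable_cst.
- apply: aeW => w l _; rewrite lee_fin ger0_norm.
    by apply: prodr_ile1 => i _; exact: thin_factor01.
  by apply: prodr_ge0 => i _; case/andP: (thin_factor01 E Z i w h01).
Qed.

End counting_laws.

(** Mixed moments of the damped counts are limits of the functionals at [exp_thin], hence equal;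
    undamping is measurable and recovers the counts. *)
Lemma eq_law_points_of_functionals {R : realType} {d dS : measure_display}
    {T : measurableType d} {S : measurableType dS} (P : probability T R)
    (E : nat -> set T) (Z Z' : nat -> T -> S) (L : (S -> R) -> \bar R) :
  (forall i, measurable (E i)) ->
  (forall i, measurable_fun setT (Z i)) -> (forall i, measurable_fun setT (Z' i)) ->
  (forall h : S -> R, measurable_fun setT h -> (forall x, 0 <= h x <= 1) ->
    (\int[P]_w (\prod_(i < n) thin_factor E Z h i w)%:E @[n --> \oo] --> L h)%E) ->
  (forall h : S -> R, measurable_fun setT h -> (forall x, 0 <= h x <= 1) ->
    (\int[P]_w (\prod_(i < n) thin_factor E Z' h i w)%:E @[n --> \oo] --> L h)%E) ->
  eq_law_points P E Z Z'.
Proof.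
move=> mE mZ mZ' LZ LZ' n B mB A mA.
pose X (Y : nat -> T -> S) (j : 'I_n) w : R := damp (npoints E Y (B j) w).
have mX Y : (forall i, measurable_fun setT (Y i)) ->
    forall j, measurable_fun setT (X Y j).
  move=> mY j; apply: (measurableT_comp measurable_damp).
  exact: measurable_npoints.
have mU : measurable_fun setT (fun x : n.-tuple R => [tuple undamp (tnth x j) | j < n]).
  apply: (@measurable_tuple_of _ _ _ _ n (fun j (x : n.-tuple R) => undamp (tnth x j))) => j.
  exact: (measurableT_comp measurable_undamp (measurable_tnth j)).
have preE Y : (fun w => [tuple npoints (R := R) E Y (B j) w | j < n]) @^-1` A =
    (fun w => [tuple X Y j w | j < n]) @^-1`
      ((fun x : n.-tuple R => [tuple undamp (tnth x j) | j < n]) @^-1` A).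
  apply/seteqP; split => w /=; rewrite (_ : [tuple undamp _ | _ < n] =
    [tuple npoints (R := R) E Y (B j) w | j < n])//;
    by apply: eq_from_tnth => j; rewrite !tnth_mktuple dampK.
rewrite !preE; apply: unit_tuple_moment_unique.
- exact: mX.
- exact: mX.
- by have := @probability_setT _ _ _ P; rewrite /= => ->; rewrite ltry.
- by have := @probability_setT _ _ _ P; rewrite /= => ->; rewrite ltry.
- by move=> j w; exact: damp01.
- by move=> j w; exact: damp01.
- move=> p.
  pose h : S -> R := exp_thin B p.
  have h01 : forall x, 0 <= h x <= 1 := @exp_thin01 R S n B p.
  have mh : measurable_fun setT h := measurable_exp_thin p mB.
  have c := @damp_moments_cvg _ _ _ _ _ P E Z mE mZ n B p mB.
  have c' := @damp_moments_cvg _ _ _ _ _ P E Z' mE mZ' n B p mB.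
  have l := LZ h mh h01; have l' := LZ' h mh h01.
  rewrite (cvg_unique (@ereal_hausdorff R) c l).
  by rewrite (cvg_unique (@ereal_hausdorff R) c' l').
- rewrite -[X in measurable X]setTI; exact: mU.
Qed.

Lemma ereal_expN_inj {R : realType} (x y : \bar R) :
  expeR (- x) = expeR (- y) -> x = y.
Proof. by move=> /expeR_inj /oppe_inj. Qed.

(** * Intensity measures of the particle system *)

Section intensities.
Context {R : realType} {d : nat}.
Implicit Types (m : {measure set R -> \bar R}) (xi : process R d).

Definition shifted_path xi n (t : n.-tuple 'rV[R]_d) (u : R) (w : proc_space xi) :
  n.-tuple R := [tuple u + xi (tnth t k) w | k < n].

(* The integral of [F] against the intensity measure of the points
   (V_i(t_1), ..., V_i(t_n)) of the system generated by (m, xi). *)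
Definition intensity m xi n (t : n.-tuple 'rV[R]_d) (F : n.-tuple R -> \bar R) :
  \bar R := (\int[m]_u \int[proc_prob xi]_w F (shifted_path t u w))%E.

Lemma measurable_shift_tuple n :
  measurable_fun setT (fun z : R * n.-tuple R => [tuple z.1 + tnth z.2 k | k < n]).
Proof.
apply: (@measurable_tuple_of _ _ _ _ n (fun k (z : R * n.-tuple R) => z.1 + tnth z.2 k)).
move=> k; apply: measurable_funD; first exact: measurable_fst.
exact: (measurableT_comp (measurable_tnth k) measurable_snd).
Qed.

Lemma measurable_path xi n (t : n.-tuple 'rV[R]_d) :
  measurable_fun setT (fun w => [tuple xi (tnth t k) w | k < n]).
Proof. apply: measurable_tuple_of => k; exact: proc_measurable. Qed.

(** The integrable weight exp(-x^2) is bounded below on the interval. *)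
Lemma admissible_itv m k : admissible_intensity m ->
  (m `[(- k%:R)%R, (k%:R)%R]%classic < +oo)%E.
Proof.
move=> /(_ 1 ltr01) h.
have mI : measurable (`[(- k%:R)%R, k%:R]%classic : set R) by exact: measurable_itv.
have mg : measurable_fun setT (fun x : R => (expR (- (1 * x ^+ 2)))%:E).
  by apply/measurable_EFinP; mfun.
have c0 : 0 < expR (- (k%:R ^+ 2)) :> R by exact: expR_gt0.
have : ((expR (- (k%:R ^+ 2)))%:E * m `[(- k%:R)%R, (k%:R)%R]%classic < +oo)%E.
  apply: le_lt_trans h; rewrite -integral_cst//.
  apply: (@le_trans _ _ (\int[m]_(x in `[(- k%:R)%R, (k%:R)%R]%classic)
    (expR (- (1 * x ^+ 2)))%:E)%E).
    apply: ge0_le_integral => //.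
    - by move=> x _; rewrite lee_fin expR_ge0.
    - exact: (measurable_funTS mg).
    - move=> x /=; rewrite in_itv/= => /andP[x1 x2]; rewrite lee_fin ler_expR lerN2 mul1r.
      by rewrite -[leLHS]real_normK ?num_real// ler_sqr ?nnegrE// ler_norml x1 x2.
  exact: ge0_subset_integral.
move: (measure_ge0 m `[(- k%:R)%R, (k%:R)%R]%classic).
set x := m _; case: x => [r _ _|_|//]; first by rewrite ltry.
by rewrite gt0_muley ?lte_fin// ltxx.
Qed.

End intensities.

Section system_functional.
Context {R : realType} {d : nat}.
Variables (m : {measure set R -> \bar R}) (xi : process R d)
  (G : gaussian_system m xi).
Hypothesis am : admissible_intensity m.
Variables (n : nat) (t : n.-tuple 'rV[R]_d).

Let P := gs_prob G.
Let E := gs_present G.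
Let U := gs_start G : nat -> gs_space G -> R.
Let X i w := [tuple gs_copy G i (tnth t k) w | k < n].
Let Q : {measure set (n.-tuple R) -> \bar R} :=
  image_measure (proc_prob xi) (measurable_path t).
Let genU : set (set (gs_space G)) :=
  [set E i `&` U i @^-1` B | i in [set: nat] & B in measurable].
Let genX i : set (set (gs_space G)) :=
  [set gs_copy G i t @^-1` B | t in [set: 'rV[R]_d] & B in measurable].

Let mE i : measurable (E i).
Proof. exact: gs_present_measurable. Qed.

Let mU i : measurable_fun setT (U i).
Proof. exact: measurable_funPT. Qed.

Let mX i : measurable_fun setT (X i).
Proof. by apply: measurable_tuple_of => k; exact: measurable_funPT. Qed.

Let Q1 : Q setT = 1%E.
Proof. by rewrite /Q /image_measure/= /pushforward preimage_setT probability_setT. Qed.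

Let calU_measurable : <<s genU >> `<=` measurable.
Proof.
apply: smallest_sub; first exact: sigma_algebra_measurable.
move=> _ [i _ [B mB] <-]; apply: measurableI => //.
by rewrite -[X in measurable X]setTI; exact: mU.
Qed.

Let hit_mem i A : measurable A -> <<s genU >> (E i `&` U i @^-1` A).
Proof. by move=> mA; apply: sub_sigma_algebra; exists i => //; exists A. Qed.

Let T' := g_sigma_algebraType genU.

Let calUT : <<s genU >> setT.
Proof. exact: (@measurableT _ T'). Qed.

Let calU_diff D i : <<s genU >> D -> <<s genU >> (D `\` E i).
Proof.
move=> mD; apply: (@measurableD _ T') => //.
by have := @hit_mem i setT measurableT; rewrite preimage_setT setIT.
Qed.

Let calU_cap D i A : <<s genU >> D -> measurable A ->
  <<s genU >> (D `&` (E i `&` U i @^-1` A)).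
Proof. by move=> mD mA; apply: (@measurableI _ T') => //; exact: hit_mem. Qed.

Let calX_mem i B : measurable B -> <<s genX i >> (X i @^-1` B).
Proof.
move=> mB; pose T'' := g_sigma_algebraType (genX i).
have : measurable_fun setT (X i : T'' -> n.-tuple R).
  apply: (@measurable_tuple_of _ _ T'' _ n (fun k => gs_copy G i (tnth t k) : T'' -> R)).
  move=> k _ A mA; rewrite setTI; apply: sub_sigma_algebra.
  by exists (tnth t k) => //; exists A.
by move=> /(_ measurableT B mB); rewrite setTI.
Qed.

Let indep (D : set (gs_space G)) (s : seq nat) (B : nat -> set (n.-tuple R)) :
  <<s genU >> D -> uniq s -> (forall i, measurable (B i)) ->
  (P (D `&` [set w | forall i, i \in s -> B i (X i w)]) =
   P D * \prod_(i <- s) Q (B i))%E.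
Proof.
move=> mD us mB.
have := @gs_independent _ _ _ _ G (None :: map Some s)
  (fun o => if o is Some i then X i @^-1` B i else D).
rewrite big_cons big_map => h.
transitivity (P D * \prod_(i <- s) P (X i @^-1` B i))%E.
  rewrite -h; first last.
  - by move=> [i|] _ //; exact: calX_mem.
  - rewrite /= map_inj_uniq ?us ?andbT; last by move=> ? ? [].
    by apply/mapP => -[].
  congr (P _); apply/seteqP; split => w /=.
    move=> [Dw Bw] [i|] //=; rewrite inE/= => /mapP[j js [->]].
    exact: Bw.
  move=> h'; split; first by apply: (h' None); rewrite /= inE eqxx.
  move=> i si; apply: (h' (Some i)); rewrite /= inE/=.
  by apply/mapP; exists i.
congr (_ * _)%E; apply: eq_bigr => i _.
exact: (@gs_copy_law _ _ _ _ G i n t (B i) (mB i)).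
Qed.

Lemma system_functional (h : n.-tuple R -> R) : measurable_fun setT h ->
  (forall x, 0 <= h x <= 1) ->
  (\int[P]_w (\prod_(i < l) thin_factor E
       (fun i w => [tuple particle i (tnth t k) w | k < n]) h i w)%:E
     @[l --> \oo] --> expeR (- intensity m xi t (EFin \o h)))%E.
Proof.
move=> mh h01.
pose sh (z : R * n.-tuple R) : n.-tuple R := [tuple z.1 + tnth z.2 k | k < n].
pose f z : R := 1 - h (sh z).
pose g := mark_mean Q (h \o sh).
have mhs : measurable_fun setT (h \o sh).
  exact: (measurableT_comp mh (@measurable_shift_tuple _ n)).
have mf : measurable_fun setT f by exact: measurable_funB.
have f01 z : 0 <= f z <= 1.
  by have /andP[? ?] := h01 (sh z); rewrite /f subr_ge0 gerBl; apply/andP.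
have hs01 z : 0 <= (h \o sh) z <= 1 by exact: h01.
have gE u : (g u)%:E = (\int[proc_prob xi]_w (h (shifted_path t u w))%:E)%E.
  rewrite /g -mark_meanE// ge0_integral_image//; last 2 first.
  - apply/measurable_EFinP.
    exact: (measurableT_comp mhs (measurable_pair1 u)).
  - by move=> y; rewrite lee_fin; case/andP: (h01 (sh (u, y))).
  apply: eq_integral => w _; congr ((h _)%:E).
  by apply: eq_from_tnth => k; rewrite !tnth_mktuple.
have fg u : mark_mean Q f u = 1 - g u.
  have mf' : measurable_fun setT (fun x => (f (u, x))%:E).
    apply/measurable_EFinP; exact: (measurableT_comp mf (measurable_pair1 u)).
  have mh' : measurable_fun setT (fun x => ((h \o sh) (u, x))%:E).
    apply/measurable_EFinP; exact: (measurableT_comp mhs (measurable_pair1 u)).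
  apply/eqP; rewrite -(addrK (g u) (mark_mean Q f u)); apply/eqP; congr (_ - _).
  apply: EFin_inj; rewrite EFinD -!mark_meanE// -ge0_integralD//.
  - rewrite -[RHS]Q1 -integral_one//; apply: eq_integral => x _.
    by rewrite -EFinD /f /= subrK.
  - by move=> x _; rewrite lee_fin; case/andP: (f01 (u, x)).
  - by move=> x _; rewrite lee_fin; case/andP: (hs01 (u, x)).
have g01 u : 0 <= g u <= 1 by exact: mark_mean01.
have mg : measurable_fun setT g by exact: measurable_mark_mean.
rewrite (_ : (fun l => _) = (fun l => \int[P]_w (\prod_(i < l) thin_factor E U g i w)%:E)%E).
  have -> : intensity m xi t (EFin \o h) = (\int[m]_u (g u)%:E)%E.
    by apply: eq_integral => u _; rewrite gE.
  apply: (@poisson_functional _ _ _ _ _ P E U m mE mU _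
    (fun k => `[- k%:R, k%:R]%classic)) => //.
  - exact: gs_start_poisson.
  - by move=> k; exact: admissible_itv.
  - move=> k l kl x /=; rewrite !in_itv/= => /andP[x1 x2]; apply/andP; split.
      by apply: le_trans x1; rewrite lerN2 ler_nat.
    by apply: (le_trans x2); rewrite ler_nat.
  - move=> x; exists (Num.trunc `|x|).+1; rewrite /= in_itv/= -ler_norml.
    by rewrite ltW// truncnS_gt.
(* [marking_prod] with D = setT and no mark constraint replaces every path by its mean effect, which
   leaves a thinning of the starting points alone. *)
apply/funext => l.
have := @marking_prod _ _ _ _ _ P E U X Q <<s genU >> mE mU mX Q1 calU_measurable
  calU_diff calU_cap indep f mf f01 l setT [::] (fun=> setT) calUT isT.
rewrite big_nil mul1e (_ : setT `&` _ = setT); last first.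
  by apply/seteqP; split => w //= _; split.
move=> mp; transitivity (\int[P]_w (\prod_(i < l) mark_factor E U X f i w)%:E)%E.
  apply: eq_integral => w _; congr (_%:E); apply: eq_bigr => i _.
  rewrite /thin_factor /mark_factor; case: ifP => // _; congr (1 - h _).
  by apply: eq_from_tnth => k; rewrite !tnth_mktuple.
rewrite mp//; apply: eq_integral => w _; congr (_%:E); apply: eq_bigr => i _.
by rewrite /thin_factor /mean_factor; case: ifP => // _; rewrite fg.
Qed.

End system_functional.

Section sigma_finite_pack.
Local Open Scope ereal_scope.
Context {R : realType}.
Variable m : {measure set R -> \bar R}.
Hypothesis am : admissible_intensity m.

Let m' : set R -> \bar R := m.

Let m'_sigma_finite : sigma_finite setT m'.
Proof.
exists (fun k => `[(- k%:R)%R, (k%:R)%R]%classic).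
  apply/esym/seteqP; split => // x _; exists (Num.trunc `|x|%R).+1 => //.
  by rewrite /= in_itv/= -ler_norml ltW// truncnS_gt.
by move=> k; split; [exact: measurable_itv|exact: admissible_itv].
Qed.

#[local] HB.instance Definition _ := Measure.on m'.
#[local] HB.instance Definition _ := Measure_isSigmaFinite.Build _ _ _ m' m'_sigma_finite.

(** Same purpose as [finite_measure_pack]: exchanging integrals asks for a bundled sigma-finite
    measure. *)
Lemma sigma_finite_pack :
  {mu : {sigma_finite_measure set R -> \bar R} | mu = m :> (set R -> \bar R)}.
Proof. by exists m'. Qed.

End sigma_finite_pack.

Section intensity_measures.
Context {R : realType} {d : nat}.
Variables (m : {measure set R -> \bar R}) (xi : process R d).
Hypothesis am : admissible_intensity m.

Lemma measurable_shifted_path n (t : n.-tuple 'rV[R]_d) :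
  measurable_fun setT (fun z : R * proc_space xi => shifted_path t z.1 z.2).
Proof.
apply: (@measurable_tuple_of _ _ _ _ n
  (fun k (z : R * proc_space xi) => z.1 + xi (tnth t k) z.2)) => k.
apply: measurable_funD; first exact: measurable_fst.
exact: (measurableT_comp (@proc_measurable _ _ xi _) measurable_snd).
Qed.

(** Turns the iterated integral [intensity] into integration against a genuine measure, so that its
    values on sets determine it. *)
Lemma intensity_measure n (t : n.-tuple 'rV[R]_d) :
  exists nu : {measure set (n.-tuple R) -> \bar R},
    forall F, measurable_fun setT F -> (forall x, 0 <= F x)%E ->
      intensity m xi t F = (\int[nu]_x F x)%E.
Proof.
have [mu muE] := sigma_finite_pack am.
exists (image_measure (mu \x proc_prob xi)%E (measurable_shifted_path t)) => F mF F0.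
rewrite ge0_integral_image// fubini_tonelli1//; last first.
  exact: (measurableT_comp mF (measurable_shifted_path t)).
exact: (congr1 (fun q : set R -> \bar R =>
  \int[q]_u \int[proc_prob xi]_w F (shifted_path t u w))%E (esym muE)).
Qed.

(** The probability of no point in B is exp(- M_t(B)), and exp(-x) is injective on the extended
    line, so void probabilities alone determine the intensity, infinite values included. *)
Lemma stationary_intensity (G : gaussian_system m xi) : stationary_system G ->
  forall n (t : n.-tuple 'rV[R]_d) h F,
    measurable_fun setT F -> (forall x, 0 <= F x)%E ->
    intensity m xi [tuple tnth t k + h | k < n] F = intensity m xi t F.
Proof.
move=> st n t h F mF F0.
have [nu nuE] := intensity_measure t.
have [nuh nuhE] := intensity_measure [tuple tnth t k + h | k < n].
rewrite nuE// nuhE//; apply: eq_measure_integral => B mB _.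
have ind (q : {measure set (n.-tuple R) -> \bar R}) :
    (q B = \int[q]_x (\1_B x)%:E)%E by rewrite integral_indic// setIT.
have mB' : measurable_fun setT (EFin \o (\1_B : n.-tuple R -> R)).
  by apply/measurable_EFinP; exact: measurable_indic.
rewrite !{}ind.
have := nuE _ mB'; have := nuhE _ mB'; rewrite /= => <-; last by move=> x; rewrite lee_fin.
move=> <-; last by move=> x; rewrite lee_fin.
have ind01 x : 0 <= (\1_B x : R) <= 1 by rewrite indicE; case: (_ \in _); rewrite /= ?lexx ?ler01.
have mind : measurable_fun setT (\1_B : n.-tuple R -> R) by exact: measurable_indic.
have mE i : measurable (gs_present G i) by exact: gs_present_measurable.
have mZ (s : n.-tuple 'rV[R]_d) i : measurable_fun setT
    (fun w => [tuple particle (G := G) i (tnth s k) w | k < n]).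
  by apply: measurable_tuple_of => k; apply: measurable_funD; exact: measurable_funPT.
have void s : expeR (- intensity m xi s (EFin \o \1_B)) =
    gs_prob G [set w | npoints (R := R) (gs_present G)
      (fun i w => [tuple particle (G := G) i (tnth s k) w | k < n]) B w = 0%E].
  have c := @system_functional _ _ _ _ G am n s _ mind ind01.
  have c' := @void_probability_cvg _ _ _ _ _ (gs_prob G) _ _ mE (mZ s) B mB.
  exact: (cvg_unique (@ereal_hausdorff R) c c').
apply: ereal_expN_inj; apply: etrans (void _) _; apply: etrans _ (esym (void t)).
have m0 : measurable [set x : 1.-tuple (\bar R) | tnth x ord0 = 0%E].
  rewrite -[X in measurable X]setTI.
  exact: (measurable_tnth ord0 measurableT (emeasurable_set1 0%E)).
have := st n t h 1%N (fun=> B) (fun=> mB) _ m0.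
have N0 (Z : nat -> gs_space G -> n.-tuple R) :
    (fun w => [tuple npoints (R := R) (gs_present G) Z B w | j < 1]) @^-1`
      [set x : 1.-tuple (\bar R) | tnth x ord0 = 0%E] =
    [set w | npoints (R := R) (gs_present G) Z B w = 0%E].
  by apply/funext => w; rewrite /preimage /mkset tnth_mktuple.
move=> eqN; apply: (etrans (esym (congr1 (gs_prob G) (N0 _)))).
apply: (etrans _ (congr1 (gs_prob G) (N0 _))); apply: etrans _ eqN.
apply: (congr1 (fun f : gs_space G -> 1.-tuple (\bar R) => gs_prob G (f @^-1` _))).
apply/funext => w; apply: eq_from_tnth => k.
rewrite !tnth_mktuple; apply: (congr1 (fun Z => npoints (gs_present G) Z B w)).
apply/funext => i; apply/funext => w'; apply: eq_from_tnth => l.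
by rewrite !tnth_mktuple.
Qed.

End intensity_measures.

Lemma integral_expR_gt0 {R : realType} {d : measure_display}
    {T : measurableType d} (m : {measure set T -> \bar R}) (f : T -> R) :
  m setT != 0%E -> measurable_fun setT f -> (0 < \int[m]_x (expR (f x))%:E)%E.
Proof.
move=> m_neq0 mf; rewrite lt0e; apply/andP; split; last first.
  by apply: integral_ge0 => u _; rewrite lee_fin expR_ge0.
apply: contra m_neq0 => /eqP i0.
have mef : measurable_fun setT (fun x => (expR (f x))%:E).
  apply/measurable_EFinP; exact: (measurableT_comp (@measurable_expR R) mf).
have : (\int[m]_x `|(expR (f x))%:E|)%E = 0%E.
  by apply: etrans _ i0; apply: eq_integral => u _; rewrite gee0_abs// lee_fin expR_ge0.
move/(ae_eq_integral_abs m measurableT mef).1 => [N [mN N0 sN]].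
rewrite -measure_le0 -N0 le_measure ?inE// => u _.
by apply: sN => /(_ Logic.I) [] /eqP; rewrite gt_eqF ?expR_gt0.
Qed.

(** * Exponential measures and Gaussian integrability *)

Section exponential_measures.
Context {R : realType}.
Local Notation leb := (@lebesgue_measure R).

Lemma lebesgue_measure_shift (c : R) (A : set R) : measurable A ->
  leb ((fun x => x + c) @^-1` A) = leb A.
Proof.
move=> mA.
have ms : measurable_fun setT (fun x : measurableTypeR R => (x + c : measurableTypeR R)).
  exact: measurable_funD.
apply/esym; apply: (@lebesgue_measure_unique _ (image_measure leb ms)) => //= _ [[a b]] _ <-.
rewrite /pushforward /= (_ : _ @^-1` _ = `]a - c, b - c]%classic); last first.
  by apply/seteqP; split => x /=; rewrite !in_itv/= ltrBlDr lerBrDr.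
by rewrite !lebesgue_measure_itv/= !lte_fin ltrD2r -!EFinD opprB addrA subrK.
Qed.

Lemma exp_measure_integral (m : {measure set R -> \bar R}) (alpha lam : R) :
  0 <= alpha -> is_scaled_exp_measure m alpha lam ->
  forall F, measurable_fun setT F -> (forall x, 0 <= F x)%E ->
    (\int[m]_x F x = \int[leb]_x (F x * (alpha * expR (- (lam * (x : R))))%:E))%E.
Proof.
move=> a0 mE F mF F0.
have mg : measurable_fun setT (fun x : R => alpha * expR (- (lam * x))) by mfun.
have g0 x : 0 <= alpha * expR (- (lam * x)) by rewrite mulr_ge0 ?expR_ge0.
have mid : measurable_fun setT (fun x : measurableTypeR R => (x : R)).
  exact: measurable_id.
have [nu [nuE <-//]] := weighted_lawP (S := R) leb mg g0 mid.
apply: eq_measure_integral => A mA _.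
rewrite mE// nuE// /exp_measure -ge0_integralZl//.
by apply: measurable_funTS; apply/measurable_EFinP; mfun.
Qed.

(** Completing squares gives s x <= s^2/dl + dl x^2/4 and - dl (x + c)^2 <= - dl x^2/2 + dl c^2,
    which leaves a Gaussian weight of rate dl/4. *)
Lemma admissible_quad (m : {measure set R -> \bar R}) (s c dl : R) :
  admissible_intensity m -> 0 < dl ->
  (\int[m]_u (expR (s * u - dl * (u + c) ^+ 2))%:E < +oo)%E.
Proof.
move=> am dl0.
have e0 : 0 < dl / 4 by lra.
have mg e : measurable_fun setT (fun x : R => (expR (- (e * x ^+ 2)))%:E) by mfun.
have := am _ e0; set I := (\int[_]_x _)%E => Ioo.
apply: (@le_lt_trans _ _ ((expR (s ^+ 2 / dl + dl * c ^+ 2))%:E * I)%E); last first.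
  by rewrite lte_mul_pinfty// lee_fin expR_ge0.
rewrite -ge0_integralZl//; try by [exact: mg|move=> x _; rewrite lee_fin expR_ge0|rewrite lee_fin expR_ge0].
apply: ge0_le_integral => //.
- by apply/measurable_EFinP; mfun.
- by apply: emeasurable_funM => //; exact: mg.
- move=> x _; rewrite -EFinM lee_fin -expRD ler_expR.
  have h1 : 0 <= (s - dl / 2 * x) ^+ 2 / dl by rewrite divr_ge0 ?sqr_ge0// ltW.
  have h2 : 0 <= dl / 2 * (x + 2 * c) ^+ 2.
    by rewrite mulr_ge0 ?sqr_ge0// divr_ge0// ltW.
  have h3 : (s - dl / 2 * x) ^+ 2 / dl = s ^+ 2 / dl - s * x + dl / 4 * x ^+ 2.
    by field; rewrite gt_eqF.
  nra.
Qed.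

Lemma exp_measure_admissible (m : {measure set R -> \bar R}) (alpha lam : R) :
  0 <= alpha -> is_scaled_exp_measure m alpha lam -> admissible_intensity m.
Proof.
move=> a0 mE e e0.
rewrite (exp_measure_integral a0 mE); last 2 first.
- by mfun.
- by move=> x; rewrite lee_fin expR_ge0.
(* The function exp(- e x^2 - lam x) is proportional to the normal density with mean - lam/(2 e) and
   variance 1/(2 e). *)
pose mu := - lam / (2 * e); pose sg := (Num.sqrt (2 * e))^-1.
have sg0 : sg != 0 by rewrite invr_eq0 gt_eqF// sqrtr_gt0 mulr_gt0.
rewrite (_ : (fun x : R => _) = (fun x : R => (alpha * expR (lam ^+ 2 / (4 * e)) /
   normal_peak sg)%:E * (normal_pdf mu sg x)%:E)%E).
  rewrite ge0_integralZl//.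
  - by rewrite integral_normal_pdf mule1 ltry.
  - by apply/measurable_EFinP; exact: measurable_normal_pdf.
  - by move=> x _; rewrite lee_fin normal_pdf_ge0.
  - by rewrite lee_fin divr_ge0 ?normal_peak_ge0// mulr_ge0// expR_ge0.
apply/funext => x; rewrite -!EFinM; congr (_%:E).
have p0 : normal_peak sg != 0.
  by rewrite gt_eqF// normal_peak_gt0.
rewrite /normal_pdf (negbTE sg0) /normal_fun [RHS]mulrA divfK//.
rewrite mulrCA -!mulrA; congr (_ * _); rewrite -!expRD; congr expR.
rewrite /mu /sg exprVn sqr_sqrtr ?mulr_ge0 ?ltW//; field.
by rewrite gt_eqF.
Qed.

End exponential_measures.

(** * Change of measure and shift relations for one-point intensities *)

Section cameron_martin.
Context {R : realType} {d : measure_display} {T : measurableType d} {I : Type}.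
Variables (P : probability T R) (X : I -> T -> R) (mu : I -> R) (K : I -> I -> R).
Hypotheses (mX : forall i, measurable_fun setT (X i))
  (XmuK : gauss_mgf P X mu K) (Ksym : forall s t, K s t = K t s).

Lemma gauss_mgf2 s t (a b : R) :
  (\int[P]_w (expR (a * X s w + b * X t w))%:E =
   (expR (a * mu s + b * mu t +
     (a ^+ 2 * K s s + 2 * (a * b) * K s t + b ^+ 2 * K t t) / 2))%:E)%E.
Proof.
have := XmuK [tuple s; t] (fun i : 'I_2 => if i == ord0 then a else b).
rewrite /quad_form !big_ord_recl !big_ord0 /= !addr0 !(tnth_nth s)/=.
under eq_integral do rewrite big_ord_recl big_ord1 /= !(tnth_nth s)/=.
move=> ->; congr ((expR (_ + _ / 2))%:E).
by rewrite [K t s]Ksym; ring.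
Qed.

Definition increment_variance s t := K t t - 2 * K s t + K s s.

(** Both sides weight a function of the single variable X_s, so comparing exponential transforms is
    enough. The shift is r Cov(X_s, X_t - X_s), and the factor is E exp(r (X_t - X_s)). *)
Lemma cameron_martin s t (r : R) (phi : R -> \bar R) :
  measurable_fun setT phi -> (forall x, 0 <= phi x)%E ->
  (\int[P]_w (phi (X s w) * (expR (r * (X t w - X s w)))%:E) =
   \int[P]_w (phi (X s w + r * (K s t - K s s))%R *
     (expR (r * (mu t - mu s) + r ^+ 2 * increment_variance s t / 2))%:E))%E.
Proof.
move=> mphi phi0.
set l := r * (mu t - mu s) + _; set c := K s t - K s s.
have m1 : measurable_fun setT (fun w => expR (r * (X t w - X s w))).
  apply: (measurableT_comp (f := expR)); first exact: measurable_expR.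
  by apply: measurable_funM => //; exact: measurable_funB.
have m2 : measurable_fun setT (fun w => X s w + r * c) by exact: measurable_funD.
have E1 q : (\int[P]_w (expR (q * X s w) * expR (r * (X t w - X s w)))%:E =
    (expR (q * (mu s + r * c) + q ^+ 2 * K s s / 2 + l))%:E)%E.
  transitivity (\int[P]_w (expR ((q - r) * X s w + r * X t w))%:E)%E.
    by apply: eq_integral => w _; rewrite -expRD; congr ((expR _)%:E); ring.
  rewrite gauss_mgf2; congr ((expR _)%:E).
  by rewrite /l /c /increment_variance; field.
have E2 q : (\int[P]_w (expR (q * (X s w + r * c)) * expR l)%:E =
    (expR (q * (mu s + r * c) + q ^+ 2 * K s s / 2 + l))%:E)%E.
  transitivity (\int[P]_w ((expR (q * (r * c) + l))%:E *
      (expR (q * X s w + 0 * X s w))%:E))%E.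
    apply: eq_integral => w _; rewrite -EFinM -!expRD; congr ((expR _)%:E); ring.
  rewrite ge0_integralZl//.
  - by rewrite gauss_mgf2 -EFinM -expRD; congr ((expR _)%:E); field.
  - apply/measurable_EFinP; apply: (measurableT_comp (f := expR)).
      exact: measurable_expR.
    by apply: measurable_funD; exact: measurable_funM.
apply: (@eq_weighted_integral _ _ _ _ _ _ _ P P _ (fun=> expR l) (X s)
  (fun w => X s w + r * c)) => //.
apply: (@weighted_exp_unique _ _ _ _ _ P P _ _ (X s) _ 1) => //.
- by move=> q; rewrite E1 ltry.
- by move=> q; rewrite E2 ltry.
- by move=> n; rewrite E1 E2.
Qed.

End cameron_martin.

Section one_point_intensity.
Context {R : realType} {d : nat}.
Variables (m : {measure set R -> \bar R}) (xi : process R d).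
Hypothesis am : admissible_intensity m.

Definition intensity1 (t : 'rV[R]_d) (psi : R -> \bar R) : \bar R :=
  (\int[m]_u \int[proc_prob xi]_w psi (u + xi t w)%R)%E.

Lemma intensity1E t psi :
  intensity1 t psi = intensity m xi [tuple t] (fun x => psi (tnth x ord0)).
Proof.
apply: eq_integral => u _; apply: eq_integral => w _; congr psi.
by rewrite tnth_mktuple (tnth_nth t).
Qed.

Let measurable_tnth0 (psi : R -> \bar R) : measurable_fun setT psi ->
  measurable_fun setT (fun x : 1.-tuple R => psi (tnth x ord0)).
Proof. by move=> mpsi; exact: (measurableT_comp mpsi (measurable_tnth ord0)). Qed.

Lemma intensity1Z t psi (c : R) : 0 <= c ->
  measurable_fun setT psi -> (forall x, 0 <= psi x)%E ->
  intensity1 t (fun x => psi x * c%:E)%E = (c%:E * intensity1 t psi)%E.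
Proof.
move=> c0 mpsi psi0; have [nu nuE] := intensity_measure xi am [tuple t].
rewrite !intensity1E !nuE//.
- by rewrite -ge0_integralZl//; [under eq_integral do rewrite muleC|exact: measurable_tnth0].
- exact: measurable_tnth0.
- by apply: emeasurable_funM => //; exact: measurable_tnth0.
- by move=> x; rewrite mule_ge0.
Qed.

Hypothesis m_neq0 : m setT != 0%E.
Variables (mu : 'rV[R]_d -> R) (K : 'rV[R]_d -> 'rV[R]_d -> R).
Hypotheses (ximuK : gauss_mgf (proc_prob xi) xi mu K)
  (Ksym : forall s t, K s t = K t s)
  (xiq : forall t, gauss_quad_law (proc_prob xi) (xi t) (mu t) (K t t)).

Lemma intensity1_gauss s t : intensity1 t (fun x => (expR (- (x + s) ^+ 2))%:E) =
  (\int[m]_u (gauss_quad 0 (- (u + s)) 1 (mu t) (K t t))%:E)%E.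
Proof.
apply: eq_integral => u _; rewrite -(xiq t).2//.
by apply: eq_integral => w _; congr ((expR _)%:E); ring.
Qed.

(** Averaging a Gaussian function over xi_t divides its rate by [k] and leaves a Gaussian transform
    of [m] alone. *)
Lemma intensity1_gaussE s t (k := 1 + 2 * K t t) :
  (intensity1 t (fun x => (expR (- (x + s) ^+ 2))%:E) =
   ((Num.sqrt k)^-1)%:E *
     \int[m]_u (expR (0 * u - k^-1 * (u + (mu t + s)) ^+ 2))%:E)%E.
Proof.
rewrite intensity1_gauss -ge0_integralZl//; last by apply/measurable_EFinP; mfun.
apply: eq_integral => u _; rewrite -EFinM; congr (_%:E).
have k0 : 0 < k by have := (xiq t).1; rewrite /k; lra.
rewrite /gauss_quad mulr1 -/k; congr (_ * expR _); field.
by rewrite gt_eqF.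
Qed.

Let k_gt0 t : 0 < 1 + 2 * K t t.
Proof. by have := (xiq t).1; lra. Qed.

Lemma intensity1_gauss_gt0_lty s t :
  (0 < intensity1 t (fun x => (expR (- (x + s) ^+ 2))%:E) < +oo)%E.
Proof.
rewrite intensity1_gaussE; set k := 1 + _; set I := (\int[m]_u _)%E.
have k0 : 0 < k by exact: k_gt0.
have Ioo : (I < +oo)%E by apply: admissible_quad => //; rewrite invr_gt0.
have I0 : (0 < I)%E by apply: integral_expR_gt0 => //; mfun.
have c0 : 0 < (Num.sqrt k)^-1 by rewrite invr_gt0 sqrtr_gt0.
by rewrite mule_gt0//= lte_mul_pinfty// lee_fin ltW.
Qed.

Hypothesis stat : forall n (t : n.-tuple 'rV[R]_d) h F,
  measurable_fun setT F -> (forall x, 0 <= F x)%E ->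
  intensity m xi [tuple tnth t k + h | k < n] F = intensity m xi t F.

Lemma intensity1_stationary t psi : measurable_fun setT psi ->
  (forall x, 0 <= psi x)%E -> intensity1 t psi = intensity1 0 psi.
Proof.
move=> mpsi psi0; rewrite (intensity1E t) (intensity1E 0).
apply: etrans _ (@stat 1 [tuple 0] t _ (measurable_tnth0 mpsi) (fun x => psi0 _)).
have e : [tuple t] = [tuple tnth [tuple 0] k + t | k < 1].
  apply: eq_from_tnth => k; rewrite tnth_mktuple (ord1 k).
  by rewrite (tnth_nth t) (tnth_nth 0) add0r.
exact: (congr1 (fun s => intensity m xi s (fun x => psi (tnth x ord0))) e).
Qed.

Let pair_fun r (psi : R -> \bar R) (x : 2.-tuple R) : \bar R :=
  (psi (tnth x ord0) * (expR (r * (tnth x (lift ord0 ord0) - tnth x ord0)))%:E)%E.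

Lemma intensity_pair s t r psi : measurable_fun setT psi -> (forall x, 0 <= psi x)%E ->
  (intensity m xi [tuple s; t] (pair_fun r psi) =
   (expR (r * (mu t - mu s) + r ^+ 2 * increment_variance K s t / 2))%:E *
   intensity1 s (fun x => psi (x + r * (K s t - K s s))%R))%E.
Proof.
move=> mpsi psi0; set c := r * (K s t - K s s).
have mc : measurable_fun setT (fun x : R => psi (x + c)).
  by apply: (measurableT_comp mpsi); exact: measurable_funD.
apply: etrans _ (intensity1Z s (expR_ge0 _) mc (fun x => psi0 _)).
rewrite /intensity /intensity1; apply: eq_integral => u _.
transitivity (\int[proc_prob xi]_w (psi (u + xi s w)%R *
    (expR (r * (xi t w - xi s w)))%:E))%E.
  apply: eq_integral => w _; rewrite /pair_fun !tnth_mktuple !(tnth_nth s)/=.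
  by congr (_ * (expR (r * _))%:E)%E; ring.
have mu_psi : measurable_fun setT (fun x : R => psi (u + x)).
  by apply: (measurableT_comp mpsi); exact: measurable_funD.
have cm := @cameron_martin _ _ _ _ (proc_prob xi) xi mu K (@proc_measurable _ _ xi)
  ximuK Ksym s t r _ mu_psi (fun x => psi0 _).
by apply: (etrans cm); apply: eq_integral => w _; rewrite addrA.
Qed.

(** The three gaps compare the time pair (h, t + h) with (0, t). The last two have the opposite sign
    because their factor is moved across the identity. *)
Definition shift_gap h t := (K h (t + h) - K h h) - (K 0 t - K 0 0).
Definition drift_gap h t := (mu t - mu 0) - (mu (t + h) - mu h).
Definition variance_gap h t :=
  (increment_variance K 0 t - increment_variance K h (t + h)) / 2.

Lemma intensity1_shift h t r psi : measurable_fun setT psi -> (forall x, 0 <= psi x)%E ->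
  (intensity1 0 (fun x => psi (x + r * shift_gap h t)%R) =
   (expR (r * drift_gap h t + r ^+ 2 * variance_gap h t))%:E * intensity1 0 psi)%E.
Proof.
move=> mpsi psi0.
(* Shifting the test function back by [c] cancels the displacement at the pair (0, t), so that only
   the gap remains at (h, t + h). *)
pose c := r * (K 0 t - K 0 0); pose psi' x := psi (x - c).
have mpsi' : measurable_fun setT psi'.
  by apply: (measurableT_comp mpsi); exact: measurable_funB.
have psi'0 x : (0 <= psi' x)%E by exact: psi0.
have pair0 x : (0 <= pair_fun r psi' x)%E.
  by rewrite mule_ge0// lee_fin expR_ge0.
have mF : measurable_fun setT (pair_fun r psi').
  apply: emeasurable_funM.
    exact: (measurableT_comp mpsi' (measurable_tnth ord0)).
  apply/measurable_EFinP; apply: (measurableT_comp (f := expR)).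
    exact: measurable_expR.
  by apply: measurable_funM => //; apply: measurable_funB; exact: measurable_tnth.
have st := @stat 2 [tuple 0; t] h _ mF pair0.
have e : [tuple h; t + h] = [tuple tnth [tuple 0; t] k + h | k < 2].
  apply: eq_from_tnth => k; rewrite tnth_mktuple !(tnth_nth 0).
  by case: k => -[|[|//]] i2; rewrite /= ?add0r.
have {st e} := etrans (congr1 (fun s => intensity m xi s (pair_fun r psi')) e) st.
rewrite (intensity_pair h (t + h) r mpsi' psi'0) (intensity_pair 0 t r mpsi' psi'0).
set lh := _ + _; set l0 := r * (mu t - mu 0) + _.
rewrite intensity1_stationary//; last first.
  by apply: (measurableT_comp mpsi'); exact: measurable_funD.
have -> : (fun x => psi' (x + r * (K h (t + h) - K h h))) =
    (fun x => psi (x + r * shift_gap h t)).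
  by apply/funext => x; congr psi; rewrite /c /shift_gap; ring.
have -> : (fun x => psi' (x + r * (K 0 t - K 0 0))) = psi.
  by apply/funext => x; congr psi; rewrite /c; ring.
move=> e; transitivity ((expR (- lh) * expR lh)%:E *
    intensity1 0 (fun x => psi (x + r * shift_gap h t)%R))%E.
  by rewrite -expRD addNr expR0 mul1e.
rewrite EFinM -muleA e.
rewrite muleA -EFinM -expRD; congr ((expR _)%:E * _)%E.
by rewrite /lh /l0 /drift_gap /variance_gap; field.
Qed.

Let gauss0 : R -> \bar R := fun x => (expR (- (x + 0) ^+ 2))%:E.

Let mgauss0 : measurable_fun setT gauss0.
Proof. by apply/measurable_EFinP; mfun. Qed.

Let gauss0_ge0 x : (0 <= gauss0 x)%E.
Proof. by rewrite lee_fin expR_ge0. Qed.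

Let expR_cancel (x y : R) :
  ((expR x)%:E * intensity1 0 gauss0 = (expR y)%:E * intensity1 0 gauss0)%E -> x = y.
Proof.
have /andP[] := intensity1_gauss_gt0_lty 0 0; rewrite -/gauss0.
case: (intensity1 0 gauss0) => // q q0 _ [] /mulIf h; apply/expR_inj/h.
by rewrite gt_eqF.
Qed.

Lemma variance_gap_eq0 h t : variance_gap h t = 0.
Proof.
(* One shift with r = 2 equals two shifts with r = 1, while for drift gap a and variance gap b the
   exponents are 2 a + 4 b and 2 (a + b). *)
have e1 := @intensity1_shift h t (1 + 1) gauss0 mgauss0 gauss0_ge0.
have ms : measurable_fun setT (fun x : R => gauss0 (x + 1 * shift_gap h t)).
  by apply: (measurableT_comp mgauss0); exact: measurable_funD.
have e2 := @intensity1_shift h t 1 _ ms (fun x => gauss0_ge0 _).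
have e3 := @intensity1_shift h t 1 gauss0 mgauss0 gauss0_ge0.
have := e1; rewrite (_ : (fun x => _) =
    (fun x => gauss0 (x + 1 * shift_gap h t + 1 * shift_gap h t))); last first.
  by apply/funext => x; congr gauss0; ring.
rewrite e2 e3 muleA -EFinM -expRD => /expR_cancel; lra.
Qed.

Lemma intensity1_shift0 h t r psi : measurable_fun setT psi -> (forall x, 0 <= psi x)%E ->
  (intensity1 0 (fun x => psi (x + r * shift_gap h t)%R) =
   (expR (r * drift_gap h t))%:E * intensity1 0 psi)%E.
Proof.
by move=> mpsi psi0; rewrite intensity1_shift// variance_gap_eq0 mulr0 addr0.
Qed.

(** A Gaussian test function has a finite positive integral, which can be cancelled. Once a
    translation rule is known, this yields the drift gap at every pair (h, t). *)
Lemma drift_gap_unique h t lam :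
  (forall psi, measurable_fun setT psi -> (forall x, 0 <= psi x)%E ->
   (intensity1 0 (fun x => psi (x + shift_gap h t)%R) =
   (expR lam)%:E * intensity1 0 psi)%E) -> drift_gap h t = lam.
Proof.
move=> e; apply: expR_cancel; rewrite -e//.
have := @intensity1_shift0 h t 1 gauss0 mgauss0 gauss0_ge0; rewrite (_ : (fun x => _) =
    (fun x => gauss0 (x + shift_gap h t))) ?mul1r//.
Qed.

End one_point_intensity.

(** * Recognizing an exponential measure *)

Section exponential_intensity.
Context {R : realType}.
Local Notation leb := (@lebesgue_measure R).

Let measurable_line : measurable_fun setT (fun x : measurableTypeR R => (x : R)).
Proof. exact: measurable_id. Qed.

(* Lebesgue measure transported from [measurableTypeR R] to [R] itself. *)
Lemma line_measureP : exists nu : {measure set R -> \bar R},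
  [/\ admissible_intensity nu, nu setT != 0%E,
    (forall c F, measurable_fun setT F -> (forall x, 0 <= F x)%E ->
      (\int[nu]_x F (x + c)%R = \int[nu]_x F x)%E) &
    (forall F, measurable_fun setT F -> (forall x, 0 <= F x)%E ->
      (\int[nu]_x F x = \int[leb]_x F x)%E)].
Proof.
exists (image_measure leb measurable_line); split.
- apply: (exp_measure_admissible ler01 (lam := 0)) => A mA; rewrite mul1e /exp_measure.
  under eq_integral do rewrite mul0r oppr0 expR0.
  by rewrite integral_one.
- have h := @lebesgue_measure_itv R `]-oo, +oo[; rewrite set_itvNyy/= in h.
  by apply/eqP => e; have := etrans (esym h) e.
- move=> c F mF F0; apply: (eq_law_integral (X2 := id)) => //.
    exact: measurable_funD.
  by move=> A mA; exact: lebesgue_measure_shift.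
- exact: ge0_integral_image.
Qed.

(** A translate of the Gaussian W is an exponential tilt of W, so the hypothesis gives exponential
    moments of the finite measure W m along p'/(n+1). They agree with those of W times b e_lam; the
    two measures coincide, and the positive W can be divided out. *)
Lemma gauss_translates_exp_measure (m : {measure set R -> \bar R}) (k M lam p : R) :
  admissible_intensity m -> m setT != 0%E -> 0 < k -> p != 0 ->
  (forall n : nat,
    (\int[m]_u (expR (0 * u - k * (u + (M + p / n.+1%:R)) ^+ 2))%:E =
     (expR (lam * (p / n.+1%:R)))%:E *
       \int[m]_u (expR (0 * u - k * (u + M) ^+ 2))%:E)%E) ->
  exists2 alpha, 0 < alpha & is_scaled_exp_measure m alpha lam.
Proof.
move=> am m0 k0 p0 mE; have [nu [nua nu0 nush nuE]] := line_measureP.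
pose W (x : R) : R := expR (- (k * (x + M) ^+ 2)).
have mW : measurable_fun setT W by rewrite /W; mfun.
have W0 x : 0 < W x by exact: expR_gt0.
have mWE s u : expR (0 * u - k * (u + (M + s)) ^+ 2) = W (u + s).
  by congr expR; ring.
have qW q u : expR (q * u) * W u = expR (q * u - k * (u + M) ^+ 2).
  by rewrite -expRD.
pose C := (\int[nu]_u (expR (- lam * u - k * (u + M) ^+ 2))%:E)%E.
have Coo : (C < +oo)%E by exact: (admissible_quad _ _ nua).
have C0 : (0 < C)%E by apply: integral_expR_gt0 => //; mfun.
pose I := (\int[m]_u (W u)%:E)%E.
have IE : I = (\int[m]_u (expR (0 * u - k * (u + M) ^+ 2))%:E)%E.
  by apply: eq_integral => u _; rewrite mul0r add0r.
have Ioo : (I < +oo)%E by rewrite IE; exact: admissible_quad.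
have I0 : (0 < I)%E by apply: integral_expR_gt0 => //; mfun.
have [a aE] : exists a, I = a%:E by exists (fine I); rewrite fineK// ge0_fin_numE// ltW.
have [c cE] : exists c, C = c%:E by exists (fine C); rewrite fineK// ge0_fin_numE// ltW.
have a0 : 0 < a by rewrite -lte_fin -aE.
have c0 : 0 < c by rewrite -lte_fin -cE.
(* Gives W m and W times b e_lam the same total mass. *)
pose b := a / c; have b0 : 0 < b by rewrite divr_gt0.
exists b => // A mA.
pose g (u : R) := b * (W u * expR (- (lam * u))).
have mg : measurable_fun setT g by rewrite /g; mfun.
have g0 u : 0 <= g u := mulr_ge0 (ltW b0) (mulr_ge0 (ltW (W0 u)) (expR_ge0 _)).
have finm q : (\int[m]_u (expR (q * u) * W u)%:E < +oo)%E.
  under eq_integral do rewrite qW; exact: admissible_quad.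
have gE q u : expR (q * u) * g u = b * expR ((q - lam) * u - k * (u + M) ^+ 2).
  by rewrite /g mulrCA -!expRD; congr (b * expR _); ring.
have fing q : (\int[nu]_u (expR (q * u) * g u)%:E < +oo)%E.
  have aq := admissible_quad (q - lam) M nua k0.
  have -> : (\int[nu]_u (expR (q * u) * g u)%:E =
      b%:E * \int[nu]_u (expR ((q - lam) * u - k * (u + M) ^+ 2))%:E)%E.
    rewrite -ge0_integralZl; [|exact: measurableT|by apply/measurable_EFinP; mfun
      |by move=> u _; rewrite lee_fin expR_ge0|by rewrite lee_fin ltW].
    by apply: eq_integral => u _; rewrite gE EFinM.
  by apply: lte_mul_pinfty => //; rewrite lee_fin ltW.
(* Expanding - k (u + M + s)^2 at s = p/(n+1), the term in s u is - 2 k s u, that is p'/(n+1) times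
   u. *)
pose p' := - (2 * k * p).
have p'0 : p' != 0 by rewrite oppr_eq0 !mulf_neq0// gt_eqF.
have eqn n : (\int[m]_u (expR (p' / n.+1%:R * u) * W u)%:E =
    \int[nu]_u (expR (p' / n.+1%:R * u) * g u)%:E)%E.
  set s := p / n.+1%:R.
  have tilt u : expR (p' / n.+1%:R * u) * W u =
      expR (k * (2 * s * M + s ^+ 2)) * W (u + s).
    rewrite -!expRD; congr expR; rewrite /p' /s; field.
    by rewrite nat1r pnatr_eq0.
  transitivity ((expR (k * (2 * s * M + s ^+ 2)) * expR (lam * s) * a)%:E).
    under eq_integral do rewrite tilt -mWE EFinM.
    rewrite ge0_integralZl//; last by apply/measurable_EFinP; mfun.
    by rewrite mE -IE aE -!EFinM mulrA.
  transitivity (\int[nu]_u ((expR (k * (2 * s * M + s ^+ 2)) * b * expR (lam * s))%:E *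
      (expR (- lam * (u + s) - k * (u + s + M) ^+ 2))%:E))%E; last first.
    apply: eq_integral => u _; rewrite -EFinM; congr (_%:E).
    have -> : expR (- lam * (u + s) - k * (u + s + M) ^+ 2) =
        expR (- lam * s) * (W (u + s) * expR (- (lam * u))).
      by rewrite -!expRD; congr expR; ring.
    have es : expR (lam * s) * expR (- lam * s) = 1 by rewrite mulNr -expRD addrN expR0.
    transitivity (b * (expR (p' / n.+1%:R * u) * W u) * expR (- (lam * u))); last first.
      by rewrite /g; ring.
    rewrite (tilt u) -[RHS]mulr1 -es; ring.
  have mC : measurable_fun setT (fun x : R => (expR (- lam * x - k * (x + M) ^+ 2))%:E).
    by apply/measurable_EFinP; mfun.
  have gC (x : R) : (0 <= (expR (- lam * x - k * (x + M) ^+ 2))%:E)%E.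
    by rewrite lee_fin expR_ge0.
  have mCs : measurable_fun setT
      (fun x : R => (expR (- lam * (x + s) - k * (x + s + M) ^+ 2))%:E).
    by apply: (measurableT_comp mC); exact: measurable_funD.
  have e0 : 0 <= expR (k * (2 * s * M + s ^+ 2)) * b * expR (lam * s).
    exact: mulr_ge0 (mulr_ge0 (expR_ge0 _) (ltW b0)) (expR_ge0 _).
  have sh := etrans (nush s _ mC gC) cE.
  rewrite ge0_integralZl; [|exact: measurableT|exact: mCs|by move=> x _; exact: gC
    |by rewrite lee_fin].
  rewrite sh -EFinM; congr (_%:E).
  have -> : a = b * c by rewrite /b divfK// gt_eqF.
  ring.
have W0' x : 0 <= W x by exact: ltW.
have eqA := @weighted_exp_unique _ _ _ _ _ m nu W g id id p' mW mg W0' g0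
  (@measurable_id _ _ setT) (@measurable_id _ _ setT) finm fing p'0 eqn.
(* Integrating 1_A / W against the weight W undoes the weight. *)
pose f (u : R) : \bar R := (\1_A u / W u)%:E.
have mf : measurable_fun setT f.
  apply/measurable_EFinP; apply: measurable_funM; first exact: measurable_indic.
  rewrite (_ : (fun x => _) = (fun x => expR (k * (x + M) ^+ 2))); first by mfun.
  by apply/funext => x; rewrite /W expRN invrK.
have f0 u : (0 <= f u)%E by rewrite lee_fin divr_ge0// ltW.
have := @eq_weighted_integral _ _ _ _ _ _ _ m nu W g id id mW mg
  W0' g0 (@measurable_id _ _ setT) (@measurable_id _ _ setT) eqA f mf f0.
rewrite (_ : (\int[m]_x _)%E = m A); last first.
  transitivity (\int[m]_u (\1_A u)%:E)%E; last by rewrite integral_indic// setIT.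
  by apply: eq_integral => u _; rewrite -EFinM divfK// gt_eqF.
have fgE u : (f u * (g u)%:E = (b * expR (- (lam * u)) * \1_A u)%:E)%E.
  rewrite -EFinM /g; congr (_%:E).
  by move: (W0 u) => w0; field; rewrite gt_eqF.
have mfg : measurable_fun setT (fun u : R => (f u * (g u)%:E)%E).
  by apply: emeasurable_funM => //; exact/measurable_EFinP.
have fg0 u : (0 <= f u * (g u)%:E)%E by rewrite mule_ge0// lee_fin.
move=> mAE; apply: (etrans mAE); apply: (etrans (nuE _ mfg fg0)).
rewrite /exp_measure -ge0_integralZl//; last 2 first.
- by apply: measurable_funTS; apply/measurable_EFinP; mfun.
- by rewrite lee_fin ltW.
pose e (u : measurableTypeR R) : R := b * expR (- (lam * u)).
transitivity (\int[leb]_u (e u * \1_A u)%:E)%E.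
  by apply: eq_integral => u _; exact: fgE.
apply: (etrans (integral_weight_indic leb setT A e)); rewrite setTI.
by apply: eq_integral => u _; rewrite -EFinM.
Qed.

End exponential_intensity.

(** * Stationarity of systems with exponential intensity *)

Section exponential_systems.
Context {R : realType} {d : nat}.
Variables (m : {measure set R -> \bar R}) (xi : process R d) (alpha lam : R).
Hypotheses (alpha_ge0 : 0 <= alpha) (mE : is_scaled_exp_measure m alpha lam).

(** Here [v] is the position of the particle at the first time. *)
Definition increments n (t : n.+1.-tuple 'rV[R]_d) (v : R) (w : proc_space xi) :
  n.+1.-tuple R := [tuple v + (xi (tnth t k) w - xi (tnth t ord0) w) | k < n.+1].

Lemma exp_intensityE : exists nu : {measure set R -> \bar R},
  forall n (t : n.+1.-tuple 'rV[R]_d) F,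
  measurable_fun setT F -> (forall x, 0 <= F x)%E ->
  intensity m xi t F = (\int[nu]_v \int[proc_prob xi]_w
    (F (increments t v w) *
     (expR (lam * xi (tnth t ord0) w) * (alpha * expR (- (lam * v))))%:E))%E.
Proof.
have [nu [nua nu0 nush nuE]] := @line_measureP R.
have [mu muE] := sigma_finite_pack nua.
exists nu => n t F mF F0.
pose P := proc_prob xi; pose x0 := xi (tnth t ord0).
have mx0 : measurable_fun setT x0 by exact: proc_measurable.
pose c (v : R) := alpha * expR (- (lam * v)).
have mc : measurable_fun setT c by rewrite /c; mfun.
have c0 v : 0 <= c v by rewrite mulr_ge0 ?expR_ge0.
have fub (f : R * proc_space xi -> \bar R) : measurable_fun setT f -> (forall z, 0 <= f z)%E ->
    (\int[nu]_v \int[P]_w f (v, w) = \int[P]_w \int[nu]_v f (v, w))%E.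
  move=> mf f0; have fb := fubini_tonelli (m1 := mu) (m2 := P) f mf f0.
  apply: (etrans (congr1 (fun q : set R -> \bar R => \int[q]_v \int[P]_w f (v, w))%E (esym muE))).
  apply: (etrans fb).
  exact: (congr1 (fun q : set R -> \bar R => \int[P]_w \int[q]_v f (v, w))%E muE).
have mFs := measurableT_comp mF (@measurable_shifted_path _ _ xi _ t).
pose f1 (z : R * proc_space xi) : \bar R := (F (shifted_path t z.1 z.2) * (c z.1)%:E)%E.
have mf1 : measurable_fun setT f1.
  apply: emeasurable_funM; first exact: mFs.
  by apply/measurable_EFinP; exact: (measurableT_comp mc measurable_fst).
have f10 z : (0 <= f1 z)%E by rewrite mule_ge0// lee_fin.
have minc : measurable_fun setT (fun z : R * proc_space xi => increments t z.1 z.2).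
  apply: (@measurable_tuple_of _ _ _ _ n.+1 (fun k (z : R * proc_space xi) =>
    z.1 + (xi (tnth t k) z.2 - x0 z.2))) => k.
  apply: measurable_funD; first exact: measurable_fst.
  by apply: measurable_funB; apply: measurableT_comp => //;
    [exact: proc_measurable|exact: measurable_snd..].
pose f2 (z : R * proc_space xi) : \bar R := (F (increments t z.1 z.2) *
  (expR (lam * x0 z.2) * c z.1)%:E)%E.
have mf2 : measurable_fun setT f2.
  apply: emeasurable_funM; first exact: (measurableT_comp mF minc).
  apply/measurable_EFinP; apply: measurable_funM.
    apply: (measurableT_comp (@measurable_expR R)); apply: measurable_funM => //.
    exact: (measurableT_comp mx0 measurable_snd).
  exact: (measurableT_comp mc measurable_fst).
have f20 z : (0 <= f2 z)%E by rewrite mule_ge0// lee_fin mulr_ge0 ?expR_ge0.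
transitivity (\int[nu]_v \int[P]_w f1 (v, w))%E.
  have mG : measurable_fun setT (fun u : R => \int[P]_w F (shifted_path t u w))%E.
    exact: (measurable_fun_fubini_tonelli_F (m2 := P) _ mFs (fun z => F0 _)).
  have G0 u : (0 <= \int[P]_w F (shifted_path t u w))%E by exact: integral_ge0.
  rewrite /intensity (exp_measure_integral alpha_ge0 mE mG G0) -nuE; last 2 first.
  - by apply: emeasurable_funM; [exact: mG|exact/measurable_EFinP].
  - by move=> x; apply: mule_ge0; [exact: G0|rewrite lee_fin; exact: c0].
  apply: eq_integral => u _; rewrite /f1/=.
  have mFu : measurable_fun setT (fun w : proc_space xi => F (shifted_path t u w)).
    exact: (measurableT_comp mFs (measurable_pair1 u)).
  rewrite muleC -ge0_integralZl//; last by rewrite lee_fin; exact: c0.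
  by apply: eq_integral => w _; rewrite muleC.
(* The substitution v = u + x0 w depends on [w]: the integrals are exchanged, translation invariance
   is used for fixed [w], and they are exchanged back. *)
apply: (etrans (fub _ mf1 f10)); apply: (etrans _ (esym (fub _ mf2 f20))).
apply: eq_integral => w _.
have mf2w : measurable_fun setT (fun v => f2 (v, w)).
  exact: (measurableT_comp mf2 (measurable_pair2 w)).
rewrite -(nush (x0 w) _ mf2w (fun v => f20 _)).
apply: eq_integral => u _; rewrite /f1 /f2 /=; congr (F _ * _%:E)%E.
  by apply: eq_from_tnth => k; rewrite !tnth_mktuple /x0; ring.
by rewrite /c mulrCA -expRD; congr (_ * expR _); ring.
Qed.

Variables (mu : 'rV[R]_d -> R) (K : 'rV[R]_d -> 'rV[R]_d -> R) (e : 'rV[R]_d -> R).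
Hypotheses (ximuK : gauss_mgf (proc_prob xi) xi mu K)
  (incK : forall h s t, increment_variance K (s + h) (t + h) = increment_variance K s t)
  (phi_shift : forall h t, mu (t + h) + lam * K (t + h) (t + h) / 2 =
     mu t + lam * K t t / 2 + e h)
  (lam_e : forall h, lam * e h = 0).

(** The time enters the one-point intensity through a single factor; for lam nonzero, stationarity
    then forces mu + lam sigma^2/2 to be constant. *)
Lemma intensity1_exp (Ksym : forall s t, K s t = K t s) :
  exists Q : (R -> \bar R) -> \bar R, forall t psi,
    measurable_fun setT psi -> (forall x, 0 <= psi x)%E ->
    intensity1 m xi t psi = ((expR (lam * (mu t + lam * K t t / 2)))%:E * Q psi)%E.
Proof.
have [nu nuE] := exp_intensityE.
exists (fun psi => \int[nu]_v (psi v * (alpha * expR (- (lam * v)))%:E))%E => t psi mpsi psi0.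
have mF : measurable_fun setT (fun x : 1.-tuple R => psi (tnth x ord0)).
  exact: (measurableT_comp mpsi (measurable_tnth ord0)).
apply: (etrans (@intensity1E R d m xi t psi)).
apply: (etrans (nuE 0%N [tuple t] _ mF (fun x => psi0 _))).
have mc : measurable_fun setT (fun v : R => (psi v * (alpha * expR (- (lam * v)))%:E)%E).
  by apply: emeasurable_funM => //; apply/measurable_EFinP; mfun.
have c0 v : (0 <= (alpha * expR (- (lam * v)))%:E)%E by rewrite lee_fin mulr_ge0 ?expR_ge0.
rewrite -ge0_integralZl; [|exact: measurableT|exact: mc
  |by move=> v _; apply: mule_ge0|by rewrite lee_fin expR_ge0].
apply: eq_integral => v _.
have me : measurable_fun setT (fun w => (expR (lam * xi t w + 0 * xi t w))%:E).
  apply/measurable_EFinP; apply: (measurableT_comp (@measurable_expR R)).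
  by apply: measurable_funD; apply: measurable_funM => //; exact: proc_measurable.
transitivity (\int[proc_prob xi]_w ((psi v * (alpha * expR (- (lam * v)))%:E) *
    (expR (lam * xi t w + 0 * xi t w))%:E))%E.
  apply: eq_integral => w _; rewrite /increments tnth_mktuple subrr addr0 (tnth_nth t).
  by rewrite mul0r addr0 [in LHS]mulrC EFinM muleA.
rewrite ge0_integralZl; [|exact: measurableT|exact: me
  |by move=> w _; rewrite lee_fin expR_ge0|exact: mule_ge0].
rewrite (@gauss_mgf2 _ _ _ _ (proc_prob xi) xi mu K ximuK Ksym t t) muleC.
by congr ((expR _)%:E * _)%E; field.
Qed.

(* Polarization: on combinations with coefficients summing to [lam] the
   exponent only involves increment variances and the one-point function. *)
Lemma exponent_increments n (t : n.-tuple 'rV[R]_d) (b : 'I_n -> R) :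
  \sum_(k < n) b k = lam ->
  \sum_(k < n) b k * mu (tnth t k) + quad_form K t b / 2 =
  \sum_(k < n) b k * (mu (tnth t k) + lam * K (tnth t k) (tnth t k) / 2) -
  (\sum_(j < n) \sum_(k < n)
     b j * b k * increment_variance K (tnth t j) (tnth t k)) / 4.
Proof.
move=> sb.
set A := \sum_(k < n) b k * K (tnth t k) (tnth t k).
have e1 : \sum_(j < n) \sum_(k < n) b j * (b k * K (tnth t k) (tnth t k)) = lam * A.
  by rewrite -sb mulr_suml; apply: eq_bigr => j _; rewrite mulr_sumr.
have e2 : \sum_(j < n) \sum_(k < n) (- 2) * (b j * b k * K (tnth t j) (tnth t k)) =
    (- 2) * quad_form K t b.
  by rewrite mulr_sumr; apply: eq_bigr => j _; rewrite mulr_sumr.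
have e3 : \sum_(j < n) \sum_(k < n) b j * K (tnth t j) (tnth t j) * b k = A * lam.
  by rewrite -sb mulr_suml; apply: eq_bigr => j _; rewrite mulr_sumr.
have -> : \sum_(j < n) \sum_(k < n)
     b j * b k * increment_variance K (tnth t j) (tnth t k) =
   lam * A + ((- 2) * quad_form K t b + A * lam).
  rewrite -e1 -e2 -e3 -!big_split/=; apply: eq_bigr => j _.
  rewrite -!big_split/=; apply: eq_bigr => k _.
  by rewrite /increment_variance; ring.
have -> : \sum_(k < n) b k * (mu (tnth t k) + lam * K (tnth t k) (tnth t k) / 2) =
    \sum_(k < n) b k * mu (tnth t k) + lam / 2 * A.
  rewrite mulr_sumr -big_split/=; apply: eq_bigr => k _; ring.
by field.
Qed.

(** The drift [e h] enters with total coefficient [lam], hence disappears. The hypothesis lam * e h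
    = 0 covers both kinds of systems: lam = 0 with an arbitrary drift, and lam nonzero with none. *)
Lemma exponent_shift n (t : n.-tuple 'rV[R]_d) (b : 'I_n -> R) h :
  \sum_(k < n) b k = lam ->
  \sum_(k < n) b k * mu (tnth t k + h) + quad_form K [tuple tnth t k + h | k < n] b / 2 =
  \sum_(k < n) b k * mu (tnth t k) + quad_form K t b / 2.
Proof.
move=> sb; rewrite (exponent_increments t sb).
have := exponent_increments [tuple tnth t k + h | k < n] sb.
under eq_bigr do rewrite tnth_mktuple.
move=> ->; congr (_ - _ / 4); last first.
  by apply: eq_bigr => j _; apply: eq_bigr => k _; rewrite !tnth_mktuple incK.
under eq_bigr do rewrite tnth_mktuple phi_shift mulrDr.
by rewrite big_split/= -mulr_suml sb lam_e addr0.
Qed.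

Lemma exp_intensity_stationary n (t : n.-tuple 'rV[R]_d) h F :
  measurable_fun setT F -> (forall x, 0 <= F x)%E ->
  intensity m xi [tuple tnth t k + h | k < n] F = intensity m xi t F.
Proof.
case: n t F => [|n] t F mF F0.
  by apply: eq_integral => u _; apply: eq_integral => w _; congr F; apply: eq_from_tnth => -[].
have [nu nuE] := exp_intensityE.
apply: (etrans (nuE n [tuple tnth t k + h | k < n.+1] F mF F0)).
apply: (etrans _ (esym (nuE n t F mF F0))).
apply: eq_integral => v _.
pose D (s : n.+1.-tuple 'rV[R]_d) k w := xi (tnth s k) w - xi (tnth s ord0) w.
pose g (s : n.+1.-tuple 'rV[R]_d) w :=
  expR (lam * xi (tnth s ord0) w) * (alpha * expR (- (lam * v))).
have mD s k : measurable_fun setT (D s k) by apply: measurable_funB; exact: proc_measurable.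
have mg s : measurable_fun setT (g s).
  apply: measurable_funM => //; apply: (measurableT_comp (@measurable_expR R)).
  by apply: measurable_funM => //; exact: proc_measurable.
have g0 s w : 0 <= g s w by rewrite /g !mulr_ge0 ?expR_ge0.
(* Rewrites sum a_k (x_k - x_0) + lam x_0 as a combination of the x_k with coefficients of sum
   [lam], as [exponent_shift] requires. *)
pose b (a : 'I_n.+1 -> R) k := a k + (k == ord0)%:R * (lam - \sum_(j < n.+1) a j).
have pick (f : 'I_n.+1 -> R) : \sum_(k < n.+1) (k == ord0)%:R * f k = f ord0.
  rewrite (bigD1 ord0)//= mul1r big1 ?addr0// => k /negbTE ->; exact: mul0r.
have sb a : \sum_(k < n.+1) b a k = lam.
  by rewrite big_split/= (pick (fun=> lam - \sum_(j < n.+1) a j)) addrC subrK.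
have mgf s a : (\int[proc_prob xi]_w (expR (\sum_(k < n.+1) a k * D s k w) * g s w)%:E =
    (alpha * expR (- (lam * v)))%:E *
    (expR (\sum_(k < n.+1) b a k * mu (tnth s k) + quad_form K s (b a) / 2))%:E)%E.
  have ms : measurable_fun setT
      (fun w => (expR (\sum_(k < n.+1) b a k * xi (tnth s k) w))%:E).
    apply/measurable_EFinP; apply: (measurableT_comp (@measurable_expR R)).
    by apply: measurable_sum => k; apply: measurable_funM => //; exact: proc_measurable.
  rewrite -ximuK -ge0_integralZl; [|exact: measurableT|exact: ms
    |by move=> w _; rewrite lee_fin expR_ge0|by rewrite lee_fin mulr_ge0 ?expR_ge0].
  apply: eq_integral => w _; rewrite -EFinM /g mulrA -expRD mulrC; congr (_ * expR _)%:E.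
  transitivity (\sum_(k < n.+1) (a k * xi (tnth s k) w + (k == ord0)%:R *
      ((lam - \sum_(j < n.+1) a j) * xi (tnth s k) w))); last first.
    by apply: eq_bigr => k _; rewrite /b; ring.
  rewrite big_split/= (pick (fun k => (lam - \sum_(j < n.+1) a j) * xi (tnth s k) w)).
  under eq_bigr do rewrite /D mulrBr.
  by rewrite sumrB -mulr_suml; ring.
pose th := [tuple (tnth t k + h)%R | k < n.+1].
have fin a : (\int[proc_prob xi]_w
    (expR (\sum_(k < n.+1) a k * D th k w) * g th w)%:E < +oo)%E.
  by rewrite mgf -EFinM ltry.
have eqm a : (\int[proc_prob xi]_w (expR (\sum_(k < n.+1) a k * D th k w) * g th w)%:E =
    \int[proc_prob xi]_w (expR (\sum_(k < n.+1) a k * D t k w) * g t w)%:E)%E.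
  rewrite (mgf th) (mgf t) -(exponent_shift t h (sb a)) -/th.
  have -> // : \sum_(k < n.+1) b a k * mu (tnth th k) =
      \sum_(k < n.+1) b a k * mu (tnth t k + h).
  by apply: eq_bigr => k _; rewrite tnth_mktuple.
have eqD := @weighted_tuple_unique _ _ _ _ _ (proc_prob xi) (proc_prob xi) n.+1
  (D th) (D t) (mD th) (mD t) (g th) (g t) (mg th) (mg t) (g0 th) (g0 t) fin eqm.
pose Fv (x : n.+1.-tuple R) := F [tuple v + tnth x k | k < n.+1].
have mFv : measurable_fun setT Fv.
  exact: (measurableT_comp mF (measurableT_comp (@measurable_shift_tuple R n.+1)
    (measurable_pair1 v))).
have mtD s := measurable_tuple_of (mD s).
have key := @eq_weighted_integral _ _ _ _ _ _ _ (proc_prob xi) (proc_prob xi)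
  _ _ _ _ (mg th) (mg t) (g0 th) (g0 t) (mtD th) (mtD t) eqD Fv mFv (fun x => F0 _).
have FvE s w : Fv [tuple D s k w | k < n.+1] = F (increments s v w).
  by congr F; apply: eq_from_tnth => k; rewrite !tnth_mktuple.
apply: (etrans (eq_integral _ _ (fun w _ =>
  congr1 (fun q => q * (g th w)%:E)%E (esym (FvE th w))))).
apply: (etrans key); apply: eq_integral => w _.
exact: (congr1 (fun q => q * (g t w)%:E)%E (FvE t w)).
Qed.

End exponential_systems.

(** * Comparison of Gaussian laws, and stationarity of the three classes *)

Section gaussian_laws.
Context {R : realType} {I : Type}.

Lemma gauss_mgf_unique {d : measure_display} {T : measurableType d}
    (P : probability T R) (X : I -> T -> R) mu K mu' K' :
  gauss_mgf P X mu K -> gauss_mgf P X mu' K' ->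
  (forall s t, K s t = K t s) -> (forall s t, K' s t = K' t s) ->
  (forall t, mu t = mu' t) /\ (forall s t, K s t = K' s t).
Proof.
move=> h h' sK sK'.
have e s t a b : a * mu s + b * mu t +
    (a ^+ 2 * K s s + 2 * (a * b) * K s t + b ^+ 2 * K t t) / 2 =
    a * mu' s + b * mu' t +
    (a ^+ 2 * K' s s + 2 * (a * b) * K' s t + b ^+ 2 * K' t t) / 2.
  by apply: expR_inj; apply: EFin_inj; rewrite -(gauss_mgf2 h sK) (gauss_mgf2 h' sK').
(* Coefficients 1 and 2 at a single time separate the linear from the quadratic part. *)
have muE t : mu t = mu' t.
  by have := e t t 1 0; have := e t t 2 0; lra.
have KE t : K t t = K' t t by have := e t t 1 0; have := muE t; lra.
split=> // s t; have := e s t 1 1.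
by rewrite !muE !KE; lra.
Qed.

Lemma gauss_mgf_moments {d : measure_display} {T : measurableType d}
    (P : probability T R) (X : I -> T -> R) mu K :
  (forall i, measurable_fun setT (X i)) ->
  gauss_mgf P X mu K -> (forall n (t : n.-tuple I) a, 0 <= quad_form K t a) ->
  (forall s t, K s t = K t s) ->
  forall t, ('E_P[X t] = (mu t)%:E /\ 'V_P[X t] = (K t t)%:E)%E.
Proof.
move=> mX h K0 sK t.
have [mu' [K' [h' _ sK' _ EV]]] := gaussian_processP mX (gauss_mgf_gaussian_process mX h K0).
have [muE KE] := gauss_mgf_unique h h' sK sK'.
by rewrite muE KE; exact: EV.
Qed.

Lemma gauss_mgf_shift {d1 d2 : measure_display} {T1 : measurableType d1}
    {T2 : measurableType d2} (P1 : probability T1 R) (P2 : probability T2 R)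
    (X : I -> T1 -> R) (W : I -> T2 -> R) (s : I -> R) mu K :
  (forall i, measurable_fun setT (X i)) -> (forall i, measurable_fun setT (W i)) ->
  (forall n (t : n.-tuple I) (a : 'I_n -> R),
    (\int[P1]_w (expR (\sum_(k < n) a k * X (tnth t k) w))%:E =
     \int[P2]_w (expR (\sum_(k < n) a k * (W (tnth t k) w + s (tnth t k))))%:E)%E) ->
  gauss_mgf P2 W mu K -> gauss_mgf P1 X (fun t => mu t + s t) K.
Proof.
move=> mX mW e h n t a; rewrite e.
have me : measurable_fun setT (fun w => (expR (\sum_(k < n) a k * W (tnth t k) w))%:E).
  apply/measurable_EFinP; apply: (measurableT_comp (@measurable_expR R)).
  by apply: measurable_sum => k; apply: measurable_funM.
transitivity (\int[P2]_w ((expR (\sum_(k < n) a k * s (tnth t k)))%:E *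
    (expR (\sum_(k < n) a k * W (tnth t k) w))%:E))%E.
  apply: eq_integral => w _; rewrite -EFinM -expRD; congr ((expR _)%:E).
  by rewrite -big_split/=; apply: eq_bigr => k _; ring.
rewrite ge0_integralZl; [|exact: measurableT|exact: me
  |by move=> w _; rewrite lee_fin expR_ge0|by rewrite lee_fin expR_ge0].
rewrite h -EFinM -expRD; congr ((expR _)%:E).
rewrite addrA; congr (_ + _); rewrite -big_split/=; apply: eq_bigr => k _; ring.
Qed.

End gaussian_laws.

Lemma increment_variance_shift {R : realType} (V : zmodType) (K : V -> V -> R) :
  (forall h t, increment_variance K h (t + h) = increment_variance K 0 t) ->
  forall h s t, increment_variance K (s + h) (t + h) = increment_variance K s t.
Proof.
move=> e h s t; rewrite -[t in RHS](subrK s) e.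
by rewrite -(e (s + h) (t - s)) addrA subrK.
Qed.

Section backward.
Context {R : realType} {d : nat}.
Variables (m : {measure set R -> \bar R}) (xi : process R d) (G : gaussian_system m xi).

(** The thinning functionals see the times only through the intensity. *)
Lemma stationary_of_intensity : admissible_intensity m ->
  (forall n (t : n.-tuple 'rV[R]_d) h F, measurable_fun setT F -> (forall x, 0 <= F x)%E ->
    intensity m xi [tuple tnth t k + h | k < n] F = intensity m xi t F) ->
  stationary_system G.
Proof.
move=> am st n t h.
have mE i : measurable (gs_present G i) by exact: gs_present_measurable.
have mZ (s : 'I_n -> 'rV[R]_d) i : measurable_fun setT
    (fun w => [tuple particle (G := G) i (s k) w | k < n]).
  by apply: measurable_tuple_of => k; apply: measurable_funD; exact: measurable_funPT.
apply: (@eq_law_points_of_functionals _ _ _ _ _ _ _ _ _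
  (fun g => expeR (- intensity m xi t (EFin \o g)))) => //.
- move=> g mg g01.
  have mg' : measurable_fun setT (EFin \o g) by exact/measurable_EFinP.
  have g0 x : (0 <= (EFin \o g) x)%E by rewrite lee_fin; case/andP: (g01 x).
  rewrite -(st n t h _ mg' g0).
  have c := @system_functional _ _ _ _ G am n [tuple tnth t k + h | k < n] g mg g01.
  have e : (fun i w => [tuple particle (G := G) i (tnth [tuple tnth t k + h | k < n] k) w | k < n]) =
      (fun i w => [tuple particle (G := G) i (tnth t k + h) w | k < n]).
    apply/funext => i; apply/funext => w; apply: eq_from_tnth => k.
    by rewrite !tnth_mktuple.
  by rewrite e in c.
- by move=> g mg g01; exact: system_functional.
Qed.

Let mxi t : measurable_fun setT (xi t). Proof. exact: proc_measurable. Qed.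

Lemma gauss_mgf_of_eq_fdd (W : process R d) (s : 'rV[R]_d -> R) mu K :
  eq_fdd (proc_prob xi) xi (proc_prob W) (fun t w => W t w + s t) ->
  gauss_mgf (proc_prob W) W mu K -> gauss_mgf (proc_prob xi) xi (fun t => mu t + s t) K.
Proof.
have mW t : measurable_fun setT (W t) by exact: proc_measurable.
move=> e h; apply: (gauss_mgf_shift mxi mW) => // n t a.
apply: (eq_fdd_mgf mxi _ e) => i; exact: measurable_funD.
Qed.

Lemma centered_gaussian (W : process R d) : gaussian_process (proc_prob W) W ->
  centered (proc_prob W) W ->
  exists K, [/\ gauss_mgf (proc_prob W) W (fun=> 0) K,
    (forall n (t : n.-tuple 'rV[R]_d) a, 0 <= quad_form K t a),
    (forall s t, K s t = K t s) & forall t, fine 'V_(proc_prob W)[W t] = K t t].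
Proof.
move=> gW cW; have [mu [K [h K0 sK _ EV]]] := gaussian_processP (@proc_measurable _ _ W) gW.
have mu0 : mu = fun=> 0.
  by apply/funext => t; apply: EFin_inj; rewrite -(EV t).1 cW.
by exists K; split => //; [rewrite -mu0|move=> t; rewrite (EV t).2].
Qed.

Lemma S1_stationary : S1 m xi ->
  [/\ admissible_intensity m, gaussian_process (proc_prob xi) xi & stationary_system G].
Proof.
move=> [am [W [c [gW [cW sW] e]]]].
have [K [h K0 sK _]] := centered_gaussian gW cW.
have hx := gauss_mgf_of_eq_fdd e h.
have mW t : measurable_fun setT (W t) by exact: proc_measurable.
split=> //; first exact: (gauss_mgf_gaussian_process mxi hx K0).
have Ksh l s t : K (s + l) (t + l) = K s t.
  (* The shifted process has covariance [K] by stationarity and the shifted covariance by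
     substitution; uniqueness equates the two. *)
  have hl : gauss_mgf (proc_prob W) (fun t => W (t + l)) (fun=> 0) K.
    move=> n u a; rewrite -h; apply: (eq_fdd_mgf _ mW (sW l)) => i; exact: mW.
  have hl' : gauss_mgf (proc_prob W) (fun t => W (t + l)) (fun=> 0) (fun s t => K (s + l) (t + l)).
    move=> n u a; have := h n [tuple tnth u k + l | k < n] a.
    under eq_integral do under eq_bigr do rewrite tnth_mktuple.
    move=> ->; congr ((expR (_ + _ / 2))%:E).
    by apply: eq_bigr => j _; apply: eq_bigr => k _; rewrite !tnth_mktuple.
  by have [_ ->] := gauss_mgf_unique hl' hl (fun s t => sK _ _) sK.
apply: stationary_of_intensity => // n t l F mF F0.
apply: eq_integral => u _.
have law : eq_fdd (proc_prob xi) (fun t => xi (t + l)) (proc_prob xi) xi.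
  have mgf k (v : k.-tuple 'rV[R]_d) a :
      (\int[proc_prob xi]_w (expR (\sum_(j < k) a j * xi (tnth v j + l) w))%:E =
       \int[proc_prob xi]_w (expR (\sum_(j < k) a j * xi (tnth v j) w))%:E)%E.
    have := hx k [tuple tnth v j + l | j < k] a.
    under eq_integral do under eq_bigr do rewrite tnth_mktuple.
    move=> ->; rewrite hx; congr ((expR (_ + _ / 2))%:E).
    by apply: eq_bigr => i _; apply: eq_bigr => j _; rewrite !tnth_mktuple Ksh.
  apply: (eq_fdd_of_mgf _ mxi) => [i|k v a|k v a]; [exact: mxi| |exact: mgf].
  by rewrite mgf hx ltry.
pose Fu (x : n.-tuple R) := F [tuple u + tnth x k | k < n].
have mFu : measurable_fun setT Fu.
  exact: (measurableT_comp mF (measurableT_comp (@measurable_shift_tuple R n)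
    (measurable_pair1 u))).
have mt1 : measurable_fun setT (fun w => [tuple xi (tnth t k + l) w | k < n]).
  by apply: (@measurable_tuple_of _ _ _ _ n (fun k => xi (tnth t k + l))).
have key := eq_law_integral mt1 (@measurable_path _ _ xi _ t) (law n t) mFu (fun x => F0 _).
have E1 w : F (shifted_path [tuple (tnth t k + l)%R | k < n] u w) =
    Fu [tuple xi (tnth t k + l) w | k < n].
  by congr F; apply: eq_from_tnth => k; rewrite !tnth_mktuple.
have E2 w : F (shifted_path t u w) = Fu [tuple xi (tnth t k) w | k < n].
  by congr F; apply: eq_from_tnth => k; rewrite !tnth_mktuple.
apply: (etrans (eq_integral _ _ (fun w _ => E1 w))); apply: (etrans key).
by apply: eq_integral => w _; exact: esym (E2 w).
Qed.

(** Common to the last two classes: [s] is the deterministic part of xi, and [e] the drift of s +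
    lam K/2 along the diagonal. *)
Lemma exp_stationary (alpha lam : R) (W : process R d) (s e : 'rV[R]_d -> R) (K : 'rV[R]_d -> 'rV[R]_d -> R) :
  0 <= alpha -> is_scaled_exp_measure m alpha lam ->
  gauss_mgf (proc_prob W) W (fun=> 0) K ->
  (forall n (t : n.-tuple 'rV[R]_d) a, 0 <= quad_form K t a) ->
  (forall s t, K s t = K t s) ->
  stationary_increments (proc_prob W) W ->
  eq_fdd (proc_prob xi) xi (proc_prob W) (fun t w => W t w + s t) ->
  (forall h t, s (t + h) + lam * K (t + h) (t + h) / 2 = s t + lam * K t t / 2 + e h) ->
  (forall h, lam * e h = 0) ->
  [/\ admissible_intensity m, gaussian_process (proc_prob xi) xi & stationary_system G].
Proof.
move=> a0 mE h K0 sK [_ sW] eW phi le0.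
have am := exp_measure_admissible a0 mE.
have mW t : measurable_fun setT (W t) by exact: proc_measurable.
have hx := gauss_mgf_of_eq_fdd eW h.
have hx' : gauss_mgf (proc_prob xi) xi s K.
  by move: hx; rewrite (_ : (fun t => 0 + s t) = s)//; apply/funext => t; rewrite add0r.
(* Only the variance of an increment from [l] is extracted; [increment_variance_shift] extends its
   invariance to all pairs of times. *)
have incE l t : (\int[proc_prob W]_w (expR (\sum_(k < 1) 1 * (W (tnth [tuple t] k + l) w - W l w)))%:E =
    (expR (increment_variance K l (t + l) / 2))%:E)%E.
  transitivity (\int[proc_prob W]_w (expR (1 * W (t + l) w + (- 1) * W l w))%:E)%E.
    apply: eq_integral => w _; rewrite big_ord1 (tnth_nth 0) /=; congr ((expR _)%:E); ring.
  rewrite (gauss_mgf2 h sK); congr ((expR _)%:E); rewrite /increment_variance (sK l (t + l)).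
  by field.
have inc l t : increment_variance K l (t + l) = increment_variance K 0 t.
  have mI l' i : measurable_fun setT (fun w => W (i + l') w - W l' w) by exact: measurable_funB.
  have := eq_fdd_mgf (mI l) (mI 0) (sW l 0) [tuple t] (fun=> 1).
  rewrite (incE l t) (incE 0 t) addr0 => -[] /expR_inj; lra.
split=> //; first exact: (gauss_mgf_gaussian_process mxi hx' K0).
apply: stationary_of_intensity => // n t l F mF F0.
exact: (exp_intensity_stationary a0 mE hx' (increment_variance_shift inc) phi le0).
Qed.

Lemma S2_stationary : S2 m xi ->
  [/\ admissible_intensity m, gaussian_process (proc_prob xi) xi & stationary_system G].
Proof.
move=> [alpha [c [W [f [[a0 mE] gW iW af e]]]]].
have [K [h K0 sK _]] := centered_gaussian gW iW.1.
apply: (@exp_stationary alpha 0 W (fun t => f t + c) f K (ltW a0) mE h K0 sK iW).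
- rewrite (_ : (fun t w => W t w + (f t + c)) = (fun t w => W t w + f t + c))//.
  by apply/funext => t; apply/funext => w; rewrite addrA.
- by move=> l t; rewrite af; ring.
- by move=> l; rewrite mul0r.
Qed.

Lemma S3_stationary : S3 m xi ->
  [/\ admissible_intensity m, gaussian_process (proc_prob xi) xi & stationary_system G].
Proof.
move=> [alpha [lam [c [W [[a0 lam0] mE gW iW e]]]]].
have [K [h K0 sK VK]] := centered_gaussian gW iW.1.
apply: (@exp_stationary alpha lam W (fun t => - lam * K t t / 2 + c) (fun=> 0) K
  (ltW a0) mE h K0 sK iW).
- rewrite (_ : (fun t w => W t w + (- lam * K t t / 2 + c)) =
    (fun t w => W t w - lam * fine 'V_(proc_prob W)[W t] / 2 + c))//.
  by apply/funext => t; apply/funext => w; rewrite VK; ring.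
- by move=> l t; ring.
- by move=> l; rewrite mulr0.
Qed.

End backward.

(** A negative q(t) would make q(n t) = n q(t) unbounded below; so q(t) and q(-t) = - q(t) are both
    nonnegative. *)
Lemma bounded_below_additive_eq0 {R : realType} (V : lmodType R) (q : V -> R) (c : R) :
  (forall s t, q (s + t) = q s + q t) -> (forall t, - c <= q t) -> forall t, q t = 0.
Proof.
move=> qD qc.
have q0 : q 0 = 0 by have := qD 0 0; rewrite addr0; lra.
have qn t n : q (t *+ n) = n%:R * q t.
  elim: n => [|n IH]; first by rewrite mulr0n q0 mul0r.
  by rewrite mulrS qD IH -[n.+1]addn1 natrD; ring.
have qge0 t : 0 <= q t.
  rewrite leNgt; apply/negP => qt.
  have nt : 0 < - q t by lra.
  have [N] : exists N : nat, `|c / q t| < N.+1%:R.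
    by exists (Num.trunc `|c / q t|); exact: truncnS_gt.
  rewrite normrM normfV (ltr0_norm qt) ltr_pdivrMr// => h2.
  have := qc (t *+ N.+1); rewrite qn; have := ler_norm c; lra.
move=> t; apply/eqP; rewrite eq_le qge0 andbT.
have := qge0 (- t); have := qD t (- t); rewrite subrr q0; lra.
Qed.

Lemma additive_inv_nat {R : realType} (V : lmodType R) (q : V -> R) (t : V) n :
  (forall s t, q (s + t) = q s + q t) -> q (n.+1%:R^-1 *: t) = q t / n.+1%:R.
Proof.
move=> qD.
have q0 : q 0 = 0 by have := qD 0 0; rewrite addr0; lra.
have qn s k : q (s *+ k) = k%:R * q s.
  elim: k => [|k IH]; first by rewrite mulr0n q0 mul0r.
  by rewrite mulrS qD IH -[k.+1]addn1 natrD; ring.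
have := qn (n.+1%:R^-1 *: t) n.+1.
rewrite -scaler_nat scalerA divff ?pnatr_eq0// scale1r => ->.
by rewrite mulrAC divff ?mul1r ?pnatr_eq0.
Qed.

Lemma mule_expR_inj {R : realType} (x y : R) (q : \bar R) :
  ((expR x)%:E * q = (expR y)%:E * q)%E ->
  (0 < (expR y)%:E * q)%E -> ((expR y)%:E * q < +oo)%E -> x = y.
Proof.
case: q => [q e||].
- rewrite -EFinM lte_fin pmulr_rgt0 ?expR_gt0// => q0 _.
  by move: e => [] /mulIf h; apply/expR_inj/h; rewrite gt_eqF.
- by move=> _ _; rewrite gt0_muley ?lte_fin ?expR_gt0// ltxx.
- by move=> _; rewrite gt0_muleNy ?lte_fin ?expR_gt0.
Qed.

Lemma EFin_mulI {R : realType} (c : R) (x y : \bar R) :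
  0 < c -> (c%:E * x = c%:E * y)%E -> x = y.
Proof.
move=> c0 /(congr1 (fun q => (c^-1%:E * q)%E)).
by rewrite !muleA -EFinM mulVf ?gt_eqF// !mul1e.
Qed.

(** * From stationarity to the three classes *)

Section forward.
Context {R : realType} {d : nat}.
Variables (m : {measure set R -> \bar R}) (xi : process R d).
Hypotheses (am : admissible_intensity m) (m_neq0 : m setT != 0%E).
Variables (mu : 'rV[R]_d -> R) (K : 'rV[R]_d -> 'rV[R]_d -> R).
Hypotheses (ximuK : gauss_mgf (proc_prob xi) xi mu K)
  (K0 : forall n (t : n.-tuple 'rV[R]_d) a, 0 <= quad_form K t a)
  (Ksym : forall s t, K s t = K t s)
  (xiq : forall t, gauss_quad_law (proc_prob xi) (xi t) (mu t) (K t t)).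
Hypothesis stat : forall n (t : n.-tuple 'rV[R]_d) h F,
  measurable_fun setT F -> (forall x, 0 <= F x)%E ->
  intensity m xi [tuple tnth t k + h | k < n] F = intensity m xi t F.

Let mxi t : measurable_fun setT (xi t). Proof. exact: proc_measurable. Qed.

Let gauss s : R -> \bar R := fun x => (expR (- (x + s) ^+ 2))%:E.
Let mgauss s : measurable_fun setT (gauss s).
Proof. by apply/measurable_EFinP; mfun. Qed.
Let gauss_ge0 s x : (0 <= gauss s x)%E.
Proof. by rewrite lee_fin expR_ge0. Qed.

Let center (s : 'rV[R]_d -> R) (t : 'rV[R]_d) (w : proc_space xi) : R := xi t w - s t.
Let mcenter s t : measurable_fun setT (center s t).
Proof. by apply: measurable_funB. Qed.
Let W (s : 'rV[R]_d -> R) : process R d :=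
  @Process R d _ _ (proc_prob xi) (center s) (mcenter s).

Let inc h t : increment_variance K h (t + h) = increment_variance K 0 t.
Proof.
have := variance_gap_eq0 am m_neq0 ximuK Ksym xiq stat h t.
by rewrite /variance_gap; lra.
Qed.

Let W_mgf : gauss_mgf (proc_prob (W mu)) (W mu) (fun=> 0) K.
Proof.
have e : gauss_mgf (proc_prob (W mu)) (W mu) (fun t => mu t + - mu t) K.
  apply: (gauss_mgf_shift (W := xi) (s := fun t => - mu t) _ _ _ ximuK) => [i|i|n t a//].
    exact: mcenter.
  exact: mxi.
by move: e; rewrite (_ : (fun t => mu t + - mu t) = fun=> 0)//; apply/funext => t; rewrite subrr.
Qed.

Let W_gaussian : gaussian_process (proc_prob (W mu)) (W mu).
Proof. exact: (gauss_mgf_gaussian_process (@proc_measurable _ _ (W mu)) W_mgf K0). Qed.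

Let W_moments t :
  ('E_(proc_prob (W mu))[W mu t] = 0%:E /\ 'V_(proc_prob (W mu))[W mu t] = (K t t)%:E)%E.
Proof. exact: (gauss_mgf_moments (@proc_measurable _ _ (W mu)) W_mgf K0 Ksym). Qed.

Let W_increments : stationary_increments (proc_prob (W mu)) (W mu).
Proof.
split; first by move=> t; exact: (W_moments t).1.
have mW t : measurable_fun setT (W mu t) by exact: mcenter.
have mI l i : measurable_fun setT (fun w => W mu (i + l) w - W mu l w).
  by exact: measurable_funB.
(* Prepends time 0 with coefficient - sum a, so that a combination of increments becomes a
   combination of values with coefficients of sum 0. *)
pose b n (a : 'I_n -> R) (k : 'I_n.+1) : R :=
  if unlift ord0 k is Some j then a j else - \sum_(j < n) a j.
have b0 n (a : 'I_n -> R) : b n a ord0 = - \sum_(j < n) a j by rewrite /b unlift_none.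
have bS n (a : 'I_n -> R) k : b n a (lift ord0 k) = a k by rewrite /b liftK.
have sb n (a : 'I_n -> R) : \sum_(k < n.+1) b n a k = 0.
  by rewrite big_ord_recl b0 (eq_bigr _ (fun k _ => bS n a k)) addNr.
pose E n (t : n.-tuple 'rV[R]_d) (a : 'I_n -> R) :=
  \sum_(k < n.+1) b n a k * 0 + quad_form K [tuple of 0 :: t] (b n a) / 2.
have mgf l n (t : n.-tuple 'rV[R]_d) (a : 'I_n -> R) :
    (\int[proc_prob (W mu)]_w
      (expR (\sum_(k < n) a k * (W mu (tnth t k + l) w - W mu l w)))%:E =
     (expR (E n t a))%:E)%E.
  pose s := [tuple tnth [tuple of 0 :: t] k + l | k < n.+1].
  transitivity (\int[proc_prob (W mu)]_w
      (expR (\sum_(k < n.+1) b n a k * W mu (tnth s k) w))%:E)%E.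
    apply: eq_integral => w _; congr ((expR _)%:E).
    rewrite big_ord_recl b0 tnth_mktuple tnth0 add0r.
    have -> : \sum_(k < n) b n a (lift ord0 k) * W mu (tnth s (lift ord0 k)) w =
        \sum_(k < n) a k * W mu (tnth t k + l) w.
      by apply: eq_bigr => k _; rewrite bS tnth_mktuple tnthS.
    rewrite (eq_bigr _ (fun k _ => mulrBr _ _ _)).
    by rewrite sumrB -mulr_suml mulNr addrC.
  rewrite (W_mgf s (b n a)); congr ((expR _)%:E).
  (* The case lam = 0 with zero mean and drift: for coefficients of sum 0 the exponent only involves
     increment variances. *)
  apply: (@exponent_shift _ _ 0 (fun=> 0) K (fun=> 0) (increment_variance_shift inc)).
  - by move=> h t'; rewrite !mul0r !addr0.
  - by move=> h; rewrite mul0r.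
  - exact: sb.
move=> h h'; apply: (eq_fdd_of_mgf (mI h) (mI h')) => [n t a|n t a].
  by rewrite mgf ltry.
by rewrite !mgf.
Qed.

Let xi_eq_fdd (V : process R d) (f : 'rV[R]_d -> proc_space xi -> R) :
  (forall t w, xi t w = f t w) -> eq_fdd (proc_prob xi) xi (proc_prob xi) f.
Proof.
by move=> e; have -> : f = xi by apply/funext => t; apply/funext => w.
Qed.

(** The relation between gaps makes phi(t) = mu(t) + lam K(t, t)/2 additive up to a constant. For
    lam = 0 this is the additive part in [S2]; for lam nonzero [intensity1_exp] and stationarity
    make phi constant, which is the mean prescribed by [S3]. *)
Lemma exp_case (alpha lam : R) : 0 < alpha -> is_scaled_exp_measure m alpha lam ->
  (forall h t, drift_gap mu h t = lam * shift_gap K h t) -> S2 m xi \/ S3 m xi.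
Proof.
move=> a0 mE rel.
pose phi t := mu t + lam * K t t / 2.
have phiD h t : phi (t + h) = phi t + phi h - phi 0.
  have := rel h t; have := inc h t.
  rewrite /phi /drift_gap /shift_gap /increment_variance => h1 h2.
  have h3 : 2 * (lam * (K h (t + h) - K h h - (K 0 t - K 0 0))) =
      lam * (K (t + h) (t + h) - K h h - K t t + K 0 0).
    rewrite -[K (t + h) (t + h)](subrK (2 * K h (t + h))).
    have -> : K (t + h) (t + h) - 2 * K h (t + h) =
      K t t - 2 * K 0 t + K 0 0 - K h h by lra.
    ring.
  lra.
have [lam0|lam0] := eqVneq lam 0.
  left; exists alpha, (mu 0), (W mu), (fun t => mu t - mu 0); split.
  - by split=> //; rewrite -lam0.
  - exact: W_gaussian.
  - exact: W_increments.
  - by move=> t1 t2; have := phiD t2 t1; rewrite /phi lam0 !mul0r !addr0 => ->; ring.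
  - by apply: xi_eq_fdd => [//|t w]; rewrite /= /center; ring.
right; exists alpha, lam, (phi 0), (W mu); split => //.
apply: xi_eq_fdd => [//|t w].
have [Q QE] := intensity1_exp (ltW a0) mE ximuK Ksym.
have e := QE t _ (mgauss 0) (gauss_ge0 0); have e0 := QE 0 _ (mgauss 0) (gauss_ge0 0).
have st := intensity1_stationary stat t (mgauss 0) (gauss_ge0 0).
have /andP[J0 Joo] := intensity1_gauss_gt0_lty am m_neq0 xiq 0 0.
have phit : phi t = phi 0.
  have eqQ := etrans (esym e) (etrans st e0).
  have J0' := eq_ind _ (fun q : \bar R => is_true (0 < q)%E) J0 _ e0.
  have Joo' := eq_ind _ (fun q : \bar R => is_true (q < +oo)%E) Joo _ e0.
  exact: (mulfI lam0 (mule_expR_inj eqQ J0' Joo')).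
rewrite (W_moments t).2 /= /center -phit /phi; ring.
Qed.

Let scaled_measure p lam : p != 0 ->
  (forall n : nat, intensity1 m xi 0 (gauss (p / n.+1%:R)) =
    ((expR (lam * (p / n.+1%:R)))%:E * intensity1 m xi 0 (gauss 0))%E) ->
  exists2 alpha, 0 < alpha & is_scaled_exp_measure m alpha lam.
Proof.
move=> p0 JE.
have k0 : 0 < 1 + 2 * K 0 0 by have := (xiq 0).1; lra.
have ki0 : 0 < (1 + 2 * K 0 0)^-1 by rewrite invr_gt0.
apply: (gauss_translates_exp_measure (k := (1 + 2 * K 0 0)^-1) (M := mu 0) am m_neq0 ki0 p0).
move=> n; have := JE n.
rewrite /gauss !(intensity1_gaussE m xiq) addr0 muleCA.
have c0 : 0 < (Num.sqrt (1 + 2 * K 0 0))^-1 by rewrite invr_gt0 sqrtr_gt0.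
by move=> /(EFin_mulI c0).
Qed.

Lemma forward_cases : S1 m xi \/ S2 m xi \/ S3 m xi.
Proof.
have [[[h t] p0]|nop] := pselect (exists ht, shift_gap K ht.1 ht.2 != 0).
  right; set p := shift_gap _ _ _ in p0; pose lam := drift_gap mu h t / p.
  (* The weight r/p turns one nonzero gap into a rule for every real translation. *)
  have sh r psi : measurable_fun setT psi -> (forall x, 0 <= psi x)%E ->
      (intensity1 m xi 0 (fun x => psi (x + r)%R) =
       (expR (lam * r))%:E * intensity1 m xi 0 psi)%E.
    move=> mpsi psi0.
    have := intensity1_shift0 am m_neq0 ximuK Ksym xiq stat h t (r / p) mpsi psi0.
    rewrite -/p divfK//= => ->; congr ((expR _)%:E * _)%E.
    by rewrite /lam; field.
  have [alpha a0 mE] : exists2 alpha, 0 < alpha & is_scaled_exp_measure m alpha lam.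
    apply: (scaled_measure p0) => n.
    rewrite -(sh _ _ (mgauss 0) (gauss_ge0 0)); congr (intensity1 m xi 0 _).
    by apply/funext => x; rewrite /gauss addr0.
  apply: (exp_case a0 mE) => h' t'.
  by apply: (drift_gap_unique am m_neq0 ximuK Ksym xiq stat) => psi mpsi psi0; exact: sh.
have sg0 h t : shift_gap K h t = 0.
  by apply/eqP/negPn/negP => p0; apply: nop; exists (h, t).
have dg0 h t : drift_gap mu h t = 0.
  apply: (drift_gap_unique am m_neq0 ximuK Ksym xiq stat) => psi mpsi psi0.
  rewrite expR0 mul1e; congr (intensity1 m xi 0 _).
  by apply/funext => x; rewrite sg0 addr0.
(* With vanishing gaps and invariant increment variances, K(t, t) - K(0, 0) is additive in t; being
   at least - K(0, 0), it is zero. *)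
have Kd t : K t t = K 0 0.
  apply/eqP; rewrite -subr_eq0; apply/eqP.
  apply: (@bounded_below_additive_eq0 _ 'rV[R]_d (fun t => K t t - K 0 0) (K 0 0)) => [s u|u].
    have := inc u s; have := sg0 u s; rewrite /increment_variance /shift_gap; lra.
  have := (xiq u).1; lra.
have Ksh l s t : K (s + l) (t + l) = K s t.
  have e h u : K h (u + h) = K 0 u by have := sg0 h u; rewrite /shift_gap !Kd; lra.
  by rewrite -[t in RHS](subrK s) e -(e (s + l) (t - s)) addrA subrK.
have muD s t : mu (s + t) - mu 0 = (mu s - mu 0) + (mu t - mu 0).
  by have := dg0 t s; rewrite /drift_gap; lra.
have [[t mut]|muc] := pselect (exists t, mu t - mu 0 != 0).
  right; have [alpha a0 mE] : exists2 alpha, 0 < alpha & is_scaled_exp_measure m alpha 0.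
    apply: (scaled_measure mut) => n; rewrite mul0r expR0 mul1e.
    (* At t' and at 0 the one-point intensities agree and so do the variances; the means differ by
       (mu t - mu 0)/(n+1), which translates the Gaussian transform of [m]. *)
    pose t' := n.+1%:R^-1 *: t.
    have ft : mu t' - mu 0 = (mu t - mu 0) / n.+1%:R.
      exact: (@additive_inv_nat _ _ (fun s => mu s - mu 0) t n muD).
    rewrite -(intensity1_stationary stat t' (mgauss 0) (gauss_ge0 0)) -ft.
    rewrite /gauss (intensity1_gaussE m xiq (mu t' - mu 0) 0) (intensity1_gaussE m xiq 0 t').
    by rewrite (Kd t') (_ : mu 0 + (mu t' - mu 0) = mu t' + 0)//; ring.
  by apply: (exp_case a0 mE) => h u; rewrite dg0 mul0r.
left; split => //; exists (W mu), (mu 0).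
have mu0 t : mu t = mu 0.
  by apply/eqP; rewrite -subr_eq0; apply/negPn/negP => e; apply: muc; exists t.
split; first exact: W_gaussian.
- split; first exact: W_increments.1.
  have mW t : measurable_fun setT (W mu t) by exact: mcenter.
  have mgf l n (t : n.-tuple 'rV[R]_d) (a : 'I_n -> R) :
     (\int[proc_prob (W mu)]_w (expR (\sum_(k < n) a k * W mu (tnth t k + l) w))%:E =
      \int[proc_prob (W mu)]_w (expR (\sum_(k < n) a k * W mu (tnth t k) w))%:E)%E.
    have := W_mgf [tuple tnth t k + l | k < n] a.
    under eq_integral do under eq_bigr do rewrite tnth_mktuple.
    move=> ->; rewrite W_mgf; congr ((expR (_ + _ / 2))%:E).
    by apply: eq_bigr => i _; apply: eq_bigr => j _; rewrite !tnth_mktuple Ksh.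
  move=> h; apply: (eq_fdd_of_mgf _ mW) => [i|n t a|n t a]; [exact: mW| |exact: mgf].
  by rewrite mgf W_mgf ltry.
- by apply: xi_eq_fdd => [//|t w]; rewrite /= /center mu0; ring.
Qed.

End forward.

Unset Implicit Arguments.
Set Strict Implicit.
Set Printing Implicit Defensive.

Theorem theorem1p1 (R : realType) (d : nat) (hd : (0 < d)%N)
    (m : {measure set R -> \bar R}) (m_neq0 : m setT != 0%E)
    (xi : process R d) (G : gaussian_system m xi) :
  [/\ admissible_intensity m, gaussian_process (proc_prob xi) xi &
      stationary_system G] <->
  S1 m xi \/ S2 m xi \/ S3 m xi.
Proof.
split=> [[am gx st]|[h|[h|h]]].
- have [mu [K [h K0 sK xq _]]] := gaussian_processP (@proc_measurable _ _ xi) gx.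
  exact: (forward_cases am m_neq0 h K0 sK xq (stationary_intensity am st)).
- exact: S1_stationary.
- exact: S2_stationary.
- exact: S3_stationary.
Qed.
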